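(* Let $\overline{X}=(X_0,X_1)$ be a compatible pair of complex Banach spaces and let $\theta\in(0,1)$. Assume that $X_0$ has the Radon–Nikodym property, that is, $\hom(L^1,X_0)=L^\infty(X_0)$ under the natural identification. Then $\overline{X}_\theta=\overline{X}^{\theta}$ with equality of norms.
   Context: A compatible pair $\overline{X}=(X_0,X_1)$ consists of two complex Banach spaces continuously embedded in a common Hausdorff topological vector space. $\Sigma=X_0+X_1$ is a Banach space with norm $\|a\|_\Sigma=\inf\{\|a_0\|_{X_0}+\|a_1\|_{X_1}: a=a_0+a_1,\ a_k\in X_k\}$. For a Banach space $X$: $\hom(L^1,X)$ is the space of continuous linear maps $L^1(\mathbb{R})\to X$ (Lebesgue measure), and $L^\infty(X)$ is the space of (classes of) essentially bounded strongly measurable functions $\mathbb{R}\to X$; the natural identification sends $h\in L^\infty(X)$ to the operator $\varphi\mapsto\int h(y)\varphi(y)\,dy$. So the hypothesis says that every continuous linear map $L^1(\mathbb{R})\to X_0$ is of this form. Let $S=\{z\in\mathbb{C}:0\le \operatorname{Re} z\le 1\}$ and $S^i=\{0<\operatorname{Re} z<1\}$, $z=x+iy$; regard $(0,1)\subset S^i$. First Calderón space: $A(\overline{X})$ is the space of bounded continuous functions $f:S\to\Sigma$, holomorphic in $S^i$, such that for $k=0,1$ the map $y\mapsto f(k+iy)$ is a bounded continuous function $\mathbb{R}\to X_k$; its norm is $\|f\|=\max_{k=0,1}\sup_{y}\|f(k+iy)\|_{X_k}$. Then $\overline{X}_\theta=\{f(\theta): f\in A(\overline{X})\}$, with norm $\|a\|_{\overline{X}_\theta}=\inf\{\|f\|: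 f\in A(\overline{X}),\ f(\theta)=a\}$. Second Calderón space: $B(\overline{X})$ is the space of functions $g:S\to\Sigma$ that are continuous on $S$, holomorphic in $S^i$, satisfy $\|g(z)\|_\Sigma=O(|y|)$ as $|y|\to\infty$ (uniformly in $x$), and are such that for $k=0,1$ the differences $g(k+iy+it)-g(k+iy)$ belong to $X_k$ for all real $y,t$, with $\|g(k+iy+it)-g(k+iy)\|_{X_k}\le c|t|$ for some constant $c$ independent of $y,t$. Let $\|g\|_{B}$ be the smallest $c$ for which this inequality holds for both $k=0,1$. Then $\overline{X}^\theta=\{g'(\theta): g\in B(\overline{X})\}$, with norm $\|a\|_{\overline{X}^\theta}=\inf\{\|g\|_B: g\in B(\overline{X}),\ g'(\theta)=a\}$. *)

(* Defs.v *)
From HB Require Import structures.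
From mathcomp Require Import all_boot all_order all_algebra.
From mathcomp Require Import complex lra.
From mathcomp Require Import all_classical all_reals all_analysis.
Set Implicit Arguments.
Unset Strict Implicit.
Unset Printing Implicit Defensive.
Import Order.TTheory GRing.Theory Num.Theory.
Import numFieldNormedType.Exports.
Local Open Scope classical_set_scope.
Local Open Scope complex_scope.
Local Open Scope ring_scope.

(* Norms of complex normed spaces take their values in R[i]; they are
   nonnegative, so their real part carries all the information. *)
Definition rnorm (R : realType) (E : normedZmodType R[i]) (x : E) : R :=
  complex.Re `|x|.

(* The endpoint X_k is indexed by k : bool, with false for 0 and true for 1. *)
Record compatible_pair (R : realType) := CompatiblePair {
  endpoint :> bool -> completeNormedModType R[i] ;
  ambient : topologicalLmodType R[i] ;
  ambient_hausdorff : hausdorff_space ambient ;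
  embed : forall k : bool, {linear endpoint k -> ambient} ;
  embed_inj : forall k, injective (embed k) ;
  embed_continuous : forall k, continuous (embed k) }.

Section real_norm.
Context (R : realType).

Lemma rnormE (E : normedZmodType R[i]) (x : E) : (rnorm x)%:C = `|x|.
Proof. by rewrite /rnorm RRe_real// normr_real. Qed.

Lemma rnorm_ge0 (E : normedZmodType R[i]) (x : E) : 0 <= rnorm x.
Proof. by rewrite -lecR rnormE normr_ge0. Qed.

Lemma rnormD (E : normedZmodType R[i]) (x y : E) :
  rnorm (x + y) <= rnorm x + rnorm y.
Proof. by rewrite -lecR rmorphD/= !rnormE ler_normD. Qed.

Lemma rnormZ (E : normedModType R[i]) (l : R[i]) (x : E) :
  rnorm (l *: x) = rnorm l * rnorm x.
Proof.
have inj : injective (fun r : R => r%:C) by move=> a b [].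
by apply: inj; rewrite rmorphM/= !rnormE normrZ.
Qed.

End real_norm.

Section sum_space.
Context (R : realType) (X : compatible_pair R).

Definition in_sum : {pred ambient X} := fun v =>
  `[< exists a0 : X false, exists a1 : X true,
        v = embed X false a0 + embed X true a1 >].

Lemma in_sum_submod : submod_closed in_sum.
Proof.
split=> [|l u v /asboolP[a0 [a1 ->]] /asboolP[b0 [b1 ->]]].
  by apply/asboolP; exists 0, 0; rewrite !linear0 addr0.
apply/asboolP; exists (l *: a0 + b0), (l *: a1 + b1).
by rewrite !linearP scalerDr addrACA.
Qed.

HB.instance Definition _ :=
  GRing.isSubmodClosed.Build R[i] (ambient X) in_sum in_sum_submod.

Definition Sigma : Type := {v : ambient X | in_sum v}.

HB.instance Definition _ := SubChoice.on Sigma.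
HB.instance Definition _ :=
  [SubChoice_isSubLmodule of Sigma by <:].

Definition sigma_decomp (a : Sigma) : set R :=
  [set r | exists a0 : X false, exists a1 : X true,
     val a = embed X false a0 + embed X true a1 /\
     r = rnorm a0 + rnorm a1].

Definition sigma_norm (a : Sigma) : R := inf (sigma_decomp a).

Lemma sigma_decomp_neq0 (a : Sigma) : sigma_decomp a !=set0.
Proof.
case: a => v hv; move/asboolP: (hv) => [a0 [a1 e]].
by exists (rnorm a0 + rnorm a1), a0, a1.
Qed.

Lemma sigma_decomp_ge0 (a : Sigma) : lbound (sigma_decomp a) 0.
Proof. by move=> _ [a0 [a1 [_ ->]]]; rewrite addr_ge0 ?rnorm_ge0. Qed.

Lemma sigma_norm_ge0 (a : Sigma) : 0 <= sigma_norm a.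
Proof.
by apply: lb_le_inf; [exact: sigma_decomp_neq0|exact: sigma_decomp_ge0].
Qed.

Lemma sigma_norm_le (a : Sigma) r : sigma_decomp a r -> sigma_norm a <= r.
Proof. by move=> h; apply: ge_inf => //; exists 0; exact: sigma_decomp_ge0. Qed.

Lemma sigma_norm_adh (a : Sigma) e : 0 < e ->
  exists2 r, sigma_decomp a r & r < sigma_norm a + e.
Proof.
move=> e0; apply: inf_adherent => //; split; first exact: sigma_decomp_neq0.
by exists 0; exact: sigma_decomp_ge0.
Qed.

Lemma sigma_normD (a b : Sigma) :
  sigma_norm (a + b) <= sigma_norm a + sigma_norm b.
Proof.
apply/ler_addgt0Pr => e e0.
have e20 : 0 < e / 2 by rewrite divr_gt0.
have [_ [a0 [a1 [ea ->]]] la] := sigma_norm_adh a e20.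
have [_ [b0 [b1 [eb ->]]] lb] := sigma_norm_adh b e20.
have : sigma_decomp (a + b) (rnorm (a0 + b0) + rnorm (a1 + b1)).
  exists (a0 + b0), (a1 + b1); split => //.
  by rewrite raddfD/= ea eb !raddfD/= addrACA.
move=> /sigma_norm_le /le_trans; apply.
have := rnormD a0 b0; have := rnormD a1 b1; move: la lb.
rewrite [in X in _ -> _ -> _ -> _ -> X](splitr e); lra.
Qed.

Lemma sigma_normZ_le (l : R[i]) (a : Sigma) :
  sigma_norm (l *: a) <= rnorm l * sigma_norm a.
Proof.
apply/ler_addgt0Pr => e e0.
have l1 : 0 < rnorm l + 1 by rewrite ltr_wpDl// rnorm_ge0.
have [_ [a0 [a1 [ea ->]]] la] := sigma_norm_adh a (divr_gt0 e0 l1).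
have : sigma_decomp (l *: a) (rnorm (l *: a0) + rnorm (l *: a1)).
  by exists (l *: a0), (l *: a1); split => //; rewrite linearZ/= ea scalerDr !linearZ.
move=> /sigma_norm_le /le_trans; apply.
rewrite !rnormZ -mulrDr.
apply: (le_trans (ler_wpM2l (rnorm_ge0 l) (ltW la))).
rewrite mulrDr lerD2l mulrCA ger_pMr// ler_pdivrMr// mul1r lerDl//.
Qed.

Lemma sigma_norm0 : sigma_norm 0 = 0.
Proof.
apply/eqP; rewrite eq_le sigma_norm_ge0 andbT; apply: sigma_norm_le.
by exists 0, 0; rewrite !linear0 addr0 /rnorm !normr0 addr0.
Qed.

Lemma sigma_normZ (l : R[i]) (a : Sigma) :
  sigma_norm (l *: a) = rnorm l * sigma_norm a.
Proof.
apply/eqP; rewrite eq_le sigma_normZ_le/=.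
have [->|l0] := eqVneq l 0; first by rewrite /rnorm normr0 mul0r sigma_norm_ge0.
have h := sigma_normZ_le l^-1 (l *: a).
rewrite scalerA mulVf// scale1r in h.
have : rnorm l * rnorm l^-1 = 1.
  by have := @rnormZ R R[i]^o l l^-1; rewrite /GRing.scale/= => <-; rewrite mulfV// /rnorm normr1.
move=> e; apply: (le_trans (ler_wpM2l (rnorm_ge0 l) h)).
by rewrite mulrA e mul1r.
Qed.

Lemma rnorm_cvg0 (E : normedModType R[i]) (u : nat -> E) :
  (forall n, rnorm (u n) < n.+1%:R^-1) -> u n @[n --> \oo] --> (0 : E).
Proof.
move=> h; apply/cvgr0Pnorm_lt => e e0.
have ee : (complex.Re e)%:C = e by rewrite RRe_real// gtr0_real.
have Re0 : 0 < complex.Re e by rewrite -ltcR ee.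
near=> n; rewrite -rnormE -ee ltcR; apply: (lt_trans (h n)).
by near: n; exact: (near_infty_natSinv_lt (PosNum Re0)).
Unshelve. all: by end_near. Qed.

Lemma sigma_norm0_eq0 (a : Sigma) : sigma_norm a = 0 -> a = 0.
Proof.
move=> a0.
have /choice[u hu] (n : nat) : exists p : X false * X true,
    val a = embed X false p.1 + embed X true p.2 /\
    rnorm p.1 + rnorm p.2 < n.+1%:R^-1.
  have n0 : 0 < n.+1%:R^-1 :> R by rewrite invr_gt0.
  have [_ [b0 [b1 [e ->]]]] := sigma_norm_adh a n0.
  by rewrite a0 add0r => h; exists (b0, b1).
have c k (v : nat -> X k) : v n @[n --> \oo] --> (0 : X k) ->
    embed X k (v n) @[n --> \oo] --> (0 : ambient X).
  move=> cv; rewrite -(linear0 (embed X k)).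
  by apply: continuous_cvg => //; exact: embed_continuous.
have c0 : embed X false (u n).1 @[n --> \oo] --> (0 : ambient X).
  apply: c; apply: rnorm_cvg0 => n; have [_] := hu n.
  by apply: le_lt_trans; rewrite lerDl rnorm_ge0.
have c1 : embed X true (u n).2 @[n --> \oo] --> (0 : ambient X).
  apply: c; apply: rnorm_cvg0 => n; have [_] := hu n.
  by apply: le_lt_trans; rewrite lerDr rnorm_ge0.
have cs : (fun _ : nat => val a) @ \oo --> (0 + 0 : ambient X).
  rewrite (_ : (fun _ => _) =
      (fun n => embed X false (u n).1 + embed X true (u n).2)); last first.
    by apply/funext => n; have [] := hu n.
  apply: (@continuous2_cvg _ _ _ _ _ _ _ _ (fun x y : ambient X => x + y)) => //.
  exact: (@add_continuous (ambient X) (0, 0)).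
have ca : (fun _ : nat => val a) @ \oo --> val a by exact: cvg_cst.
apply: val_inj; rewrite /= -[RHS](addr0 0).
exact: (cvg_unique (@ambient_hausdorff R X) ca cs).
Qed.

Let sigma_normC (a : Sigma) : R[i] := (sigma_norm a)%:C.

Let sigma_normCD (a b : Sigma) :
  sigma_normC (a + b) <= sigma_normC a + sigma_normC b.
Proof. by rewrite /sigma_normC -rmorphD/= lecR sigma_normD. Qed.

Let sigma_normCZ (l : R[i]) (a : Sigma) :
  sigma_normC (l *: a) = `|l| * sigma_normC a.
Proof. by rewrite /sigma_normC sigma_normZ rmorphM/= rnormE. Qed.

Let sigma_normC0 (a : Sigma) : sigma_normC a = 0 -> a = 0.
Proof. by move=> [/sigma_norm0_eq0]. Qed.

HB.instance Definition _ :=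
  @Lmodule_isNormed.Build R[i] Sigma sigma_normC
    sigma_normCD sigma_normCZ sigma_normC0.

Lemma rnorm_sigmaE (a : Sigma) : rnorm a = sigma_norm a.
Proof. by []. Qed.

End sum_space.

Section calderon_spaces.
Context (R : realType) (X : compatible_pair R).

Definition strip : set R[i]^o := [set z | 0 <= complex.Re z <= 1].

Definition open_strip : set R[i]^o := [set z | 0 < complex.Re z < 1].

(* The point k + iy. *)
Definition edge (k : bool) (y : R) : R[i]^o := (k%:R +i* y)%C.

(* Functions on the strip are total functions on the complex plane whose values
   off the strip are irrelevant. *)
Definition calderon_A (f : R[i]^o -> Sigma X) : Prop :=
  [/\ {within strip, continuous f},
      exists M : R, forall z, strip z -> rnorm (f z) <= M,
      forall z, open_strip z -> derivable f z 1 &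
      forall k : bool, exists F : R -> X k,
        [/\ forall y, embed X k (F y) = val (f (edge k y)),
            continuous F &
            exists M : R, forall y, rnorm (F y) <= M]].

Definition edge_sup (f : R[i]^o -> Sigma X) (k : bool) : R :=
  sup [set r | exists y (x : X k),
    embed X k x = val (f (edge k y)) /\ r = rnorm x].

Definition calderon_A_norm (f : R[i]^o -> Sigma X) : R :=
  Num.max (edge_sup f false) (edge_sup f true).

Definition first_calderon (theta : R) : set (Sigma X) :=
  [set a | exists f, calderon_A f /\ f theta%:C = a].

Definition first_calderon_norm (theta : R) (a : Sigma X) : R :=
  inf [set r | exists f,
    [/\ calderon_A f, f theta%:C = a & r = calderon_A_norm f]].

Definition edge_lipschitz (g : R[i]^o -> Sigma X) (c : R) : Prop :=
  forall (k : bool) (y t : R), exists x : X k,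
    embed X k x = val (g (edge k (y + t)) - g (edge k y)) /\
    rnorm x <= c * `|t|.

Definition calderon_B (g : R[i]^o -> Sigma X) : Prop :=
  [/\ {within strip, continuous g},
      forall z, open_strip z -> derivable g z 1,
      exists C M : R, forall z, strip z -> M <= `|complex.Im z| ->
        rnorm (g z) <= C * `|complex.Im z| &
      exists c : R, edge_lipschitz g c].

Definition calderon_B_norm (g : R[i]^o -> Sigma X) : R :=
  inf [set c | edge_lipschitz g c].

Definition second_calderon (theta : R) : set (Sigma X) :=
  [set a | exists g, calderon_B g /\ 'D_1 g theta%:C = a].

Definition second_calderon_norm (theta : R) (a : Sigma X) : R :=
  inf [set r | exists g,
    [/\ calderon_B g, 'D_1 g theta%:C = a & r = calderon_B_norm g]].

End calderon_spaces.

Arguments first_calderon {R} X theta.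
Arguments second_calderon {R} X theta.

Section bochner.
Context (R : realType) (E : normedModType R[i]).
Let mu := @lebesgue_measure R.

Definition simple_fun (s : R -> E) : Prop :=
  finite_set (range s) /\ forall x, measurable (s @^-1` [set x]).

(* Pointwise limits are taken everywhere and not only almost everywhere: an
   almost everywhere limit of simple functions agrees almost everywhere with an
   everywhere limit, so the classes are the same. *)
Definition strongly_measurable (h : R -> E) : Prop :=
  exists s : nat -> R -> E, (forall n, simple_fun (s n)) /\
    forall y, s n y @[n --> \oo] --> h y.

Definition essentially_bounded (h : R -> E) : Prop :=
  exists M : R, {ae mu, forall y, rnorm (h y) <= M}.

Definition Linfty (h : R -> E) : Prop :=
  strongly_measurable h /\ essentially_bounded h.

Definition integrable_simple_fun (s : R -> E) : Prop :=
  simple_fun s /\ forall x, x != 0 -> (mu (s @^-1` [set x]) < +oo)%E.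

(* The value 0 may be taken on a set of infinite measure; its term vanishes. *)
Definition simple_integral (s : R -> E) : E :=
  \sum_(x \in range s) (fine (mu (s @^-1` [set x])))%:C *: x.

(* h is Bochner integrable, with integral I. *)
Definition is_bochner_integral (h : R -> E) (I : E) : Prop :=
  strongly_measurable h /\
  exists s : nat -> R -> E,
    [/\ forall n, integrable_simple_fun (s n),
        (\int[mu]_y (rnorm (h y - s n y))%:E)%E @[n --> \oo] --> 0%E &
        simple_integral (s n) @[n --> \oo] --> I].

End bochner.

Section radon_nikodym.
Context (R : realType).
Let mu := @lebesgue_measure R.

Definition L1 (phi : R -> R[i]) : Prop :=
  mu.-integrable setT (fun y => (complex.Re (phi y))%:E) /\
  mu.-integrable setT (fun y => (complex.Im (phi y))%:E).

Definition L1_dist (phi psi : R -> R[i]) : \bar R :=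
  (\int[mu]_y (rnorm (phi y - psi y))%:E)%E.

(* A continuous linear map on L^1 is given by its values on representatives;
   continuity for the L^1 seminorm forces it to identify functions that agree
   almost everywhere. *)
Definition hom_L1 (E : normedModType R[i]) (T : (R -> R[i]) -> E) : Prop :=
  (forall (a : R[i]) phi psi, L1 phi -> L1 psi ->
     T (fun y => a * phi y + psi y) = a *: T phi + T psi) /\
  (forall phi, L1 phi -> forall e : R, 0 < e -> exists2 d : R, 0 < d &
     forall psi, L1 psi -> (L1_dist phi psi < d%:E)%E ->
       rnorm (T phi - T psi) < e).

(* The converse, that h in L^infty(E) represents an element of hom(L^1, E),
   holds for every Banach space E. *)
Definition radon_nikodym_property (E : completeNormedModType R[i]) : Prop :=
  forall T : (R -> R[i]) -> E, hom_L1 T ->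
    exists2 h : R -> E, Linfty h &
      forall phi, L1 phi ->
        is_bochner_integral (fun y => phi y *: h y) (T phi).

End radon_nikodym.

(* Main.v *)
From HB Require Import structures.
From mathcomp Require Import all_boot all_order all_algebra.
From mathcomp Require Import complex ring lra.
From mathcomp Require Import all_classical all_reals all_analysis measurable_realfun.
From mathcomp Require finmap.
Require Import Defs.
Set Implicit Arguments.
Unset Strict Implicit.
Unset Printing Implicit Defensive.
Import Order.TTheory GRing.Theory Num.Theory.
Import numFieldNormedType.Exports.
Local Open Scope classical_set_scope.
Local Open Scope complex_scope.
Local Open Scope ring_scope.

(**
The two spaces are linked by differentiation.  A function f of the first space
has a primitive g on the closed strip, single valued by Cauchy's theorem.  On
the line over k the increments of g are i times integrals of the edge function
of f, taken in X_k, so that g belongs to the second space, g' = f, and the norm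
of g is at most the norm of f ([A_into_B]).  This half holds for every
compatible pair.

Conversely, let g belong to the second space.  The vertical difference
quotients u_n(z) = (n+1)(g(z + i/(n+1)) - g(z))/i converge to g' in the open
strip, and their edge functions are bounded in X_k by the norm of g.  What may
fail is their convergence on the edges, and there the Radon-Nikodym property of
X_0 enters.  The function G(y) = g(iy) - g(0) is Lipschitz with values in X_0,
so it defines an operator on L^1 that sends the indicator of [x, y) to
G(y) - G(x)
([stieltjes_operator]).  The density of this operator is the almost everywhere
limit of the difference quotients of G, by Lebesgue's differentiation theorem,
and dominated convergence makes these quotients a Cauchy sequence in the mean
on every bounded interval ([radon_nikodym_quotients]).

Closeness in the mean on a long interval of one edge, together with boundedness
on both edges, is all that matters for the value at an interior point theta
([correction]): if u is small in this sense, then there is a scalar holomorphic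
function m with m(theta) = 1 such that m u is uniformly small on both edges
([multiplier]).  One takes
  m(z) = ((1 + theta)/(z + 1))^p (1 + M H(theta))/(1 + M H(z)),
where H is a Riemann sum of the integral of |u(iy)|/(z - iy) dy with its poles
moved slightly to the left, |.| being the norm of X_0.  The first factor is
small over 1 and far away over 0, since there |z + 1| exceeds 1 + theta.  The
real part of H at iy is at least half of |u(iy)|, up to a small error, so the
second factor compensates for the size of u, while M H(theta) stays bounded
because the integral of |u(iy)| is small.

Along a subsequence, u_{n_{j+1}} - u_{n_j} can thus be replaced by a function
w_j with the same value at theta and with edge norms at most of order e/2^j;
the maximum principle transfers this bound to the strip.  The function u_{n_0},
multiplied by (theta + s)/(z + s) to make it bounded, plus the sum of all w_j
belongs to the first space, telescopes to g'(theta) at theta, and has norm at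
most the norm of g plus e ([B_into_A]).

The complex analysis of functions with values in a Banach space rests on
Goursat's theorem ([goursat]), which gives the mean value property on circles
([circle_mean]), the maximum principle ([maximum_principle]), and the
holomorphy of uniform limits ([weierstrass]).  Functions on the strip are
extended to the plane by projecting onto the strip ([clamp]), so that
continuity can be stated on the whole plane.
*)

(** * Bisection *)

(** Compactness of intervals and rectangles is used in Cousin's form: a property
that passes from the parts of a subdivision to the whole, and holds for all
small pieces around each point, holds globally. *)
Section bisection.
Context (R : realType) (P : R -> R -> R -> R -> Prop).
Hypothesis quad : forall a b c d, a <= b -> c <= d ->
  P a ((a + b) / 2) c ((c + d) / 2) -> P ((a + b) / 2) b c ((c + d) / 2) ->
  P a ((a + b) / 2) ((c + d) / 2) d -> P ((a + b) / 2) b ((c + d) / 2) d ->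
  P a b c d.

(** If a rectangle fails, then so does one of its four quarters. *)
Let half_step (p q x y : R) : 0 <= p -> 0 <= q -> ~ P x (x + p) y (y + q) ->
  exists x' y', [/\ x <= x', x' + p / 2 <= x + p, y <= y', y' + q / 2 <= y + q &
    ~ P x' (x' + p / 2) y' (y' + q / 2)].
Proof.
move=> p0 q0 nP; apply: contrapT => H; apply: nP.
have ex : (x + (x + p)) / 2 = x + p / 2 by lra.
have ey : (y + (y + q)) / 2 = y + q / 2 by lra.
apply: quad; rewrite ?ex ?ey; try lra; apply: contrapT => h; apply: H.
- by exists x, y; split => //; lra.
- exists (x + p / 2), y; split; try lra.
  by rewrite (_ : x + p / 2 + p / 2 = x + p) //; lra.
- exists x, (y + q / 2); split; try lra.
  by rewrite (_ : y + q / 2 + q / 2 = y + q) //; lra.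
- exists (x + p / 2), (y + q / 2); split; try lra.
  rewrite (_ : x + p / 2 + p / 2 = x + p); last lra.
  by rewrite (_ : y + q / 2 + q / 2 = y + q) //; lra.
Qed.

(** A failing rectangle would contain a nested sequence of failing rectangles,
which shrink to a point where the local hypothesis is contradicted. *)
Lemma bisection2 a b c d : a <= b -> c <= d ->
  (forall x y, a <= x <= b -> c <= y <= d -> exists2 e : R, 0 < e &
     forall a' b' c' d', a <= a' -> a' <= x -> x <= b' -> b' <= b ->
       c <= c' -> c' <= y -> y <= d' -> d' <= d ->
       b' - a' < e -> d' - c' < e -> P a' b' c' d') ->
  P a b c d.
Proof.
move=> ab cd loc; apply: contrapT => nP.
pose p n : R := (b - a) / 2 ^+ n.
pose q n : R := (d - c) / 2 ^+ n.
have e2 n : 0 < 2 ^+ n :> R by rewrite exprn_gt0.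
have p0 n : 0 <= p n by rewrite divr_ge0 ?subr_ge0 ?ab ?cd ?(ltW (e2 n)).
have q0 n : 0 <= q n by rewrite divr_ge0 ?subr_ge0 ?ab ?cd ?(ltW (e2 n)).
have pS n : p n.+1 = p n / 2 by rewrite /p exprSr invfM mulrA.
have qS n : q n.+1 = q n / 2 by rewrite /q exprSr invfM mulrA.
have /choice[f hf] : forall ns : nat * (R * R), exists s : R * R,
    let: (n, (x, y)) := ns in ~ P x (x + p n) y (y + q n) ->
    [/\ x <= s.1, s.1 + p n.+1 <= x + p n, y <= s.2,
        s.2 + q n.+1 <= y + q n & ~ P s.1 (s.1 + p n.+1) s.2 (s.2 + q n.+1)].
  move=> [n [x y]]; have [h|h] := pselect (P x (x + p n) y (y + q n)).
    by exists (0, 0).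
  have [x' [y' h']] := half_step (p0 n) (q0 n) h.
  by exists (x', y') => _ /=; rewrite pS qS.
pose s := fix s n := if n is m.+1 then f (m, s m) else (a, c).
have bad n : ~ P (s n).1 ((s n).1 + p n) (s n).2 ((s n).2 + q n).
  elim: n => [|n IH] /=.
    rewrite /p /q expr0 !divr1 (_ : a + (b - a) = b); last lra.
    by rewrite (_ : c + (d - c) = d) //; lra.
  by have := hf (n, s n); case: (s n) IH => x y /= IH /(_ IH)[].
have step n : [/\ (s n).1 <= (s n.+1).1, (s n.+1).1 + p n.+1 <= (s n).1 + p n,
    (s n).2 <= (s n.+1).2 & (s n.+1).2 + q n.+1 <= (s n).2 + q n].
  have := hf (n, s n); have := bad n; rewrite [s n.+1]/=.
  by case: (s n) => x y /= h /(_ h)[].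
have mono n m : [/\ (s n).1 <= (s (n + m)%N).1,
    (s (n + m)%N).1 + p (n + m)%N <= (s n).1 + p n,
    (s n).2 <= (s (n + m)%N).2 & (s (n + m)%N).2 + q (n + m)%N <= (s n).2 + q n].
  elim: m => [|m [h1 h2 h3 h4]]; first by rewrite addn0.
  have [k1 k2 k3 k4] := step (n + m)%N; rewrite addnS; split.
  - exact: le_trans k1.
  - exact: le_trans h2.
  - exact: le_trans k3.
  - exact: le_trans h4.
have key n m : (s n).1 <= (s m).1 + p m /\ (s n).2 <= (s m).2 + q m.
  have [nm|/ltnW mn] := leqP n m.
    have [h1 h2 h3 h4] := mono n (m - n)%N; rewrite subnKC// in h1 h2 h3 h4.
    by have := p0 m; have := q0 m; split; lra.
  have [h1 h2 h3 h4] := mono m (n - m)%N; rewrite subnKC// in h1 h2 h3 h4.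
  by have := p0 n; have := q0 n; split; lra.
pose x := sup [set (s n).1 | n in setT]; pose y := sup [set (s n).2 | n in setT].
have hsx : has_sup [set (s n).1 | n in setT].
  split; first by exists (s 0%N).1, 0%N.
  by exists ((s 0%N).1 + p 0%N) => _ [n _ <-]; exact: (key n 0%N).1.
have hsy : has_sup [set (s n).2 | n in setT].
  split; first by exists (s 0%N).2, 0%N.
  by exists ((s 0%N).2 + q 0%N) => _ [n _ <-]; exact: (key n 0%N).2.
have lx n : (s n).1 <= x by apply: sup_ubound; [exact: hsx.2|exists n].
have ly n : (s n).2 <= y by apply: sup_ubound; [exact: hsy.2|exists n].
have ux n : x <= (s n).1 + p n.
  by apply: ge_sup => [|_ [m _ <-]]; [exact: hsx.1|exact: (key m n).1].
have uy n : y <= (s n).2 + q n.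
  by apply: ge_sup => [|_ [m _ <-]]; [exact: hsy.1|exact: (key m n).2].
have P0 : p 0%N = b - a by rewrite /p expr0 divr1.
have Q0 : q 0%N = d - c by rewrite /q expr0 divr1.
have [|| e e0 he] := loc x y.
- by have := lx 0%N; have := ux 0%N; rewrite P0 /=; lra.
- by have := ly 0%N; have := uy 0%N; rewrite Q0 /=; lra.
have [n [pn qn]] : exists n, p n < e /\ q n < e.
  pose M := (b - a) + (d - c) + 1.
  have M0 : 0 < M by rewrite /M; lra.
  have [n nM] : exists n : nat, M / e < n%:R.
    exists (Num.truncn (M / e)).+1; apply: truncnS_gt.
  exists n; have nn : n%:R <= 2 ^+ n :> R.
    by rewrite -natrX ler_nat ltnW// ltn_expl.
  have : M < e * 2 ^+ n.
    by rewrite mulrC -ltr_pdivrMr//; apply: lt_le_trans nn.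
  by rewrite /p /q !ltr_pdivrMr// /M; split; lra.
apply: (bad n); have [m1 m2 m3 m4] := mono 0%N n; rewrite add0n /= P0 Q0 in m1 m2 m3 m4.
by apply: he => //; lra.
Qed.

End bisection.

(** The one-dimensional case is the planar one for a property that ignores the
second interval. *)
Lemma bisection1 (R : realType) (P : R -> R -> Prop) (a b : R) :
  (forall x y, x <= y -> P x ((x + y) / 2) -> P ((x + y) / 2) y -> P x y) ->
  a <= b ->
  (forall t, a <= t <= b -> exists2 e : R, 0 < e & forall x y,
     a <= x -> x <= t -> t <= y -> y <= b -> y - x < e -> P x y) -> P a b.
Proof.
move=> add ab loc; apply: (@bisection2 R (fun a b c d => P a b) _ a b 0 0) => //.
  by move=> x y c d xy _ h1 h2 _ _; exact: add.
move=> x y /loc[e e0 he] _; exists e => // a' b' c' d' ha hx hb hb' _ _ _ _ hd _; exact: he.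
Qed.

(** * Linear identities *)

(** Equations between linear combinations are decided by comparing the
coefficients of each vector, which are left to [ring]. *)
Section linear_expressions.
Context (K : nzRingType) (V : lmodType K).

Inductive lin_expr :=
  | LVar of nat | LZero | LAdd of lin_expr & lin_expr | LOpp of lin_expr
  | LScale of K & lin_expr.

Fixpoint lin_eval (env : seq V) e : V :=
  match e with
  | LVar i => nth 0 env i | LZero => 0
  | LAdd a b => lin_eval env a + lin_eval env b
  | LOpp a => - lin_eval env a
  | LScale k a => k *: lin_eval env a
  end.

Fixpoint lin_coef e (i : nat) : K :=
  match e with
  | LVar j => if Nat.eqb i j then 1 else 0 | LZero => 0
  | LAdd a b => lin_coef a i + lin_coef b i
  | LOpp a => - lin_coef a i
  | LScale k a => k * lin_coef a i
  end.

Lemma lin_evalE env e :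
  lin_eval env e = \sum_(i < size env) lin_coef e i *: nth 0 env i.
Proof.
elim: e => [j||a IHa b IHb|a IHa|k a IHa] /=.
- have [h|h] := ltnP j (size env); last first.
    rewrite nth_default// big1// => i _.
    have [E|] := PeanoNat.Nat.eqb_spec i j; last by rewrite scale0r.
    by move: (ltn_ord i); rewrite E ltnNge h.
  rewrite (bigD1 (Ordinal h))//= PeanoNat.Nat.eqb_refl scale1r big1 ?addr0// => i ni.
  have [E|] := PeanoNat.Nat.eqb_spec i j; last by rewrite scale0r.
  by case/eqP: ni; apply: val_inj.
- by rewrite big1// => i _; rewrite scale0r.
- by rewrite IHa IHb -big_split/=; apply: eq_bigr => i _; rewrite scalerDl.
- by rewrite IHa -sumrN; apply: eq_bigr => i _; rewrite scaleNr.
- by rewrite IHa scaler_sumr; apply: eq_bigr => i _; rewrite scalerA.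
Qed.

Fixpoint lin_coef_eq (a b : lin_expr) (n : nat) : Prop :=
  if n is m.+1 then lin_coef a m = lin_coef b m /\ lin_coef_eq a b m else True.

Lemma lin_eval_eq env a b :
  lin_coef_eq a b (size env) -> lin_eval env a = lin_eval env b.
Proof.
rewrite !lin_evalE => h; apply: eq_bigr => -[i hi] _ /=; congr (_ *: _).
by elim: (size env) hi h => // n IH; rewrite ltnS leq_eqVlt => /orP[/eqP-> []//|hi [_ /IH]]; exact.
Qed.

End linear_expressions.
Arguments LVar {K}. Arguments LZero {K}.

Ltac lin_mem x l := lazymatch l with
  | nil => constr:(false)
  | x :: _ => constr:(true)
  | _ :: ?t => lin_mem x t end.
Ltac lin_index x l := lazymatch l with
  | x :: _ => constr:(O)
  | _ :: ?t => let n := lin_index x t in constr:(S n) end.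
Ltac lin_atoms l t := lazymatch t with
  | (?a + ?b)%R => let l1 := lin_atoms l a in lin_atoms l1 b
  | (- ?a)%R => lin_atoms l a
  | (0)%R => l
  | (_ *: ?a)%R => lin_atoms l a
  | _ => let b := lin_mem t l in
         lazymatch b with true => l | false => constr:(t :: l) end end.
Ltac lin_quote K l t := lazymatch t with
  | (?a + ?b)%R => let x := lin_quote K l a in let y := lin_quote K l b in
      constr:(@LAdd K x y)
  | (- ?a)%R => let x := lin_quote K l a in constr:(@LOpp K x)
  | (0)%R => constr:(@LZero K)
  | (?k *: ?a)%R => let x := lin_quote K l a in constr:(@LScale K k x)
  | _ => let n := lin_index t l in constr:(@LVar K n) end.
Ltac linear_identity := lazymatch goal with
  | R : realType |- @eq ?T ?a ?b =>
    let K := constr:(complex R) in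
    let l0 := constr:(@nil T) in
    let l1 := lin_atoms l0 a in let l := lin_atoms l1 b in
    let x := lin_quote K l a in let y := lin_quote K l b in
    apply: (@lin_eval_eq _ _ l x y); cbn [lin_coef_eq lin_coef size Nat.eqb];
    repeat split; ring end.

(** * Real norms and completeness *)

Section norms.
Context (R : realType).
Implicit Type E : normedModType R[i].

Lemma rnorm0 E : rnorm (0 : E) = 0.
Proof. by rewrite /rnorm normr0. Qed.

Lemma rnormN E (x : E) : rnorm (- x) = rnorm x.
Proof. by rewrite /rnorm normrN. Qed.

Lemma rnorm_distC E (x y : E) : rnorm (x - y) = rnorm (y - x).
Proof. by rewrite /rnorm distrC. Qed.

Lemma rnormB E (x y : E) : rnorm (x - y) <= rnorm x + rnorm y.
Proof. by rewrite -(rnormN y) rnormD. Qed.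

Lemma rnorm_dist E (z x y : E) : rnorm (x - y) <= rnorm (x - z) + rnorm (z - y).
Proof. by rewrite -{1}(subrK z x) -addrA rnormD. Qed.

Lemma rnorm_distD E (x y : E) : rnorm x <= rnorm (x - y) + rnorm y.
Proof. by rewrite -{1}(subrK y x) rnormD. Qed.

Lemma rnorm_eq0 E (x : E) : rnorm x <= 0 -> x = 0.
Proof.
move=> h; apply/normr0_eq0; rewrite -rnormE; congr (_%:C).
by apply/le_anti; rewrite h rnorm_ge0.
Qed.

Lemma rnorm_real (r : R) : rnorm (r%:C : R[i]^o) = `|r|.
Proof. by rewrite /rnorm normc_def /= expr0n /= addr0 sqrtr_sqr. Qed.

Lemma rnormZr E (r : R) (x : E) : rnorm (r%:C *: x) = `|r| * rnorm x.
Proof. by rewrite rnormZ -rnorm_real. Qed.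

Lemma rnorm_sum E (I : Type) (s : seq I) (F : I -> E) :
  rnorm (\sum_(i <- s) F i) <= \sum_(i <- s) rnorm (F i).
Proof.
elim: s => [|i s IH]; first by rewrite !big_nil rnorm0.
by rewrite !big_cons (le_trans (rnormD _ _))// lerD2l.
Qed.

Lemma rnorm_le_eps E (x : E) : (forall e : R, 0 < e -> rnorm x <= e) -> x = 0.
Proof. by move=> h; apply/rnorm_eq0/ler_addgt0Pr => e /h; rewrite add0r. Qed.

(** Completeness by sequences; both the endpoints and their sum satisfy it
([complete_rcomplete], [sigma_rcomplete]). *)
Definition rcomplete E := forall u : nat -> E,
  (forall e : R, 0 < e -> exists N, forall n m,
    (N <= n)%N -> (N <= m)%N -> rnorm (u n - u m) <= e) ->
  exists l, forall e : R, 0 < e -> exists N, forall n,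
    (N <= n)%N -> rnorm (u n - l) <= e.

End norms.

(** * Primitives and integrals of continuous vector functions *)

Section primitives.
Context (R : realType) (E : normedModType R[i]).
Implicit Types (F phi : R -> E) (G gam : R -> R).

Definition contR phi := forall x (e : R), 0 < e ->
  exists2 d : R, 0 < d & forall y, `|y - x| < d -> rnorm (phi y - phi x) <= e.

Definition primitive F phi := forall x (e : R), 0 < e -> exists2 d : R, 0 < d &
  forall y, `|y - x| < d -> rnorm (F y - F x - (y - x)%:C *: phi x) <= e * `|y - x|.

(** The derivative at [x] controls increments over all short intervals around [x],
not only those with endpoint [x]; bisection needs this form. *)
Lemma primitive_straddle F phi x (e : R) : primitive F phi -> 0 < e ->
  exists2 d : R, 0 < d & forall y z, y <= x -> x <= z -> z - y < d ->
    rnorm (F z - F y - (z - y)%:C *: phi x) <= e * (z - y).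
Proof.
move=> h e0; have [d d0 hd] := h x e e0; exists d => // y z yx xz zy.
have hz : rnorm (F z - F x - (z - x)%:C *: phi x) <= e * (z - x).
  by have := hd z; rewrite (@ger0_norm _ (z - x)) ?subr_ge0//; apply; lra.
have hy : rnorm (F y - F x - (y - x)%:C *: phi x) <= e * (x - y).
  by have := hd y; rewrite distrC (@ger0_norm _ (x - y)) ?subr_ge0//; apply; lra.
rewrite (_ : _ - _ = (F z - F x - (z - x)%:C *: phi x) -
    (F y - F x - (y - x)%:C *: phi x)); last by linear_identity.
apply: (le_trans (rnormB _ _)); lra.
Qed.

Definition real_primitive G gam := forall x (e : R), 0 < e ->
  exists2 d : R, 0 < d &
  forall y, `|y - x| < d -> `|G y - G x - (y - x) * gam x| <= e * `|y - x|.

Lemma real_primitive_straddle G gam x (e : R) : real_primitive G gam -> 0 < e ->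
  exists2 d : R, 0 < d & forall y z, y <= x -> x <= z -> z - y < d ->
    (z - y) * gam x - (G z - G y) <= e * (z - y).
Proof.
move=> h e0; have [d d0 hd] := h x e e0; exists d => // y z yx xz zy.
have : `|G z - G x - (z - x) * gam x| <= e * (z - x).
  by have := hd z; rewrite (@ger0_norm _ (z - x)) ?subr_ge0//; apply; lra.
have : `|G y - G x - (y - x) * gam x| <= e * (x - y).
  by have := hd y; rewrite distrC (@ger0_norm _ (x - y)) ?subr_ge0//; apply; lra.
rewrite !ler_norml => /andP[h1 h2] /andP[h3 h4]; lra.
Qed.

(** The estimate with an extra error [e (b - a)] is additive over subdivisions
and holds locally, hence globally by bisection. *)
Lemma mean_value F phi G gam a b : primitive F phi -> real_primitive G gam ->
  a <= b -> (forall t, a <= t <= b -> rnorm (phi t) <= gam t) ->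
  rnorm (F b - F a) <= G b - G a.
Proof.
move=> hF hG ab h; apply/ler_addgt0Pr => e e0.
pose e1 := e / (b - a + 1) / 2.
have ba : 0 < b - a + 1 by lra.
have e10 : 0 < e1 by rewrite !divr_gt0.
have : rnorm (F b - F a) <= G b - G a + (2 * e1) * (b - a).
  apply: (bisection1 (P := fun x y => rnorm (F y - F x) <= G y - G x + (2 * e1) * (y - x)))
      => // [x y xy h1 h2|t tab].
    have := rnorm_dist (F ((x + y) / 2)) (F y) (F x); lra.
  have [d1 d10 hd1] := primitive_straddle t hF e10.
  have [d2 d20 hd2] := real_primitive_straddle t hG e10.
  exists (Num.min d1 d2); first by rewrite lt_min d10.
  move=> x y ax xt ty yb; rewrite lt_min => /andP[l1 l2].
  have k1 := hd1 _ _ xt ty l1; have k2 := hd2 _ _ xt ty l2.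
  have := rnorm_distD (F y - F x) ((y - x)%:C *: phi t).
  rewrite rnormZr ger0_norm; last lra.
  have : (y - x) * rnorm (phi t) <= (y - x) * gam t by rewrite ler_wpM2l ?h//; lra.
  lra.
move=> /le_trans; apply; rewrite lerD2l /e1.
rewrite (_ : 2 * _ * _ = e * ((b - a) / (b - a + 1))); last by field; lra.
by rewrite ger_pMr// ler_pdivrMr//; lra.
Qed.

Lemma real_primitive_lin M : real_primitive (fun t => M * t) (fun=> M).
Proof.
move=> x e e0; exists 1 => // y _.
rewrite (_ : M * y - M * x - (y - x) * M = 0); last by ring.
by rewrite normr0 mulr_ge0 ?(ltW e0).
Qed.

Lemma mean_value_const F phi M a b : primitive F phi -> a <= b ->
  (forall t, a <= t <= b -> rnorm (phi t) <= M) ->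
  rnorm (F b - F a) <= M * (b - a).
Proof.
by move=> hF ab h; rewrite mulrBr; apply: (mean_value hF (real_primitive_lin M) ab).
Qed.

Lemma primitiveD F1 f1 F2 f2 : primitive F1 f1 -> primitive F2 f2 ->
  primitive (fun t => F1 t + F2 t) (fun t => f1 t + f2 t).
Proof.
move=> h1 h2 x e e0; have e20 : 0 < e / 2 by rewrite divr_gt0.
have [d1 d10 k1] := h1 x _ e20; have [d2 d20 k2] := h2 x _ e20.
exists (Num.min d1 d2); first by rewrite lt_min d10.
move=> y; rewrite lt_min => /andP[/k1 l1 /k2 l2].
rewrite (_ : _ - _ = (F1 y - F1 x - (y - x)%:C *: f1 x) +
   (F2 y - F2 x - (y - x)%:C *: f2 x)); last by linear_identity.
apply: (le_trans (rnormD _ _)); lra.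
Qed.

Lemma primitive_lin (c : E) : primitive (fun t => t%:C *: c) (fun=> c).
Proof.
move=> x e e0; exists 1 => // y _.
rewrite -scalerBl -rmorphB subrr.
by rewrite rnorm0 mulr_ge0 ?(ltW e0).
Qed.

Lemma primitive_ext F phi psi : primitive F phi -> phi =1 psi -> primitive F psi.
Proof. by move=> h /funext <-. Qed.

End primitives.

(** A bounded linear map commutes with differentiation, hence with integrals. *)
Lemma primitive_linear (R : realType) (E1 E2 : normedModType R[i])
    (L : {linear E1 -> E2}) (M : R) F phi :
  (forall x, rnorm (L x) <= M * rnorm x) -> primitive F phi ->
  primitive (fun t => L (F t)) (fun t => L (phi t)).
Proof.
move=> hL h x e e0; have M1 : 0 < `|M| + 1 by rewrite ltr_wpDl.
have [d d0 hd] := h x _ (divr_gt0 e0 M1); exists d => // y /hd k.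
rewrite -linearZ -!linearB (le_trans (hL _))//.
apply: le_trans (_ : (`|M| + 1) * (e / (`|M| + 1) * `|y - x|) <= _); last first.
  by rewrite mulrA mulrC (mulrC _ (e / _)) divfK ?gt_eqF// mulrC.
apply: (@le_trans _ _ ((`|M| + 1) * rnorm (F y - F x - (y - x)%:C *: phi x))).
  by rewrite ler_wpM2r ?rnorm_ge0// (le_trans (ler_norm M))// lerDl.
by rewrite ler_wpM2l// ltW.
Qed.

Section integral.
Context (R : realType) (E : normedModType R[i]).
Implicit Types (F phi : R -> E).

Lemma primitive_unique F1 F2 phi a b : primitive F1 phi -> primitive F2 phi ->
  F1 b - F1 a = F2 b - F2 a.
Proof.
move=> h1 h2; wlog ab : a b / a <= b.
  move=> W; have [|/ltW] := leP a b; first exact: W.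
  by move=> /W; rewrite -(opprB (F1 b)) -(opprB (F2 b)) => /oppr_inj.
have h2' := primitiveD h1 (primitive_linear (L := -%R : {linear E -> E}) (M := 1)
  (fun x => _ : rnorm (- x) <= 1 * rnorm x) h2).
have {}h2' := h2' (fun x => ltac:(by rewrite rnormN mul1r)).
have := mean_value_const (M := 0) h2' ab.
move=> /(_ (fun t _ => ltac:(by rewrite subrr rnorm0))); rewrite mul0r => /rnorm_eq0.
rewrite -[_ - _]/(F1 b - F2 b - (F1 a - F2 a)) => h.
apply/eqP; rewrite -subr_eq0 -h; apply/eqP; linear_identity.
Qed.

(** The integral of a function is the increment of any primitive; the value is
meaningful when a primitive exists, in particular for continuous functions
with values in a complete space. *)
Definition vint phi (a b : R) : E :=
  let F := xget (fun=> 0) [set F | primitive F phi] in F b - F a.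

Lemma vintE F phi a b : primitive F phi -> vint phi a b = F b - F a.
Proof.
move=> h; apply: primitive_unique (h).
exact: (xgetPex (fun=> 0) (ex_intro (fun F => primitive F phi) F h)).
Qed.

Section existence.
Variable phi : R -> E.
Hypothesis cphi : contR phi.
Hypothesis cE : rcomplete E.

Let t (n k : nat) : R := k%:R / n.+1%:R - n.+1%:R.
(* The length of the part of the cell from t n k to t n k.+1 that lies to the
   left of x; thus S n is a primitive of a step function. *)
Let w n k (x : R) : R := Num.min x (t n k.+1) - Num.min x (t n k).
Let K n := (2 * n.+1 * n.+1)%N.
Let S n x := \sum_(k <- iota 0 (K n)) (w n k x)%:C *: phi (t n k).

Let tS n k : t n k.+1 = t n k + n.+1%:R^-1.
Proof. by rewrite /t -natr1 mulrDl mul1r addrAC. Qed.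

Let t_le n k : t n k <= t n k.+1.
Proof. by rewrite tS lerDl invr_ge0. Qed.

Let sum_w n x : `|x| <= n.+1%:R -> \sum_(k <- iota 0 (K n)) w n k x = x + n.+1%:R.
Proof.
move=> hx; rewrite -[iota 0 (K n)]/(index_iota 0 (K n)) telescope_sumr//.
have t0 : t n 0 = - n.+1%:R by rewrite /t mul0r sub0r.
have tK : t n (K n) = n.+1%:R.
  by rewrite /t /K natrM mulfK ?pnatr_eq0// mul2n -addnn natrD addrK.
move: hx; rewrite t0 tK ler_norml => /andP[h1 h2].
by rewrite min_l// min_r// opprK.
Qed.

(** Only cells that meet the interval from [x] to [y] contribute to the
difference, so the oscillation of [phi] matters only there. *)
Let S_est n x y c M : x <= y -> `|x| <= n.+1%:R -> `|y| <= n.+1%:R ->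
  (forall s, x - n.+1%:R^-1 <= s <= y -> rnorm (phi s - c) <= M) ->
  rnorm (S n y - S n x - (y - x)%:C *: c) <= M * (y - x).
Proof.
move=> xy hx hy hM.
have -> : y - x = \sum_(k <- iota 0 (K n)) (w n k y - w n k x).
  by rewrite sumrB !sum_w//; ring.
rewrite /S -sumrB rmorph_sum/= scaler_suml -sumrB mulr_sumr.
rewrite (le_trans (rnorm_sum _ _))//; apply: ler_sum => k _.
rewrite (_ : _ - _ = (w n k y - w n k x)%:C *: (phi (t n k) - c)); last first.
  by linear_identity.
have tk := t_le n k.
have w0 : 0 <= w n k y - w n k x.
  by rewrite /w !minEle; case: (lerP y (t n k.+1)) => ?; case: (lerP y (t n k)) => ?;
    case: (lerP x (t n k.+1)) => ?; case: (lerP x (t n k)) => ?; lra.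
rewrite rnormZr ger0_norm// mulrC.
have [w1|w1] := eqVneq (w n k y - w n k x) 0; first by rewrite w1 !mulr0.
rewrite ler_wpM2r// hM//.
have {w1} : 0 < w n k y - w n k x by rewrite lt_def w1.
have inv0 : 0 <= n.+1%:R^-1 :> R by rewrite invr_ge0.
have := tS n k; move: (n.+1%:R^-1) inv0 => inv inv0; rewrite /w !minEle; case: (lerP y (t n k.+1)) => ?; case: (lerP y (t n k)) => ?;
    case: (lerP x (t n k.+1)) => ?; case: (lerP x (t n k)) => ?; lra.
Qed.

(** Locally both sums are close to [(y - x) phi(s)]; bisection makes the estimate
global without uniform continuity. *)
Let S_cauchy x e : 0 < e -> exists N, forall n m, (N <= n)%N -> (N <= m)%N ->
  rnorm ((S n x - S n 0) - (S m x - S m 0)) <= e.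
Proof.
move=> e0.
suff H a b : a <= b -> exists N, forall n m, (N <= n)%N -> (N <= m)%N ->
    rnorm ((S n b - S n a) - (S m b - S m a)) <= e / (b - a + 1) * (b - a).
  have [x0|/ltW x0] := leP 0 x.
    have [N hN] := H _ _ x0; exists N => n m h1 h2; apply: (le_trans (hN _ _ h1 h2)).
    by rewrite subr0 mulrAC -mulrA ger_pMr// ler_pdivrMr; lra.
  have [N hN] := H _ _ x0; exists N => n m h1 h2.
  rewrite (_ : _ - _ = - ((S n 0 - S n x) - (S m 0 - S m x))); last by linear_identity.
  rewrite rnormN; apply: (le_trans (hN _ _ h1 h2)).
  by rewrite sub0r mulrAC -mulrA ger_pMr// ler_pdivrMr; lra.
move=> ab; have e1 : 0 < e / (b - a + 1) by rewrite divr_gt0//; lra.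
move: (e / _) e1 => {}e {}e0.
apply: (bisection1 (P := fun x y => exists N, forall n m, (N <= n)%N -> (N <= m)%N ->
    rnorm ((S n y - S n x) - (S m y - S m x)) <= e * (y - x))) => // [{}x y _|s sab].
  move=> [N1 h1] [N2 h2]; exists (maxn N1 N2) => n m; rewrite !geq_max.
  move=> /andP[n1 n2] /andP[m1 m2]; have := h1 _ _ n1 m1; have := h2 _ _ n2 m2.
  set z := (x + y) / 2 => k1 k2.
  rewrite (_ : _ - _ = (S n z - S n x - (S m z - S m x)) +
    (S n y - S n z - (S m y - S m z))); last by linear_identity.
  by apply: (le_trans (rnormD _ _)); rewrite /z in k1 k2 *; lra.
have e20 : 0 < e / 2 by lra.
have [d d0 hd] := cphi s e20; exists (d / 2); first lra.
move=> {}x y ax xs sy yb yx.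
have [N hN] : exists N : nat, `|x| + `|y| + 2 / d < N%:R.
  by exists (Num.truncn (`|x| + `|y| + 2 / d)).+1; exact: truncnS_gt.
have d20 : 0 < 2 / d by rewrite divr_gt0.
suff est n : (N <= n)%N -> rnorm (S n y - S n x - (y - x)%:C *: phi s) <= e / 2 * (y - x).
  exists N => n m /est h1 /est h2.
  rewrite (_ : _ - _ = (S n y - S n x - (y - x)%:C *: phi s) -
     (S m y - S m x - (y - x)%:C *: phi s)); last by linear_identity.
  by apply: (le_trans (rnormB _ _)); lra.
move=> Nn; have nn : `|x| + `|y| + 2 / d < n.+1%:R.
  by apply: (lt_trans hN); rewrite ltr_nat ltnS.
have ax0 := normr_ge0 x; have ay0 := normr_ge0 y.
apply: S_est; try lra.
have inv : n.+1%:R^-1 < d / 2.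
  rewrite invf_plt ?posrE//; last lra.
  by rewrite invf_div; lra.
move=> r; move: (n.+1%:R^-1) inv => i inv hr; apply: hd; rewrite ltr_norml; lra.
Qed.

Lemma primitive_exists : exists F, primitive F phi.
Proof.
have /choice[F hF] : forall x, exists l, forall e : R, 0 < e -> exists N, forall n,
    (N <= n)%N -> rnorm ((S n x - S n 0) - l) <= e.
  by move=> x; apply: cE => e; exact: S_cauchy.
exists F => x e e0; have [d d0 hd] := cphi x e0.
exists (d / 2); first lra.
suff H a b : a <= b -> a <= x <= b -> b - a < d / 2 ->
    rnorm (F b - F a - (b - a)%:C *: phi x) <= e * (b - a).
  move=> y yx; have [xy|/ltW xy] := leP x y.
    rewrite ger0_norm ?subr_ge0// in yx *; apply: H => //; lra.
  rewrite ler0_norm ?subr_le0// opprB in yx *.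
  rewrite -rnormN (_ : - (F y - F x - (y - x)%:C *: phi x) = F x - F y - (x - y)%:C *: phi x); last by linear_identity.
  by apply: H => //; lra.
move=> ab xab hba; apply/ler_addgt0Pr => r r0.
have r30 : 0 < r / 2 by lra.
have [N1 h1] := hF a _ r30; have [N2 h2] := hF b _ r30.
have [N hN] : exists N : nat, `|a| + `|b| + 2 / d < N%:R.
  by exists (Num.truncn (`|a| + `|b| + 2 / d)).+1; exact: truncnS_gt.
have d20 : 0 < 2 / d by rewrite divr_gt0.
pose n := maxn N (maxn N1 N2).
have n1 : (N1 <= n)%N by rewrite /n !leq_max leqnn orbT.
have n2 : (N2 <= n)%N by rewrite /n !leq_max leqnn !orbT.
have nn : `|a| + `|b| + 2 / d < n.+1%:R.
  by apply: (lt_le_trans hN); rewrite ler_nat leqW// /n leq_maxl.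
have ax0 := normr_ge0 a; have ay0 := normr_ge0 b.
have inv : n.+1%:R^-1 < d / 2.
  rewrite invf_plt ?posrE//; last lra.
  by rewrite invf_div; lra.
have := S_est (n := n) (c := phi x) (M := e) ab.
move=> /(_ ltac:(lra) ltac:(lra)) h.
have {}h : rnorm (S n b - S n a - (b - a)%:C *: phi x) <= e * (b - a).
  by apply: h => s; move: (n.+1%:R^-1) inv => i inv hs; apply: hd; rewrite ltr_norml; lra.
have k1 := h1 _ n1; have k2 := h2 _ n2.
rewrite (_ : F b - _ - _ = (S n b - S n a - (b - a)%:C *: phi x) +
  ((S n a - S n 0 - F a) - (S n b - S n 0 - F b))); last by linear_identity.
apply: (le_trans (rnormD _ _)).
have := rnormB (S n a - S n 0 - F a) (S n b - S n 0 - F b); lra.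
Qed.

End existence.

Hypothesis cE : rcomplete E.
Implicit Type psi : R -> E.

Lemma vint_primitive phi : contR phi -> exists2 F, primitive F phi &
  forall a b, vint phi a b = F b - F a.
Proof.
by move=> /primitive_exists/(_ cE)[F hF]; exists F => // a b; exact: vintE.
Qed.

Lemma vint_bound phi M a b : contR phi -> a <= b ->
  (forall t, a <= t <= b -> rnorm (phi t) <= M) ->
  rnorm (vint phi a b) <= M * (b - a).
Proof.
move=> /vint_primitive[F hF ->]; exact: mean_value_const.
Qed.

Lemma vintD phi psi a b : contR phi -> contR psi ->
  vint (fun t => phi t + psi t) a b = vint phi a b + vint psi a b.
Proof.
move=> /vint_primitive[F hF ->] /vint_primitive[G hG ->].
by rewrite (vintE _ _ (primitiveD hF hG)); linear_identity.
Qed.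

Lemma vint_cat phi b a c : contR phi -> vint phi a c = vint phi a b + vint phi b c.
Proof. by move=> /vint_primitive[F hF E1]; rewrite !E1; linear_identity. Qed.

Lemma vint_cst (c : E) a b : vint (fun=> c) a b = (b - a)%:C *: c.
Proof. by rewrite (vintE _ _ (primitive_lin c)) rmorphB scalerBl. Qed.

End integral.

(** * Complex differentiation *)

Section complex_plane.
Context (R : realType).
Implicit Types (z w : R[i]^o) (x y : R).

Definition pt x y : R[i]^o := (x +i* y)%C.

Lemma ptE x y : pt x y = x%:C + 'i * y%:C :> R[i].
Proof. by apply/eqP; rewrite eq_complex /=; apply/andP; split; apply/eqP; ring. Qed.

Lemma ptB x y x' y' : pt x y - pt x' y' = pt (x - x') (y - y').
Proof. by []. Qed.

Lemma ptD x y x' y' : pt x y + pt x' y' = pt (x + x') (y + y').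
Proof. by []. Qed.

Lemma pt_ReIm z : pt (complex.Re z) (complex.Im z) = z.
Proof. by case: z. Qed.

Lemma sqr_rnorm z : rnorm z ^+ 2 = complex.Re z ^+ 2 + complex.Im z ^+ 2.
Proof. by rewrite /rnorm; case: z => a b; rewrite normc_def /= sqr_sqrtr// addr_ge0 ?sqr_ge0. Qed.

Lemma rnormE_sqrt z : rnorm z = Num.sqrt (complex.Re z ^+ 2 + complex.Im z ^+ 2).
Proof. by rewrite /rnorm; case: z => a b; rewrite normc_def. Qed.

Lemma Re_le z : `|complex.Re z| <= rnorm z.
Proof. by rewrite rnormE_sqrt -sqrtr_sqr ler_wsqrtr// lerDl sqr_ge0. Qed.

Lemma Im_le z : `|complex.Im z| <= rnorm z.
Proof. by rewrite rnormE_sqrt -sqrtr_sqr ler_wsqrtr// lerDr sqr_ge0. Qed.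

Lemma rnorm_le_ReIm z : rnorm z <= `|complex.Re z| + `|complex.Im z|.
Proof.
rewrite -(@ler_pXn2r _ 2) ?nnegrE ?addr_ge0 ?rnorm_ge0//.
rewrite sqr_rnorm sqrrD !real_normK ?num_real// addrAC lerDl.
by rewrite mulrn_wge0// mulr_ge0.
Qed.

Lemma rnormM z w : rnorm (z * w) = rnorm z * rnorm w.
Proof. exact: (@rnormZ R R[i]^o z w). Qed.

Lemma rnorm1 : rnorm (1 : R[i]^o) = 1.
Proof. by rewrite /rnorm normr1. Qed.

Lemma rnormX z n : rnorm (z ^+ n) = rnorm z ^+ n.
Proof. by elim: n => [|n IH]; rewrite ?expr0 ?rnorm1// !exprS rnormM IH. Qed.

Lemma rnorm_eq0E z : (rnorm z == 0) = (z == 0).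
Proof.
apply/eqP/eqP => [h|->]; last exact: rnorm0.
by apply: rnorm_eq0; rewrite h.
Qed.

Lemma rnorm_gt0 z : (0 < rnorm z) = (z != 0).
Proof. by rewrite lt_def rnorm_ge0 andbT rnorm_eq0E. Qed.

Lemma rnormV z : rnorm (z^-1) = (rnorm z)^-1.
Proof.
have [->|z0] := eqVneq z 0; first by rewrite invr0 rnorm0 invr0.
apply: (@mulIf _ (rnorm z)); first by rewrite rnorm_eq0E.
by rewrite -rnormM !mulVf ?rnorm1 ?rnorm_eq0E.
Qed.

Lemma rnormi : rnorm ('i : R[i]^o) = 1.
Proof. by rewrite rnormE_sqrt /= expr0n expr1n add0r sqrtr1. Qed.

Lemma rnorm_scalei (E : normedModType R[i]) (x : E) : rnorm ('i *: x) = rnorm x.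
Proof. by rewrite rnormZ rnormi mul1r. Qed.

End complex_plane.

Section continuity.
Context (R : realType) (E : normedModType R[i]).
Implicit Types (f g : R[i]^o -> E) (z w : R[i]^o).

Definition ccont f z := forall e : R, 0 < e -> exists2 d : R, 0 < d &
  forall w, rnorm (w - z) < d -> rnorm (f w - f z) <= e.

(** It amounts to derivability in the direction 1 ([cderiv_derivable],
[derivable_cderiv]). *)
Definition cderiv f z (l : E) := forall e : R, 0 < e -> exists2 d : R, 0 < d &
  forall w, rnorm (w - z) < d -> rnorm (f w - f z - (w - z) *: l) <= e * rnorm (w - z).

Lemma pos_ReC (e : R[i]) : 0 < e -> (complex.Re e)%:C = e /\ 0 < complex.Re e.
Proof.
move=> e0; have ee : (complex.Re e)%:C = e by rewrite RRe_real// gtr0_real.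
by split => //; rewrite -ltcR ee.
Qed.

Lemma norm_ltC (F : normedModType R[i]) (x : F) (e : R) : (`|x| < e%:C) = (rnorm x < e).
Proof. by rewrite -rnormE ltcR. Qed.

Lemma norm_leC (F : normedModType R[i]) (x : F) (e : R) : (`|x| <= e%:C) = (rnorm x <= e).
Proof. by rewrite -rnormE lecR. Qed.

Lemma nbhsP (F : normedModType R[i]) (x : F) (A : set F) :
  nbhs x A <-> exists2 d : R, 0 < d & forall y, rnorm (y - x) < d -> A y.
Proof.
split=> [/nbhs_normP[d /= d0 h]|[d d0 h]].
  have [ed d1] := pos_ReC d0; exists (complex.Re d) => // y hy; apply: h => /=.
  by rewrite -ed norm_ltC rnorm_distC.
apply/nbhs_normP; exists d%:C; first by rewrite /= ltcR.
by move=> y /=; rewrite norm_ltC rnorm_distC => /h.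
Qed.

Lemma ccontP f z : (f w @[w --> z] --> f z) <-> ccont f z.
Proof.
split=> [h e e0|h].
  have /cvgrPdist_le/(_ e%:C) := h; rewrite ltcR => /(_ e0)/nbhsP[d d0 hd].
  by exists d => // w /hd; rewrite norm_leC rnorm_distC.
apply/(@cvgrPdist_le _ _ _ (nbhs z) (nbhs_filter z)) => e /pos_ReC[ee /h[d d0 hd]].
apply/nbhsP; exists d => // w /hd.
by rewrite -ee norm_leC rnorm_distC.
Qed.

Lemma cderiv_cont f z l : cderiv f z l -> ccont f z.
Proof.
move=> h e e0; have [d d0 hd] := h 1 ltr01.
have l0 := rnorm_ge0 l; have l1 : 0 < rnorm l + 1 by lra.
exists (Num.min d (e / (rnorm l + 1))); first by rewrite lt_min d0 divr_gt0.
move=> w; rewrite lt_min ltr_pdivlMr// => /andP[/hd k1 k2].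
have := rnorm_distD (f w - f z) ((w - z) *: l); rewrite rnormZ; lra.
Qed.

(** The difference quotient at [z], continued by the derivative at [z] itself. *)
Definition slope f z (l : E) w : E := if w == z then l else (w - z)^-1 *: (f w - f z).

Lemma slopeE f z l w : f w - f z = (w - z) *: slope f z l w.
Proof.
rewrite /slope; case: eqP => [->|/eqP wz]; first by rewrite !subrr scale0r.
by rewrite scalerA divff ?scale1r// subr_eq0.
Qed.

Lemma slope_contP f z l : cderiv f z l <-> ccont (slope f z l) z.
Proof.
have key w : rnorm (f w - f z - (w - z) *: l) = rnorm (w - z) * rnorm (slope f z l w - l).
  by rewrite (slopeE _ _ l) -scalerBr rnormZ.
have sz : slope f z l z = l by rewrite /slope eqxx.
split=> h e e0; have [d d0 hd] := h e e0; exists d => // w /[dup] /hd; rewrite sz => k kd.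
  have [->|wz] := eqVneq w z; first by rewrite sz subrr rnorm0 ltW.
  have wz0 : 0 < rnorm (w - z) by rewrite rnorm_gt0 subr_eq0.
  by move: k; rewrite key mulrC ler_pM2r.
by rewrite key mulrC ler_wpM2r// rnorm_ge0.
Qed.

Lemma cderiv_slope f z l (q : R[i]^o -> E) : ccont q z -> q z = l ->
  (exists2 d : R, 0 < d & forall w, rnorm (w - z) < d -> f w - f z = (w - z) *: q w) ->
  cderiv f z l.
Proof.
move=> cq ql [d d0 hd] e e0; have [d' d'0 hd'] := cq e e0.
exists (Num.min d d'); first by rewrite lt_min d0.
move=> w; rewrite lt_min => /andP[/hd -> /hd']; rewrite ql -scalerBr rnormZ mulrC => k.
by rewrite ler_wpM2r// rnorm_ge0.
Qed.

Lemma cderiv_derivable f z l : cderiv f z l -> derivable f z 1 /\ 'D_1 f z = l.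
Proof.
move=> h.
have c : (fun t : R[i]^o => t^-1 *: (f (t *: (1 : R[i]^o) + z) - f z)) @ 0^' --> l.
  apply/cvgrPdist_le => e /pos_ReC[ee /h[d d0 hd]].
  apply/nbhsP; exists d => // t; rewrite subr0 => td t0.
  have tz : t *: (1 : R[i]^o) + z - z = t by rewrite addrK /GRing.scale/= mulr1.
  have := hd (t *: (1 : R[i]^o) + z); rewrite tz => /(_ td) k.
  rewrite -ee norm_leC rnorm_distC.
  have -> : t^-1 *: (f (t *: (1 : R[i]^o) + z) - f z) - l =
      t^-1 *: (f (t *: (1 : R[i]^o) + z) - f z - t *: l).
    by rewrite [RHS]scalerBr scalerA mulVf// scale1r.
  by rewrite rnormZ rnormV mulrC ler_pdivrMr ?rnorm_gt0.
by split; [apply: cvgP c|exact: cvg_lim].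
Qed.

Lemma derivable_cderiv f z : derivable f z 1 -> cderiv f z ('D_1 f z).
Proof.
move=> h e e0.
have /cvgrPdist_le/(_ e%:C) : (fun t : R[i]^o => t^-1 *: (f (t *: (1 : R[i]^o) + z) - f z)) @ 0^' --> 'D_1 f z := h.
rewrite ltcR => /(_ e0) /nbhsP[d d0 hd]; exists d => // w wd.
have [->|wz] := eqVneq w z; first by rewrite !subrr scale0r subr0 !rnorm0 mulr0.
have := hd (w - z); rewrite subr0 => /(_ wd); rewrite subr_eq0 => /(_ wz).
rewrite norm_leC rnorm_distC /= [(w - z) *: _]mulr1 subrK => k.
have wz0 : 0 < rnorm (w - z) by rewrite rnorm_gt0 subr_eq0.
rewrite -ler_pdivrMr// mulrC -rnormV -rnormZ.
by rewrite scalerBr scalerA mulVf ?scale1r// subr_eq0.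
Qed.

Lemma ccont_ext f g z : (exists2 d : R, 0 < d & forall w, rnorm (w - z) < d -> f w = g w) ->
  ccont f z -> ccont g z.
Proof.
move=> [d d0 hd] h e e0; have [d' d'0 hd'] := h e e0.
exists (Num.min d d'); first by rewrite lt_min d0.
move=> w; rewrite lt_min => /andP[k1 k2]; rewrite -!hd ?subrr ?rnorm0//; exact: hd'.
Qed.

Lemma cderiv_ext f g z l : (exists2 d : R, 0 < d & forall w, rnorm (w - z) < d -> f w = g w) ->
  cderiv f z l -> cderiv g z l.
Proof.
move=> [d d0 hd] h e e0; have [d' d'0 hd'] := h e e0.
exists (Num.min d d'); first by rewrite lt_min d0.
move=> w; rewrite lt_min => /andP[k1 k2]; rewrite -!hd ?subrr ?rnorm0//; exact: hd'.
Qed.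

Lemma ccontD f g z : ccont f z -> ccont g z -> ccont (fun w => f w + g w) z.
Proof. by move=> /ccontP h1 /ccontP h2; apply/ccontP; apply: (cvgD h1 h2). Qed.

Lemma ccontB f g z : ccont f z -> ccont g z -> ccont (fun w => f w - g w) z.
Proof. by move=> /ccontP h1 /ccontP h2; apply/ccontP; apply: (cvgB h1 h2). Qed.

Lemma ccont_cst (c : E) z : ccont (fun=> c) z.
Proof. by move=> e e0; exists 1 => // w _; rewrite subrr rnorm0 ltW. Qed.

Lemma ccont_comp f (phi : R[i]^o -> R[i]^o) z :
  (forall e : R, 0 < e -> exists2 d : R, 0 < d &
    forall w, rnorm (w - z) < d -> rnorm (phi w - phi z) <= e) ->
  ccont f (phi z) -> ccont (fun w => f (phi w)) z.
Proof.
move=> h1 h2 e e0; have [d d0 hd] := h2 e e0.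
have d20 : 0 < d / 2 by rewrite divr_gt0.
have [d' d'0 hd'] := h1 _ d20; exists d' => // w /hd' k; apply: hd; lra.
Qed.

Lemma ccontZ (phi : R[i]^o -> R[i]^o) f z :
  (phi w @[w --> z] --> phi z) -> ccont f z -> ccont (fun w => phi w *: f w) z.
Proof. by move=> h1 /ccontP h2; apply/ccontP; apply: (cvgZ h1 h2). Qed.

Lemma cderivD f g z l m : cderiv f z l -> cderiv g z m ->
  cderiv (fun w => f w + g w) z (l + m).
Proof.
move=> /slope_contP h1 /slope_contP h2.
apply: (cderiv_slope (ccontD h1 h2)); first by rewrite /slope eqxx.
exists 1 => // w _; rewrite scalerDr -!slopeE; linear_identity.
Qed.

Lemma cderivB f g z l m : cderiv f z l -> cderiv g z m ->
  cderiv (fun w => f w - g w) z (l - m).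
Proof.
move=> /slope_contP h1 /slope_contP h2.
apply: (cderiv_slope (ccontB h1 h2)); first by rewrite /slope eqxx.
exists 1 => // w _; rewrite scalerBr -!slopeE; linear_identity.
Qed.

Lemma cderiv_cst (c : E) z : cderiv (fun=> c) z 0.
Proof.
move=> e e0; exists 1 => // w _.
by rewrite subrr scaler0 subr0 rnorm0 mulr_ge0 ?(ltW e0) ?rnorm_ge0.
Qed.

End continuity.

Section products.
Context (R : realType) (E : normedModType R[i]).
Implicit Types (f g : R[i]^o -> E) (phi : R[i]^o -> R[i]^o) (z w : R[i]^o).

Lemma cderivZ phi f z k l : cderiv phi z k -> cderiv f z l ->
  cderiv (fun w => phi w *: f w) z (k *: f z + phi z *: l).
Proof.
move=> h1 h2; have c1 := cderiv_cont h1; move/slope_contP: h1 => h1.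
move/slope_contP: h2 => h2.
pose q w := slope phi z k w *: f z + phi w *: slope f z l w.
apply: (@cderiv_slope _ _ _ _ _ q).
- apply: ccontD; last by apply: ccontZ => //; apply/ccontP.
  by apply: ccontZ; [apply/ccontP|exact: ccont_cst].
- by rewrite /q /slope !eqxx.
exists 1 => // w _; rewrite /q.
have e1 : (w - z) *: (slope phi z k w *: f z) = (phi w - phi z) *: f z.
  by rewrite scalerA (slopeE phi z k w).
have e2 := slopeE f z l w; rewrite scalerDr e1.
rewrite (_ : (w - z) *: (phi w *: slope f z l w) = phi w *: ((w - z) *: slope f z l w)).
  by rewrite -e2; linear_identity.
by rewrite !scalerA; congr (_ *: _); rewrite mulrC.
Qed.

Lemma cderiv_comp f phi z k l : cderiv phi z k -> cderiv f (phi z) l ->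
  cderiv (fun w => f (phi w)) z (k *: l).
Proof.
move=> h1 h2; have c1 := cderiv_cont h1; move/slope_contP: h1 => h1.
move/slope_contP: h2 => h2.
pose q w := slope phi z k w *: slope f (phi z) l (phi w).
apply: (@cderiv_slope _ _ _ _ _ q).
- by apply: ccontZ; [apply/ccontP|apply: (ccont_comp _ h2)].
- by rewrite /q /slope !eqxx.
exists 1 => // w _; rewrite (slopeE f _ l) /q scalerA; congr (_ *: _).
exact: (slopeE phi).
Qed.

Lemma cderiv_id z : cderiv (fun w : R[i]^o => w) z 1.
Proof.
move=> e e0; exists 1 => // w _.
by rewrite [_ *: 1]mulr1 subrr rnorm0 mulr_ge0 ?(ltW e0) ?rnorm_ge0.
Qed.

Lemma cderivV phi z k : phi z != 0 -> cderiv phi z k ->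
  cderiv (fun w => (phi w)^-1) z (- (k / phi z ^+ 2)).
Proof.
move=> p0 h; have c := cderiv_cont h; move/slope_contP: (h) => hs.
pose q w : R[i]^o := - (slope phi z k w / (phi w * phi z)).
apply: (@cderiv_slope _ _ _ _ _ q).
- move/ccontP: hs => h1; move/ccontP: c => h2.
  have /ccontP h3 := ccont_cst (phi z) z.
  by apply/ccontP; exact: (cvgN (cvgM h1 (cvgV (mulf_neq0 p0 p0) (cvgM h2 h3)))).
- by rewrite /q /slope eqxx expr2.
have n0 : 0 < rnorm (phi z) / 2 by rewrite divr_gt0 ?rnorm_gt0.
have [d d0 hd] := c _ n0; exists d => // w /hd kd.
have w0 : phi w != 0.
  apply/eqP => e; move: kd; rewrite e sub0r rnormN => kd; move: n0; lra.
transitivity (- ((phi w - phi z) / (phi w * phi z)) : R[i]).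
  by field; rewrite p0 w0.
rewrite /q (slopeE phi z k w); move: (slope _ _ _ _) => s.
change (- ((w - z) * s / (phi w * phi z)) = (w - z) * (- (s / (phi w * phi z))) :> R[i]).
by rewrite mulrN mulrA.
Qed.

End products.

(** * Goursat's theorem *)

Lemma rnorm_nat (R : realType) n : rnorm (n%:R : R[i]^o) = n%:R.
Proof. by rewrite -(rmorph_nat (real_complex R)) rnorm_real normr_nat. Qed.

Section rectangle_integral.
Context (R : realType) (E : normedModType R[i]).
Implicit Types (f g : R[i]^o -> E) (z w : R[i]^o) (x y a b c d : R).

Definition entire_cont f := forall z, ccont f z.

Lemma rnorm_pt_le x y : rnorm (pt x y : R[i]^o) <= `|x| + `|y|.
Proof. exact: (rnorm_le_ReIm (pt x y)). Qed.

Lemma contR_hor f y : entire_cont f -> contR (fun x => f (pt x y)).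
Proof.
move=> h x e e0; have [d d0 hd] := h (pt x y) e e0; exists d => // x' xx.
by apply: hd; rewrite ptB subrr (le_lt_trans (rnorm_pt_le _ _))// normr0 addr0.
Qed.

Lemma contR_ver f x : entire_cont f -> contR (fun y => f (pt x y)).
Proof.
move=> h y e e0; have [d d0 hd] := h (pt x y) e e0; exists d => // x' xx.
by apply: hd; rewrite ptB subrr (le_lt_trans (rnorm_pt_le _ _))// normr0 add0r.
Qed.

Definition hint f a b y := vint (fun x => f (pt x y)) a b.
Definition vvint f c d x := vint (fun y => f (pt x y)) c d.
(** The integral along the boundary of a rectangle, counterclockwise. *)
Definition rect f a b c d : E :=
  hint f a b c + 'i *: vvint f c d b - hint f a b d - 'i *: vvint f c d a.

Lemma primitive_path (Q q : R[i]^o -> E) (z0 u : R[i]^o) :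
  (forall z, cderiv Q z (q z)) ->
  primitive (fun t : R => Q (z0 + t%:C * u)) (fun t => u *: q (z0 + t%:C * u)).
Proof.
move=> h x e e0; have u1 : 0 < rnorm u + 1 by rewrite ltr_wpDl ?rnorm_ge0.
have [d d0 hd] := h (z0 + x%:C * u) _ (divr_gt0 e0 u1).
exists (d / (rnorm u + 1)); first by rewrite divr_gt0.
move=> y; rewrite ltr_pdivlMr// => yx.
have zz : z0 + y%:C * u - (z0 + x%:C * u) = (y - x)%:C * u by rewrite rmorphB/=; ring.
have nzz : rnorm ((y - x)%:C * u : R[i]^o) <= `|y - x| * (rnorm u + 1).
  by rewrite rnormM rnorm_real mulrDr lerDl mulr1.
have := hd (z0 + y%:C * u); rewrite zz => /(_ (le_lt_trans nzz yx)).
rewrite scalerA => /le_trans; apply.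
rewrite -mulrA ler_pM2l// mulrC ler_pdivrMr//.
Qed.

Hypothesis cE : rcomplete E.

Lemma rect_exact (Q q : R[i]^o -> E) a b c d :
  (forall z, cderiv Q z (q z)) -> rect q a b c d = 0.
Proof.
move=> h.
have H y : hint q a b y = Q (pt b y) - Q (pt a y).
  have eH x : pt x y = pt 0 y + x%:C * 1 by rewrite mulr1 -[x%:C]/(pt x 0) ptD add0r addr0.
  have eQ (T : Type) (h' : R[i]^o -> T) :
      (fun t : R => h' (pt 0 y + t%:C * 1)) = (fun t => h' (pt t y)).
    by apply/funext => x; rewrite -eH.
  have := primitive_path (pt 0 y) 1 h; rewrite eQ => hp.
  apply: (vintE a b (F := fun x => Q (pt x y))); apply: (primitive_ext hp) => x.
  by rewrite scale1r -eH.
have V x : 'i *: vvint q c d x = Q (pt x d) - Q (pt x c).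
  have eV y : pt x y = pt x 0 + y%:C * 'i.
    by apply/eqP; rewrite eq_complex /=; apply/andP; split; apply/eqP; ring.
  have ni : rnorm (- 'i : R[i]) = 1 := etrans (rnormN ('i : R[i]^o)) (rnormi R).
  have := primitive_linear (L := GRing.scale (- 'i : R[i]) : {linear E -> E})
     (M := 1) (fun v => _) (primitive_path (pt x 0) 'i h).
  move=> /(_ (fun v => ltac:(by rewrite mul1r /= rnormZ ni mul1r))) hp.
  rewrite /vvint.
  have -> : (fun y => q (pt x y)) = (fun y => - 'i *: ('i *: q (pt x 0 + y%:C * 'i))).
    apply/funext => y; rewrite scalerA mulNr -expr2 sqr_i opprK scale1r -eV//.
  rewrite (vintE c d hp) /= -scalerBr scalerA mulrN -expr2 sqr_i opprK scale1r.
  by rewrite -!eV.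
by rewrite /rect !H !V; linear_identity.
Qed.

Lemma rectD f g a b c d : entire_cont f -> entire_cont g ->
  rect (fun z => f z + g z) a b c d = rect f a b c d + rect g a b c d.
Proof.
move=> hf hg; rewrite /rect /hint /vvint.
rewrite (vintD cE _ _ (contR_hor c hf) (contR_hor c hg)).
rewrite (vintD cE _ _ (contR_hor d hf) (contR_hor d hg)).
rewrite (vintD cE _ _ (contR_ver a hf) (contR_ver a hg)).
rewrite (vintD cE _ _ (contR_ver b hf) (contR_ver b hg)).
linear_identity.
Qed.

Lemma rect_bound f a b c d M : entire_cont f -> a <= b -> c <= d ->
  (forall x y, a <= x <= b -> c <= y <= d -> rnorm (f (pt x y)) <= M) ->
  rnorm (rect f a b c d) <= M * (2 * ((b - a) + (d - c))).
Proof.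
move=> hf ab cd h; rewrite /rect /hint /vvint.
have h1 := vint_bound cE (contR_hor c hf) ab (fun t tab => h t c tab ltac:(by rewrite lexx cd)).
have h2 := vint_bound cE (contR_hor d hf) ab (fun t tab => h t d tab ltac:(by rewrite lexx cd)).
have h3 := vint_bound cE (contR_ver a hf) cd (fun t tab => h a t ltac:(by rewrite lexx ab) tab).
have h4 := vint_bound cE (contR_ver b hf) cd (fun t tab => h b t ltac:(by rewrite lexx ab) tab).
set p := vint _ a b in h1 *; set q := vint _ c d in h4 *.
set r := vint _ a b in h2 *; set s := vint _ c d in h3 *.
apply: (le_trans (rnormB _ _)); rewrite rnorm_scalei.
have := rnormB (p + 'i *: q) r; have := rnormD p ('i *: q); rewrite rnorm_scalei; lra.
Qed.

Lemma rect_catx f a b c d m : entire_cont f ->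
  rect f a b c d = rect f a m c d + rect f m b c d.
Proof.
move=> hf; rewrite /rect /hint (vint_cat cE m a b (contR_hor c hf)).
rewrite (vint_cat cE m a b (contR_hor d hf)); linear_identity.
Qed.

Lemma rect_caty f a b c d m : entire_cont f ->
  rect f a b c d = rect f a b c m + rect f a b m d.
Proof.
move=> hf; rewrite /rect /vvint (vint_cat cE m c d (contR_ver a hf)).
rewrite (vint_cat cE m c d (contR_ver b hf)); linear_identity.
Qed.

Lemma cderiv_quadratic (A B : E) z :
  cderiv (fun w => w *: A + (w ^+ 2 / 2) *: B) z (A + z *: B).
Proof.
have h1 := cderivZ (cderiv_id z) (cderiv_cst A z).
have sq : cderiv (fun w : R[i]^o => w ^+ 2 / 2 : R[i]^o) z z.
  pose q (w : R[i]^o) : R[i]^o := (w + z) / 2.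
  apply: (@cderiv_slope _ _ _ _ _ q).
  - move=> e e0; exists e => // w k; rewrite (_ : q w - q z = (w - z) / 2).
      rewrite rnormM rnormV (rnorm_nat R 2) ler_pdivrMr//.
      by have := rnorm_ge0 (w - z); lra.
    by rewrite /q; field.
  - by rewrite /q; field.
  - exists 1 => // w _.
    by change (w ^+ 2 / 2 - z ^+ 2 / 2 = (w - z) * ((w + z) / 2) :> R[i]); field.
have := cderivD h1 (cderivZ sq (cderiv_cst B z)).
by rewrite !scaler0 !addr0 scale1r.
Qed.

(** The bound [2 e (perimeter / 2)^2] on the boundary integral is additive over
quarterings, and near a point of differentiability it holds because the affine
part of [f] has a primitive. *)
Lemma goursat f a b c d : entire_cont f -> a <= b -> c <= d ->
  (forall x y, a <= x <= b -> c <= y <= d -> exists l, cderiv f (pt x y) l) ->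
  rect f a b c d = 0.
Proof.
move=> hf ab cd hd; apply: rnorm_le_eps => e e0.
pose s := (b - a) + (d - c); have s0 : 0 <= s by rewrite /s; lra.
pose e1 := e / (2 * s ^+ 2 + 1).
have s1 : 0 < 2 * s ^+ 2 + 1 by rewrite ltr_wpDl// mulr_ge0// sqr_ge0.
have e10 : 0 < e1 by rewrite divr_gt0.
have : rnorm (rect f a b c d) <= 2 * e1 * ((b - a) + (d - c)) ^+ 2.
  apply: (bisection2 (P := fun a b c d =>
    rnorm (rect f a b c d) <= 2 * e1 * ((b - a) + (d - c)) ^+ 2)) => //.
    move=> a1 b1 c1 d1 _ _.
    move: e1 {e10} => e1 h1 h2 h3 h4.
    rewrite (rect_catx _ _ _ _ ((a1 + b1) / 2) hf) (rect_caty a1 _ _ _ ((c1 + d1) / 2) hf).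
    rewrite (rect_caty _ b1 _ _ ((c1 + d1) / 2) hf).
    apply: (le_trans (rnormD _ _)).
    have := rnormD (rect f a1 ((a1 + b1) / 2) c1 ((c1 + d1) / 2)) (rect f a1 ((a1 + b1) / 2) ((c1 + d1) / 2) d1).
    have := rnormD (rect f ((a1 + b1) / 2) b1 c1 ((c1 + d1) / 2)) (rect f ((a1 + b1) / 2) b1 ((c1 + d1) / 2) d1).
    have k1 : (a1 + b1) / 2 - a1 = (b1 - a1) / 2 by field.
    have k2 : b1 - (a1 + b1) / 2 = (b1 - a1) / 2 by field.
    have k3 : (c1 + d1) / 2 - c1 = (d1 - c1) / 2 by field.
    have k4 : d1 - (c1 + d1) / 2 = (d1 - c1) / 2 by field.
    rewrite k1 k2 k3 k4 in h1 h2 h3 h4; lra.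
  move=> x y xab ycd; have [l hl] := hd x y xab ycd.
  have [r r0 hr] := hl _ e10; exists (r / 2); first lra.
  move=> a' b' c' d' aa ax xb bb cc cy yd dd hba hdc.
  pose z := pt x y; pose A := f z - z *: l.
  have cA : entire_cont (fun w => A + w *: l).
    move=> w; apply: cderiv_cont; apply: (cderivD (cderiv_cst A w)).
    exact: (cderivZ (cderiv_id w) (cderiv_cst l w)).
  pose g w := f w - (A + w *: l).
  have cg : entire_cont g by move=> w; apply: ccontB.
  have fE : f = (fun w => (A + w *: l) + g w).
    by apply/funext => w; rewrite /g addrC subrK.
  rewrite {1}fE rectD// (rect_exact _ _ _ _ (fun w => cderiv_quadratic A l w)) add0r.
  pose p := (b' - a') + (d' - c').
  have : rnorm (rect g a' b' c' d') <= (e1 * p) * (2 * p).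
    apply: rect_bound => //; [lra|lra|move=> x' y' hx hy].
    have nz : rnorm (pt x' y' - z) <= p.
      rewrite ptB (le_trans (rnorm_pt_le _ _))// lerD// ler_norml; lra.
    have := hr (pt x' y'); rewrite (_ : f _ - _ - _ = g (pt x' y')); last first.
      by rewrite /g /A -/z; linear_identity.
    have pr : p < r by rewrite /p; lra.
    move=> /(_ (le_lt_trans nz pr)) /le_trans; apply.
    by rewrite ler_wpM2l// ltW.
  by rewrite -/p expr2; lra.
move=> /le_trans; apply; rewrite -/s /e1.
rewrite (_ : _ * _ * _ = e * (2 * s ^+ 2 / (2 * s ^+ 2 + 1))); last by field; lra.
rewrite ger_pMr// ler_pdivrMr//; lra.
Qed.

End rectangle_integral.

(** * The complex exponential *)

Section exponential.
Context (R : realType).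
Implicit Types (x y t : R) (z w : R[i]^o).

Lemma is_derive_real_primitive (G gam : R -> R) :
  (forall t : R, is_derive t 1 G (gam t)) -> real_primitive G gam.
Proof.
move=> h x e e0; have [hx gx] := h x.
have /cvgrPdist_le/(_ e e0) : (fun t : R => t^-1 *: (G (t *: (1 : R) + x) - G x)) @ 0^' --> 'D_1 G x := hx.
rewrite gx => /nbhs_normP[d /= d0 hd]; exists d => // y yx.
have [->|yx0] := eqVneq y x; first by rewrite !subrr mul0r subr0 normr0 mulr0.
have := hd (y - x); rewrite /= sub0r normrN => /(_ yx); rewrite subr_eq0 => /(_ yx0).
rewrite [_ *: 1]mulr1 subrK => k.
have yx1 : 0 < `|y - x| by rewrite normr_gt0 subr_eq0.
rewrite -ler_pdivrMr// -normfV -normrM -normrN; apply: le_trans k.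
rewrite le_eqVlt; apply/orP; left; apply/eqP; congr (`|_|).
have yx2 : y - x != 0 by rewrite subr_eq0.
rewrite [(y - x)^-1 *: _]mulrC; field.
exact: yx2.
Qed.

Definition cexp z : R[i]^o :=
  pt (expR (complex.Re z) * cos (complex.Im z)) (expR (complex.Re z) * sin (complex.Im z)).

Lemma cexpD z w : cexp (z + w) = cexp z * cexp w :> R[i].
Proof.
case: z w => a b [c d]; rewrite /cexp /= expRD cosD sinD.
by apply/eqP; rewrite eq_complex /=; apply/andP; split; apply/eqP; ring.
Qed.

Lemma cexp_neq0 z : cexp z != 0.
Proof.
apply/eqP => h; have := cexpD z (- z); rewrite h mul0r subrr /cexp /= expR0 cos0 sin0.
by move=> [] /eqP; rewrite mulr1 oner_eq0.
Qed.

Lemma rnorm_cexp z : rnorm (cexp z) = expR (complex.Re z).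
Proof.
rewrite rnormE_sqrt /= !exprMn -mulrDr cos2Dsin2 mulr1 sqrtr_sqr ger0_norm//.
Qed.

Lemma cderiv_cexp0 : cderiv cexp 0 1.
Proof.
move=> e e0.
have [e' [e'0 e'1 e'e]] : exists e', [/\ 0 < e', e' <= 1 & e' <= e / 12].
  exists (Num.min (e / 12) 1).
  by rewrite lt_min ltr01 divr_gt0// !ge_min !lexx orbT.
have [d2 d20 h2] := is_derive_real_primitive (@is_derive_expR R) 0 e'0.
have [d3 d30 h3] := is_derive_real_primitive (@is_derive_cos R) 0 e'0.
have [d4 d40 h4] := is_derive_real_primitive (@is_derive_sin R) 0 e'0.
exists (Num.min (Num.min e' d2) (Num.min d3 d4)).
  by rewrite !lt_min e'0 d20 d30 d40.
move=> [x y]; rewrite !lt_min !subr0 => /andP[/andP[ze z2] /andP[z3 z4]].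
set z : R[i]^o := (x +i* y)%C in ze z2 z3 z4 *.
have xz : `|x| <= rnorm z := Re_le z.
have yz : `|y| <= rnorm z := Im_le z.
have z0 := rnorm_ge0 z.
have {}h2 := h2 x; have {}h3 := h3 y; have {}h4 := h4 y.
rewrite !subr0 expR0 mulr1 in h2; rewrite !subr0 cos0 sin0 oppr0 mulr0 subr0 in h3.
rewrite !subr0 sin0 cos0 mulr1 subr0 in h4.
have {}h2 := h2 (le_lt_trans xz z2).
have {}h3 := h3 (le_lt_trans yz z3).
have {}h4 := h4 (le_lt_trans yz z4).
have -> : cexp z - cexp 0 - z *: (1 : R[i]^o) =
    pt ((expR x - 1 - x) + expR x * (cos y - 1)) (expR x * (sin y - y) + (expR x - 1) * y).
  rewrite /cexp /= expR0 cos0 sin0 [z *: _]mulr1 /z.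
  by apply/eqP; rewrite eq_complex /=; apply/andP; split; apply/eqP; ring.
apply: (le_trans (rnorm_pt_le _ _)).
have n1 : `|expR x - 1| <= 2 * rnorm z.
  have := ler_normD (expR x - 1 - x) x; rewrite subrK.
  have : e' * `|x| <= 1 * `|x| by rewrite ler_wpM2r.
  lra.
have n2 : `|expR x| <= 3.
  have := ler_normD (expR x - 1) 1; rewrite subrK normr1; lra.
have f1 : e' * `|x| <= e' * rnorm z by rewrite ler_wpM2l// ltW.
have f2 : e' * `|y| <= e' * rnorm z by rewrite ler_wpM2l// ltW.
have f3 : `|expR x * (cos y - 1)| <= 3 * (e' * rnorm z).
  by rewrite normrM ler_pM//; lra.
have f4 : `|expR x * (sin y - y)| <= 3 * (e' * rnorm z).
  by rewrite normrM ler_pM//; lra.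
have f5 : `|(expR x - 1) * y| <= 2 * (e' * rnorm z).
  rewrite normrM mulrA ler_pM//; lra.
have g1 := ler_normD (expR x - 1 - x) (expR x * (cos y - 1)).
have g2 := ler_normD (expR x * (sin y - y)) ((expR x - 1) * y).
have : e' * rnorm z <= e / 12 * rnorm z by rewrite ler_wpM2r.
have : 0 <= e * rnorm z by rewrite mulr_ge0// ltW.
lra.
Qed.

Lemma cderiv_cexp z : cderiv cexp z (cexp z).
Proof.
move=> e e0; have n0 : 0 < rnorm (cexp z) by rewrite rnorm_gt0 cexp_neq0.
have [d d0 hd] := cderiv_cexp0 (divr_gt0 e0 n0); exists d => // w wz.
have := hd (w - z); rewrite subr0 => /(_ wz) k.
have -> : cexp w - cexp z - (w - z) *: cexp z =
    (cexp z * (cexp (w - z) - cexp 0 - (w - z) *: (1 : R[i]^o)) : R[i]).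
  have c0 : cexp 0 = 1 by rewrite /cexp /= expR0 cos0 sin0 mulr0 mulr1.
  have cw : cexp w = cexp z * cexp (w - z) by rewrite -cexpD addrC subrK.
  rewrite c0 cw.
  change (cexp z * cexp (w - z) - cexp z - (w - z) * cexp z =
    cexp z * (cexp (w - z) - 1 - (w - z) * 1) :> R[i]).
  ring.
rewrite rnormM -ler_pdivlMl// mulrA [_^-1 * e]mulrC//.
Qed.

End exponential.

(** * Mean values on circles and the maximum principle *)

Section maximum.
Context (R : realType) (E : normedModType R[i]).
Implicit Types (f g : R[i]^o -> E) (z w : R[i]^o) (x y a b c d r : R).

Definition circ z r (t : R) : R[i]^o := z + r%:C * cexp (pt 0 t).

Definition mean_valued f z := exists2 rho : R, 0 < rho & forall r, 0 < r < rho ->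
  vint (fun t => f (circ z r t)) 0 (2 * pi) = (2 * pi)%:C *: f z.

Lemma cexp_scale r t : 0 < r -> cexp (pt (ln r) t) = r%:C * cexp (pt 0 t) :> R[i].
Proof.
move=> r0; rewrite /cexp /= lnK ?posrE// expR0 !mul1r.
by apply/eqP; rewrite eq_complex /=; apply/andP; split; apply/eqP; ring.
Qed.

Lemma rnorm_circ z r t : 0 < r -> rnorm (circ z r t - z) = r.
Proof.
move=> r0; rewrite /circ addrC addKr rnormM rnorm_cexp /= expR0 mulr1.
by rewrite rnorm_real gtr0_norm.
Qed.

Hypothesis cE : rcomplete E.

(** In the coordinate [u] with [w = z + exp u], circles around [z] are vertical
segments, and the two horizontal sides of the rectangle of height [2 pi]
cancel.  Goursat's theorem then shows that the mean does not depend on the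
radius, and its limit at radius 0 is [f z].  Since [z] itself is never reached,
continuity there is enough. *)
Lemma circle_mean f z rho : entire_cont f -> 0 < rho ->
  (forall w, w != z -> rnorm (w - z) < rho -> exists l, cderiv f w l) ->
  mean_valued f z.
Proof.
move=> hf rho0 hd; exists rho => // r /andP[r0 rrho].
have p0 : 0 <= 2 * pi :> R by rewrite mulr_ge0 ?pi_ge0.
pose h w := f (z + cexp w).
have ch : entire_cont h.
  move=> w; apply: (@ccont_comp _ _ f (fun u => z + cexp u)) => // e e0.
  have [d d0 kd] := cderiv_cont (cderiv_cexp w) e0; exists d => // u /kd.
  by rewrite opprD addrACA subrr add0r.
have hE s t : 0 < s -> h (pt (ln s) t) = f (circ z s t).
  by move=> s0; rewrite /h /circ cexp_scale.
have ciE s : 0 < s -> (fun t => f (circ z s t)) = (fun t => h (pt (ln s) t)).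
  by move=> s0; apply/funext => t; rewrite hE.
have indep s : 0 < s -> s <= r ->
    vint (fun t => f (circ z s t)) 0 (2 * pi) = vint (fun t => f (circ z r t)) 0 (2 * pi).
  move=> s0 sr; rewrite (ciE s s0) (ciE r r0).
  have lnsr : ln s <= ln r by rewrite ler_ln ?posrE.
  have gs := goursat cE ch lnsr p0.
  have {gs} : rect h (ln s) (ln r) 0 (2 * pi) = 0.
    apply: gs => x y /andP[_ xr] _.
    have nx : rnorm (cexp (pt x y)) <= r.
      by rewrite rnorm_cexp /= -(lnK (_ : r \is Num.pos)) ?posrE// ler_expR.
    have [||l hl] := hd (z + cexp (pt x y)).
    - by rewrite -subr_eq0 addrC addKr cexp_neq0.
    - by rewrite addrC addKr (le_lt_trans nx).
    exists (cexp (pt x y) *: l).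
    apply: (@cderiv_comp _ _ f (fun u => z + cexp u)) => //.
    by have := cderivD (cderiv_cst z _) (cderiv_cexp (pt x y)); rewrite add0r.
  rewrite /rect.
  have -> : hint h (ln s) (ln r) (2 * pi) = hint h (ln s) (ln r) 0.
    rewrite /hint; congr vint; apply/funext => x; congr (f (z + _)).
    rewrite (_ : 2 * pi = pi + pi); last by ring.
    by rewrite /cexp /= cosDpi sinDpi cospi sinpi opprK oppr0 cos0 sin0.
  set A := hint _ _ _ _; set V1 := vvint _ _ _ _; set V2 := vvint _ _ _ _ => e.
  have {}e : 'i *: V1 = 'i *: V2.
    apply/eqP; rewrite -subr_eq0; apply/eqP; rewrite -[RHS]e; linear_identity.
  have ni : - 'i * 'i = 1 :> R[i] by rewrite mulNr -expr2 sqr_i opprK.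
  have {e}e := congr1 ( *:%R (- 'i : R[i])) e.
  rewrite !scalerA ni !scale1r in e; exact: esym e.
apply/eqP; rewrite -subr_eq0; apply/eqP; apply: rnorm_le_eps => e e0.
have pp : 0 < 2 * pi + 1 :> R by lra.
have [d d0 kd] := hf z _ (divr_gt0 e0 pp).
pose s := Num.min r (d / 2).
have s0 : 0 < s by rewrite lt_min r0 divr_gt0.
have sr : s <= r by rewrite ge_min lexx.
have sd : s < d.
  by apply: (@le_lt_trans _ _ (d / 2)); [rewrite ge_min lexx orbT|lra].
rewrite -(indep s)// ciE//.
have cs : contR (fun t => h (pt (ln s) t)) := contR_ver _ ch.
have ck : contR (fun _ : R => - f z).
  by move=> x e' e'0; exists 1 => // *; rewrite subrr rnorm0 ltW.
rewrite (_ : _ - _ = vint (fun t => h (pt (ln s) t) + - f z) 0 (2 * pi)); last first.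
  by rewrite (vintD cE _ _ cs ck) vint_cst subr0 scalerN.
have cc : contR (fun t => h (pt (ln s) t) + - f z).
  apply: (@contR_ver _ _ (fun w => h w + - f z)) => w.
  by apply: ccontD => //; exact: ccont_cst.
apply: le_trans (vint_bound (M := e / (2 * pi + 1)) cE cc p0 _) _.
  by move=> t _; rewrite hE//; apply: kd; rewrite rnorm_circ.
by rewrite subr0 mulrAC -mulrA ger_pMr// ler_pdivrMr//; lra.
Qed.

Lemma holomorphic_mean f z rho : entire_cont f -> 0 < rho ->
  (forall w, rnorm (w - z) < rho -> exists l, cderiv f w l) -> mean_valued f z.
Proof. by move=> hf r0 h; apply: (circle_mean hf r0) => w _; exact: h. Qed.

(** If no point were maximal, each point would have a neighbourhood on which [v]
stays below some value of [v]; by bisection the whole rectangle would lie below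
one of its own values. *)
Lemma rect_max (v : R[i]^o -> R) a b c d : a <= b -> c <= d ->
  (forall z (e : R), 0 < e -> exists2 r : R, 0 < r &
     forall w, rnorm (w - z) < r -> `|v w - v z| <= e) ->
  exists x0 y0, [/\ a <= x0 <= b, c <= y0 <= d &
    forall x y, a <= x <= b -> c <= y <= d -> v (pt x y) <= v (pt x0 y0)].
Proof.
move=> ab cd hv; apply: contrapT => H.
have {}H x0 y0 : a <= x0 <= b -> c <= y0 <= d -> exists x y,
    [/\ a <= x <= b, c <= y <= d & v (pt x0 y0) < v (pt x y)].
  move=> hx hy; apply: contrapT => k; apply: H; exists x0, y0; split => // x y xab ycd.
  by rewrite leNgt; apply/negP => vv; apply: k; exists x, y.
have : exists x0 y0, [/\ a <= x0 <= b, c <= y0 <= d &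
    forall x y, a <= x <= b -> c <= y <= d -> v (pt x y) < v (pt x0 y0)].
  apply: (bisection2 (P := fun a' b' c' d' => exists x0 y0,
     [/\ a <= x0 <= b, c <= y0 <= d & forall x y,
       a' <= x <= b' -> c' <= y <= d' -> v (pt x y) < v (pt x0 y0)])) => //; last first.
    move=> x y xab ycd; have [x1 [y1 [hx1 hy1 lt1]]] := H x y xab ycd.
    have k0 : 0 < (v (pt x1 y1) - v (pt x y)) / 2 by lra.
    have [r r0 hr] := hv (pt x y) _ k0; exists (r / 2); first lra.
    move=> a' b' c' d' *; exists x1, y1; split => // x2 y2 hx2 hy2.
    have : `|v (pt x2 y2) - v (pt x y)| <= (v (pt x1 y1) - v (pt x y)) / 2.
      apply: hr; rewrite ptB (le_lt_trans (rnorm_pt_le _ _))//.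
      have : `|x2 - x| <= b' - a' by rewrite ler_norml; lra.
      have : `|y2 - y| <= d' - c' by rewrite ler_norml; lra.
      lra.
    by rewrite ler_norml; lra.
  have two (P Q : R -> R -> Prop) :
      (exists x0 y0, [/\ a <= x0 <= b, c <= y0 <= d & forall x y, P x y -> v (pt x y) < v (pt x0 y0)]) ->
      (exists x0 y0, [/\ a <= x0 <= b, c <= y0 <= d & forall x y, Q x y -> v (pt x y) < v (pt x0 y0)]) ->
      exists x0 y0, [/\ a <= x0 <= b, c <= y0 <= d &
        forall x y, P x y \/ Q x y -> v (pt x y) < v (pt x0 y0)].
    move=> [x1 [y1 [hx1 hy1 h1]]] [x2 [y2 [hx2 hy2 h2]]].
    have [le12|/ltW le21] := leP (v (pt x1 y1)) (v (pt x2 y2)).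
      by exists x2, y2; split => // x y [/h1|/h2//]; move=> /lt_le_trans; apply.
    by exists x1, y1; split => // x y [/h1//|/h2]; move=> /lt_le_trans; apply.
  move=> a' b' c' d' _ _ h1 h2 h3 h4.
  pose In x1 x2 y1 y2 (x y : R) := x1 <= x <= x2 /\ y1 <= y <= y2.
  have cv x1 x2 y1 y2 : (exists x0 y0, [/\ a <= x0 <= b, c <= y0 <= d & forall x y,
       x1 <= x <= x2 -> y1 <= y <= y2 -> v (pt x y) < v (pt x0 y0)]) ->
     exists x0 y0, [/\ a <= x0 <= b, c <= y0 <= d & forall x y,
       In x1 x2 y1 y2 x y -> v (pt x y) < v (pt x0 y0)].
    by move=> [x0 [y0 [k1 k2 k3]]]; exists x0, y0; split => // x y [? ?]; exact: k3.
  have [x0 [y0 [k1 k2 k3]]] := two _ _ (two _ _ (cv _ _ _ _ h1) (cv _ _ _ _ h2))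
    (two _ _ (cv _ _ _ _ h3) (cv _ _ _ _ h4)).
  exists x0, y0; split => // x y hx hy; apply: k3; rewrite /In.
  have [xm|xm] := leP x ((a' + b') / 2); have [ym|ym] := leP y ((c' + d') / 2).
  - by left; left; split; lra.
  - by right; left; split; lra.
  - by left; right; split; lra.
  - by right; right; split; lra.
by move=> [x0 [y0 [k1 k2 /(_ x0 y0 k1 k2)]]]; rewrite ltxx.
Qed.

Lemma rnorm_dist_abs (F : normedModType R[i]) (u v : F) : `|rnorm u - rnorm v| <= rnorm (u - v).
Proof.
have h1 := rnorm_distD u v; have h2 := rnorm_distD v u; rewrite rnorm_distC in h2.
by rewrite ler_norml; lra.
Qed.

Lemma rect_bounded f a b c d : entire_cont f -> a <= b -> c <= d ->
  exists M : R, forall x y, a <= x <= b -> c <= y <= d -> rnorm (f (pt x y)) <= M.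
Proof.
move=> hf ab cd; have [|x0 [y0 [_ _ h]]] := @rect_max (fun z => rnorm (f z)) a b c d ab cd.
  move=> z e /(hf z)[r r0 hr]; exists r => // w /hr; apply: le_trans.
  exact: rnorm_dist_abs.
by exists (rnorm (f (pt x0 y0))).
Qed.

(** If the norm exceeded [M] at [z0], then for a small [e] the function
[v w = |f w| + e |w - z0|^2] would attain its maximum at an interior point.  The mean of
[|w - z0|^2] over a circle is larger than the value at the centre by the square
of the radius, against the mean value property of [f]. *)
Lemma maximum_principle f a b c d M : entire_cont f -> a <= b -> c <= d ->
  (forall x y, a < x < b -> c < y < d -> mean_valued f (pt x y)) ->
  (forall x y, a <= x <= b -> c <= y <= d -> [\/ x = a, x = b, y = c | y = d] ->
     rnorm (f (pt x y)) <= M) ->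
  forall x y, a <= x <= b -> c <= y <= d -> rnorm (f (pt x y)) <= M.
Proof.
move=> hf ab cd hm hb x0 y0 hx0 hy0; rewrite leNgt; apply/negP => big.
pose z0 := pt x0 y0; pose D := ((b - a) + (d - c)) ^+ 2 + 1.
have D0 : 0 < D by rewrite ltr_wpDl// sqr_ge0.
pose e := (rnorm (f z0) - M) / D / 2.
have e0 : 0 < e by rewrite !divr_gt0// subr_gt0.
have eD : e * D < rnorm (f z0) - M.
  rewrite /e -mulrA [_^-1 * D]mulrC mulrA divfK ?gt_eqF//.
  by move: big; rewrite -/z0; lra.
pose v w := rnorm (f w) + e * rnorm (w - z0) ^+ 2.
have hv z (k : R) : 0 < k -> exists2 r : R, 0 < r &
     forall w, rnorm (w - z) < r -> `|v w - v z| <= k.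
  move=> k0; have k20 : 0 < k / 2 by lra.
  have [r1 r10 hr1] := hf z _ k20.
  pose B := e * (2 * rnorm (z - z0) + 1).
  have B0 : 0 < B by rewrite mulr_gt0// ltr_wpDl// mulr_ge0// rnorm_ge0.
  exists (Num.min r1 (Num.min 1 (k / 2 / B))); first by rewrite !lt_min r10 ltr01 divr_gt0.
  move=> w; rewrite !lt_min ltr_pdivlMr// => /andP[/hr1 l1 /andP[l2 l3]].
  have m1 := rnorm_dist_abs (f w) (f z).
  have m2 := rnorm_dist_abs (w - z0) (z - z0).
  have wz : w - z0 - (z - z0) = w - z by rewrite opprB addrA subrK.
  rewrite wz in m2.
  have -> : v w - v z = (rnorm (f w) - rnorm (f z)) +
     e * ((rnorm (w - z0) - rnorm (z - z0)) * (rnorm (w - z0) + rnorm (z - z0))).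
    by rewrite /v; ring.
  apply: (le_trans (ler_normD _ _)); rewrite [X in _ + X]normrM [X in _ + _ * X]normrM.
  rewrite (gtr0_norm e0) (ger0_norm (addr_ge0 (rnorm_ge0 _) (rnorm_ge0 _))).
  have q0 := rnorm_ge0 (z - z0); have q1 := rnorm_ge0 (w - z0); have q2 := rnorm_ge0 (w - z).
  have m3 : `|rnorm (w - z0) - rnorm (z - z0)| * (rnorm (w - z0) + rnorm (z - z0)) <=
      rnorm (w - z) * (2 * rnorm (z - z0) + 1).
    apply: ler_pM => //; first by rewrite addr_ge0.
    by move: m2; rewrite ler_norml; lra.
  have m4 : e * (`|rnorm (w - z0) - rnorm (z - z0)| * (rnorm (w - z0) + rnorm (z - z0))) <=
      e * (rnorm (w - z) * (2 * rnorm (z - z0) + 1)) by rewrite ler_pM2l.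
  by rewrite /B in l3; lra.
have distD x y : a <= x <= b -> c <= y <= d -> rnorm (pt x y - z0) ^+ 2 <= D.
  move=> hx hy; rewrite /D; apply: (@le_trans _ _ (((b - a) + (d - c)) ^+ 2)); last by rewrite lerDl.
  rewrite lerXn2r ?nnegrE ?rnorm_ge0//; first lra.
  rewrite ptB (le_trans (rnorm_pt_le _ _))// lerD// ler_norml; lra.
have [x1 [y1 [hx1 hy1 mx]]] := rect_max ab cd hv.
pose z1 := pt x1 y1.
have vz : v z0 <= v z1 by exact: mx.
have vz0 : v z0 = rnorm (f z0) by rewrite /v subrr rnorm0 expr0n mulr0 addr0.
have nb : ~ [\/ x1 = a, x1 = b, y1 = c | y1 = d].
  move=> /(hb _ _ hx1 hy1) k.
  have : e * rnorm (z1 - z0) ^+ 2 <= e * D by rewrite ler_pM2l// distD.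
  by move: vz; rewrite vz0 /v -/z1 in k *; lra.
have hx1' : a < x1 < b.
  rewrite !lt_neqAle; case/andP: hx1 => -> ->; rewrite !andbT.
  by apply/andP; split; apply/eqP => q; apply: nb; [apply: Or41|apply: Or42].
have hy1' : c < y1 < d.
  rewrite !lt_neqAle; case/andP: hy1 => -> ->; rewrite !andbT.
  by apply/andP; split; apply/eqP => q; apply: nb; [apply: Or43|apply: Or44].
have [rho rho0 hr] := hm _ _ hx1' hy1'.
pose m := Num.min (Num.min (x1 - a) (b - x1)) (Num.min (y1 - c) (d - y1)).
have m0 : 0 < m by rewrite !lt_min !subr_gt0; case/andP: hx1' => -> ->; case/andP: hy1' => -> ->.
pose r := Num.min rho m / 2.
have mn0 : 0 < Num.min rho m by rewrite lt_min rho0.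
have r0 : 0 < r by rewrite divr_gt0.
have rrho : r < rho.
  by have : Num.min rho m <= rho by [rewrite ge_min lexx]; rewrite /r; lra.
have rm : r < m.
  by have : Num.min rho m <= m by [rewrite ge_min lexx orbT]; rewrite /r; lra.
move: (rm); rewrite /m !lt_min => /andP[/andP[ra rb] /andP[rc rd]].
have hmean := hr r ltac:(by rewrite r0).
have p0 : 0 < 2 * pi :> R by rewrite mulr_gt0 ?pi_gt0.
pose p := x1 - x0; pose q := y1 - y0.
have cE1 t : circ z1 r t = pt (x1 + r * cos t) (y1 + r * sin t).
  rewrite /circ /cexp /= expR0 !mul1r.
  by apply/eqP; rewrite eq_complex /=; apply/andP; split; apply/eqP; ring.
(* The maximality of v at z1 bounds |f| on the circle by gam, and G is a
   primitive of gam; the cosine and sine terms integrate to 0. *)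
pose gam t := v z1 - e * (p ^+ 2 + q ^+ 2 + r ^+ 2) - 2 * e * r * (p * cos t + q * sin t).
pose G t := (v z1 - e * (p ^+ 2 + q ^+ 2 + r ^+ 2)) * t - 2 * e * r * (p * sin t - q * cos t).
have bound t : rnorm (f (circ z1 r t)) <= gam t.
  have ct : `|cos t| <= 1 by rewrite ler_norml cos_geN1 cos_le1.
  have st : `|sin t| <= 1 by rewrite ler_norml sin_geN1 sin_le1.
  have rct : `|r * cos t| <= r by rewrite normrM gtr0_norm// ger_pMr.
  have rst : `|r * sin t| <= r by rewrite normrM gtr0_norm// ger_pMr.
  rewrite ler_norml in rct; rewrite ler_norml in rst.
  have := mx (x1 + r * cos t) (y1 + r * sin t) ltac:(lra) ltac:(lra).
  rewrite -cE1 {1}/v -/z1 => k.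
  suff : e * rnorm (circ z1 r t - z0) ^+ 2 =
      e * (p ^+ 2 + q ^+ 2 + r ^+ 2) + 2 * e * r * (p * cos t + q * sin t).
    by rewrite /gam; lra.
  have := cos2Dsin2 t; rewrite cE1 ptB sqr_rnorm /= => cs.
  have r2 : r ^+ 2 = (r * cos t) ^+ 2 + (r * sin t) ^+ 2.
    by rewrite !exprMn -mulrDr cs mulr1.
  by rewrite r2 /p /q; ring.
have hG : real_primitive G gam.
  apply: is_derive_real_primitive => t.
  rewrite /G /gam; apply: is_derive_eq.
  by rewrite /GRing.scale/=; ring.
have cf : entire_cont (fun w => f (z1 + w)).
  move=> w; apply: (@ccont_comp _ _ f (fun u => z1 + u)) => // k k0.
  by exists k => // u; rewrite opprD addrACA subrr add0r => /ltW.
have cc : contR (fun t => f (circ z1 r t)).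
  pose hh w := f (z1 + r%:C * cexp w).
  apply: (@contR_ver _ _ hh 0) => w.
  apply: (@ccont_comp _ _ f (fun u => z1 + r%:C * cexp u)) => // k k0.
  have [dd dd0 kd] := cderiv_cont (cderiv_cexp w) (divr_gt0 k0 r0); exists dd => // u /kd.
  rewrite opprD addrACA subrr add0r -mulrBr rnormM rnorm_real gtr0_norm//.
  by rewrite ler_pdivlMr// mulrC.
have [F hF FE] := vint_primitive cE cc.
have := mean_value hF hG (ltW p0) (fun t _ => bound t).
rewrite -FE hmean rnormZr (gtr0_norm p0) /G.
rewrite [in sin _](_ : 2 * pi = pi + pi); last by ring.
rewrite [in cos _](_ : 2 * pi = pi + pi); last by ring.
rewrite sinDpi cosDpi sin0 cos0 sinpi cospi.
have zz : rnorm (z1 - z0) ^+ 2 = p ^+ 2 + q ^+ 2 by rewrite ptB sqr_rnorm.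
rewrite {1}/v zz -/z1 => k.
have : 0 < e * r ^+ 2 * (2 * pi) by rewrite mulr_gt0 // mulr_gt0 ?exprn_gt0.
move: k; rewrite /z1; lra.
Qed.

End maximum.

(** * Uniform limits of holomorphic functions *)

Section weierstrass.
Context (R : realType) (E : normedModType R[i]).
Implicit Types (f g : R[i]^o -> E) (z w : R[i]^o).

Lemma cderiv_inv_sub z w : w != z ->
  exists l, cderiv (fun u : R[i]^o => (u - z)^-1 : R[i]^o) w l.
Proof.
move=> wz; exists (- ((1 - 0) / (w - z) ^+ 2)).
apply: (@cderivV R (fun u => u - z)); first by rewrite subr_eq0.
exact: (cderivB (cderiv_id w) (cderiv_cst z w)).
Qed.

Lemma rnorm_far z w w' : rnorm (w' - w) < rnorm (w - z) -> w' != z.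
Proof.
move=> h; apply/eqP => e; move: h; rewrite e rnorm_distC ltxx //.
Qed.

Lemma slope_far f z l w : w != z -> exists2 d : R, 0 < d & forall u,
  rnorm (u - w) < d -> (u - z)^-1 *: (f u - f z) = slope f z l u.
Proof.
move=> wz; exists (rnorm (w - z)); first by rewrite rnorm_gt0 subr_eq0.
by move=> u /rnorm_far; rewrite /slope => /negbTE ->.
Qed.

Lemma slope_entire f z l : entire_cont f -> cderiv f z l -> entire_cont (slope f z l).
Proof.
move=> hf hl w; have [->|wz] := eqVneq w z; first exact/slope_contP.
apply: (ccont_ext (slope_far f l wz)).
apply: ccontZ; last by apply: ccontB => //; exact: ccont_cst.
by have [k /cderiv_cont hk] := cderiv_inv_sub wz; apply/ccontP.
Qed.

Lemma slope_cderiv f z l w m : w != z -> cderiv f w m ->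
  exists k, cderiv (slope f z l) w k.
Proof.
move=> wz hm; have [k hk] := cderiv_inv_sub wz.
have h := cderivZ hk (cderivB hm (cderiv_cst (f z) w)).
by eexists; apply: (cderiv_ext (slope_far f l wz)); exact: h.
Qed.

Hypothesis cE : rcomplete E.

(** The slopes of the [u n] at [z] are holomorphic off [z] and continuous at [z],
so the maximum principle on a square around [z] bounds the difference of two of
them by its size on the boundary, where uniform convergence of [u n] controls
it.  Hence the slopes converge uniformly, their limit is continuous, and it is
the slope of [f]. *)
Lemma weierstrass (u : nat -> R[i]^o -> E) f z (rho : R) :
  (forall n, entire_cont (u n)) -> 0 < rho ->
  (forall n w, rnorm (w - z) < rho -> exists l, cderiv (u n) w l) ->
  (forall e : R, 0 < e -> exists N, forall n, (N <= n)%N -> forall w,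
     rnorm (w - z) < rho -> rnorm (u n w - f w) <= e) ->
  exists l, cderiv f z l.
Proof.
move=> hu rho0 hd hlim.
have zz : rnorm (z - z) < rho by rewrite subrr rnorm0.
have /choice[l hl] n := hd n z zz.
pose q n := slope (u n) z (l n).
pose r := rho / 3; have r0 : 0 < r by rewrite divr_gt0.
set x := complex.Re z; set y := complex.Im z; have zE : z = pt x y by rewrite pt_ReIm.
have near x' y' : x - r <= x' <= x + r -> y - r <= y' <= y + r -> rnorm (pt x' y' - z) < rho.
  move=> hx hy; rewrite zE ptB (le_lt_trans (rnorm_pt_le _ _))//.
  have : `|x' - x| <= r by rewrite ler_norml; lra.
  have : `|y' - y| <= r by rewrite ler_norml; lra.
  by rewrite /r; lra.
have qC e : 0 < e -> exists N, forall n m, (N <= n)%N -> (N <= m)%N -> forall x' y',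
    x - r <= x' <= x + r -> y - r <= y' <= y + r ->
    rnorm (q n (pt x' y') - q m (pt x' y')) <= e.
  move=> e0; have k0 : 0 < e * r / 4 by rewrite divr_gt0// mulr_gt0.
  have [N hN] := hlim _ k0; exists N => n m Nn Nm.
  have ent k : entire_cont (q k) by apply: slope_entire.
  have entB : entire_cont (fun w => q n w - q m w) by move=> w; apply: ccontB; apply: ent.
  have hol v : v != z -> rnorm (v - z) < rho -> exists k, cderiv (fun w => q n w - q m w) v k.
    move=> vz vr; have [a1 h1] := hd n v vr; have [a2 h2] := hd m v vr.
    have [b1 k1] := slope_cderiv (l n) vz h1.
    have [b2 k2] := slope_cderiv (l m) vz h2.
    by exists (b1 - b2); apply: cderivB.
  apply: (maximum_principle (f := fun w => q n w - q m w) cE) => //; try lra.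
  - move=> x' y' hx hy; set w := pt x' y'.
    have wz : rnorm (w - z) < rho by apply: near; lra.
    have [wz0|wz0] := eqVneq w z.
      by apply: (circle_mean cE (rho := rho)) => //; rewrite wz0.
    apply: (holomorphic_mean cE (rho := Num.min (rho - rnorm (w - z)) (rnorm (w - z)))) => //.
      by rewrite lt_min subr_gt0 wz rnorm_gt0 subr_eq0.
    move=> v; rewrite lt_min => /andP[v1 v2]; apply: hol; first exact: rnorm_far v2.
    by have := rnorm_dist w v z; lra.
  move=> x' y' hx hy hbd; set w := pt x' y'.
  have wr : r <= rnorm (w - z).
    have h1 := Re_le (w - z); have h2 := Im_le (w - z).
    have ReE : complex.Re (w - z) = x' - x by rewrite zE.
    have ImE : complex.Im (w - z) = y' - y by rewrite zE.
    rewrite ReE in h1; rewrite ImE in h2; rewrite ler_norml in h1; rewrite ler_norml in h2.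
    by case: hbd => e1; move: h1 h2; rewrite e1; lra.
  have wz : w != z by rewrite -subr_eq0 -rnorm_gt0; lra.
  have w0 : 0 < rnorm (w - z) by lra.
  rewrite /q /slope (negbTE wz) -scalerBr rnormZ rnormV mulrC ler_pdivrMr//.
  have wrho := near _ _ hx hy.
  have a1 := hN _ Nn w wrho; have a2 := hN _ Nm w wrho.
  have a3 := hN _ Nn z zz; have a4 := hN _ Nm z zz.
  rewrite (_ : u n w - u n z - (u m w - u m z) =
     (u n w - f w) - (u m w - f w) - ((u n z - f z) - (u m z - f z))); last by linear_identity.
  have b1 := rnormB (u n w - f w - (u m w - f w)) (u n z - f z - (u m z - f z)).
  have b2 := rnormB (u n w - f w) (u m w - f w).
  have b3 := rnormB (u n z - f z) (u m z - f z).
  have : e * r <= e * rnorm (w - z) by rewrite ler_wpM2l// ltW.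
  lra.
have qz n : q n z = l n by rewrite /q /slope eqxx.
have [L hL] : exists L, forall e : R, 0 < e -> exists N, forall n,
    (N <= n)%N -> rnorm (l n - L) <= e.
  apply: cE => e /qC[N hN]; exists N => n m Nn Nm.
  have := hN _ _ Nn Nm x y; rewrite -zE !qz; apply; lra.
have sC e : 0 < e -> exists N, forall x' y',
    x - r <= x' <= x + r -> y - r <= y' <= y + r ->
    rnorm (q N (pt x' y') - slope f z L (pt x' y')) <= e.
  move=> e0; have [N hN] := qC e e0; exists N => x' y' hx hy; set w := pt x' y'.
  apply/ler_addgt0Pr => k k0.
  suff [n [Nn hn]] : exists n, (N <= n)%N /\ rnorm (q n w - slope f z L w) <= k.
    have := rnorm_dist (q n w) (q N w) (slope f z L w).
    by have := hN _ _ (leqnn N) Nn _ _ hx hy; rewrite -/w; lra.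
  have [wz|wz] := eqVneq w z.
    have [n0 hn0] := hL _ k0; exists (maxn N n0); rewrite leq_maxl; split => //.
    by rewrite wz qz /slope eqxx hn0// leq_maxr.
  have w0 : 0 < rnorm (w - z) by rewrite rnorm_gt0 subr_eq0.
  have k1 : 0 < k * rnorm (w - z) / 2 by rewrite divr_gt0// mulr_gt0.
  have [n0 hn0] := hlim _ k1; exists (maxn N n0); rewrite leq_maxl; split => //.
  have n0m : (n0 <= maxn N n0)%N by rewrite leq_maxr.
  have a1 := hn0 _ n0m w (near _ _ hx hy); have a2 := hn0 _ n0m z zz.
  move: (maxn N n0) {n0m} a1 a2 => n a1 a2.
  rewrite /q /slope (negbTE wz) -scalerBr rnormZ rnormV mulrC ler_pdivrMr//.
  rewrite (_ : _ - _ = u n w - f w - (u n z - f z)); last by linear_identity.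
  by have := rnormB (u n w - f w) (u n z - f z); lra.
exists L; apply/slope_contP => e e0.
have e30 : 0 < e / 3 by lra.
have [N hN] := sC _ e30.
have [d d0 hd'] := (iffLR (slope_contP _ _ _) (hl N)) _ e30.
exists (Num.min d r); first by rewrite lt_min d0.
move=> w; rewrite lt_min => /andP[/hd' k1 wr].
have [hx hy] : x - r <= complex.Re w <= x + r /\ y - r <= complex.Im w <= y + r.
  have h1 := Re_le (w - z); have h2 := Im_le (w - z).
  have ReE : complex.Re (w - z) = complex.Re w - x by rewrite zE; case: (w).
  have ImE : complex.Im (w - z) = complex.Im w - y by rewrite zE; case: (w).
  rewrite ReE in h1; rewrite ImE in h2; rewrite ler_norml in h1; rewrite ler_norml in h2.
  by split; lra.
have k2 := hN _ _ hx hy; rewrite pt_ReIm in k2.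
have k3 := hN x y ltac:(lra) ltac:(lra); rewrite -zE in k3.
have -> : slope f z L w - slope f z L z = (q N w - q N z) - (q N w - slope f z L w)
   + (q N z - slope f z L z) by linear_identity.
have := rnormD ((q N w - q N z) - (q N w - slope f z L w)) (q N z - slope f z L z).
have := rnormB (q N w - q N z) (q N w - slope f z L w).
by move: k1; rewrite -/(q N); lra.
Qed.

(** Decay at infinity reduces the strip to a long rectangle. *)
Lemma strip_maximum f M : entire_cont f -> 0 <= M ->
  (forall x y, 0 < x < 1 -> exists l, cderiv f (pt x y) l) ->
  (forall y, rnorm (f (pt 0 y)) <= M) -> (forall y, rnorm (f (pt 1 y)) <= M) ->
  (forall e : R, 0 < e -> exists Y, forall x y, 0 <= x <= 1 -> Y <= `|y| ->
     rnorm (f (pt x y)) <= e) ->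
  forall x y, 0 <= x <= 1 -> rnorm (f (pt x y)) <= M.
Proof.
move=> hf M0 hd h0 h1 hdec x y hx; apply/ler_addgt0Pr => e e0.
have [Y hY] := hdec e e0; pose Z := Num.max `|Y| `|y|.
have YZ : `|Y| <= Z by rewrite le_max lexx.
have yZ : `|y| <= Z by rewrite le_max lexx orbT.
have Z0 : 0 <= Z := le_trans (normr_ge0 _) YZ.
have YZ' : Y <= Z := le_trans (ler_norm _) YZ.
apply: (maximum_principle (a := 0) (b := 1) (c := - Z) (d := Z) cE hf) => //; try lra.
- move=> x' y' hx' hy'; pose rho := Num.min x' (1 - x').
  apply: (holomorphic_mean cE (rho := rho)) => //; first by rewrite lt_min subr_gt0.
  move=> w; rewrite lt_min => /andP[w1 w2]; rewrite -(pt_ReIm w); apply: hd.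
  have := Re_le (w - pt x' y'); rewrite ler_norml.
  have -> : complex.Re (w - pt x' y') = complex.Re w - x' by case: (w).
  by lra.
- move=> x' y' hx' hy' [->|->|e1|e1]; first by have := h0 y'; lra.
  + by have := h1 y'; lra.
  + suff : rnorm (f (pt x' y')) <= e by lra.
    by apply: hY => //; rewrite e1 normrN ger0_norm.
  + suff : rnorm (f (pt x' y')) <= e by lra.
    by apply: hY => //; rewrite e1 ger0_norm.
- by rewrite -ler_norml.
Qed.

End weierstrass.

(** * Functions on the closed strip *)

Section clamp.
Context (R : realType) (E : normedModType R[i]).
Implicit Types (f g : R[i]^o -> E) (z w : R[i]^o).

(** The nearest point of the closed strip. *)
Definition clamp z : R[i]^o := pt (Num.max 0 (Num.min 1 (complex.Re z))) (complex.Im z).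

Lemma clamp_strip z : strip (clamp z).
Proof. by rewrite /strip /= le_max lexx /= ge_max ge_min lexx ler01. Qed.

Lemma clamp_id z : strip z -> clamp z = z.
Proof. by case: z => x y /= /andP[x0 x1]; rewrite /clamp /= min_r// max_r. Qed.

Lemma clamp_dist z w : rnorm (clamp z - clamp w) <= rnorm (z - w).
Proof.
case: z => a b; case: w => c d; rewrite /clamp ptB.
rewrite !rnormE_sqrt /= ler_wsqrtr// lerD2r.
rewrite -[leLHS]real_normK ?num_real// -[leRHS]real_normK ?num_real//.
rewrite lerXn2r ?nnegrE//.
rewrite !maxEle !minEle.
case: (lerP 1 a) => ha; case: (lerP 1 c) => hc;
 rewrite ?ler01; try (case: (lerP 0 a) => ?); try (case: (lerP 0 c) => ?);
 rewrite ?subrr ?normr0//; rewrite ler_norml; case: (lerP 0 (a - c)) => h3; rewrite ?(ger0_norm h3) ?(ltr0_norm h3); lra.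
Qed.

Definition strip_cont f := forall z, strip z -> forall e : R, 0 < e ->
  exists2 d : R, 0 < d & forall w, strip w -> rnorm (w - z) < d -> rnorm (f w - f z) <= e.

Lemma strip_contP f : {within @strip R, continuous f} <-> strip_cont f.
Proof.
split=> [/subspace_continuousP h z sz e e0|h].
  have /cvgrPdist_le/(_ e%:C) := h z sz; rewrite ltcR => /(_ e0).
  rewrite /prop_near1 withinE => -[A /nbhsP[d d0 hA] hE].
  exists d => // w sw /hA Aw.
  have : (A `&` @strip R) w by split.
  by rewrite -hE => -[/= + _]; rewrite norm_leC rnorm_distC.
apply/subspace_continuousP => z sz.
apply/(@cvgrPdist_le _ _ _ (within (@strip R) (nbhs z)) (within_filter _ (nbhs_filter z))).
move=> e /pos_ReC[ee /(h z sz)[d d0 hd]].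
apply/nbhsP; exists d => // w wz sw.
by rewrite -ee norm_leC rnorm_distC; exact: hd.
Qed.

Lemma clamp_entire f : strip_cont f -> entire_cont (fun z => f (clamp z)).
Proof.
move=> h z e e0; have [d d0 hd] := h _ (clamp_strip z) e e0; exists d => // w wz.
by apply: hd; [exact: clamp_strip|exact: le_lt_trans (clamp_dist _ _) wz].
Qed.

Lemma near_clamp z : open_strip z -> exists2 d : R, 0 < d & forall w,
  rnorm (w - z) < d -> clamp w = w.
Proof.
move=> /andP[z0 z1]; exists (Num.min (complex.Re z) (1 - complex.Re z)).
  by rewrite lt_min z0 subr_gt0.
move=> w; rewrite lt_min => /andP[w1 w2]; apply: clamp_id; rewrite /strip /=.
have := Re_le (w - z); rewrite ler_norml.
have -> : complex.Re (w - z) = complex.Re w - complex.Re z by case: (w); case: (z).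
lra.
Qed.

Lemma clamp_cderiv f z l : open_strip z -> cderiv f z l <-> cderiv (fun z => f (clamp z)) z l.
Proof.
move=> /near_clamp[d d0 hd]; split; apply: cderiv_ext; exists d => // w /hd -> //.
Qed.

End clamp.

(** * Geometric series and completeness of the sum space *)

Section completeness.
Context (R : realType).

Lemma exp2_small (K e : R) : 0 < e -> exists N, forall n, (N <= n)%N -> K / 2 ^+ n <= e.
Proof.
move=> e0; have [N hN] : exists N : nat, `|K| / e < N%:R.
  by exists (Num.truncn (`|K| / e)).+1; exact: truncnS_gt.
exists N => n Nn; have e2 : 0 < 2 ^+ n :> R by rewrite exprn_gt0.
rewrite ler_pdivrMr// (le_trans (ler_norm K))// mulrC -ler_pdivrMr//.
rewrite (le_trans (ltW hN))// (_ : 2 ^+ n = (2 ^ n)%:R); last by rewrite natrX.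
by rewrite ler_nat (leq_trans Nn)// ltnW// ltn_expl.
Qed.

Lemma geometric_tail (E : normedModType R[i]) (d : nat -> E) (K : R) :
  (forall n, rnorm (d n) <= K / 2 ^+ n) -> forall n m, (n <= m)%N ->
  rnorm (\sum_(k < n) d k - \sum_(k < m) d k) <= 2 * K / 2 ^+ n.
Proof.
move=> hd n m nm; have K0 : 0 <= K.
  by have := hd 0%N; rewrite expr0 divr1; apply: le_trans; exact: rnorm_ge0.
suff : rnorm (\sum_(k < n) d k - \sum_(k < m) d k) <= 2 * K / 2 ^+ n - 2 * K / 2 ^+ m.
  move=> /le_trans; apply; rewrite gerBl divr_ge0 ?exprn_ge0// mulr_ge0//.
rewrite -(subnKC nm); elim: (m - n)%N => [|j IH].
  by rewrite addn0 !subrr rnorm0.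
rewrite addnS big_ord_recr /= opprD addrA.
apply: (le_trans (rnormB _ _)); have := hd (n + j)%N.
have -> : 2 * K / 2 ^+ (n + j).+1 = K / 2 ^+ (n + j).
  by rewrite exprS; field; rewrite expf_neq0.
move: IH; rewrite (_ : 2 * K / 2 ^+ (n + j) = 2 * (K / 2 ^+ (n + j))); last by rewrite mulrA.
lra.
Qed.

Lemma geometric_series (E : normedModType R[i]) (d : nat -> E) (K : R) : rcomplete E ->
  (forall n, rnorm (d n) <= K / 2 ^+ n) -> exists L, forall n,
  rnorm (\sum_(k < n) d k - L) <= 2 * K / 2 ^+ n.
Proof.
move=> cE hd; have tail := geometric_tail hd.
have [|L hL] := cE (fun n => \sum_(k < n) d k).
  move=> e e0; have [N hN] := exp2_small (2 * K) e0; exists N => n m Nn Nm.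
  have [nm|/ltnW mn] := leqP n m; first by apply: (le_trans (tail _ _ nm)); exact: hN.
  by rewrite rnorm_distC; apply: (le_trans (tail _ _ mn)); exact: hN.
exists L => n; apply/ler_addgt0Pr => e /hL[N hN].
have h1 := tail n (maxn n N) (leq_maxl _ _); have h2 := hN _ (leq_maxr n N).
by have := rnorm_dist (\sum_(k < maxn n N) d k) (\sum_(k < n) d k) L; lra.
Qed.

Lemma complete_rcomplete (E : completeNormedModType R[i]) : rcomplete E.
Proof.
move=> u hu.
have : cauchy (u n @[n --> \oo]).
  apply/cauchy_ballP => e /pos_ReC[ee e0].
  have e20 : 0 < complex.Re e / 2 by rewrite divr_gt0.
  have [N hN] := hu _ e20.
  exists (u @` [set n | (N <= n)%N], u @` [set n | (N <= n)%N]) => /=.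
    by split; exists N => // n /= Nn; exists n.
  move=> [_ _] /= [[n Nn <-] [m Nm <-]]; rewrite -ball_normE /= -ee norm_ltC.
  by rewrite (le_lt_trans (hN _ _ Nn Nm))//; lra.
move=> /cauchy_cvgP /cvg_ex[l hl]; exists l => e e0.
have /cvgrPdist_le/(_ e%:C) := hl; rewrite ltcR => /(_ e0)[N _ hN].
by exists N => n Nn; have := hN n Nn; rewrite norm_leC rnorm_distC.
Qed.

End completeness.

Section sum_space_theory.
Context (R : realType) (X : compatible_pair R).

Lemma in_sum_embed k (x : X k) : in_sum (embed X k x).
Proof.
apply/asboolP; case: k x => x; first by exists 0, x; rewrite linear0 add0r.
by exists x, 0; rewrite linear0 addr0.
Qed.

(** The endpoint [X k] as a subspace of the sum. *)
Definition iota_ k (x : X k) : Sigma X := exist _ (embed X k x) (in_sum_embed x).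

Lemma val_iota k (x : X k) : val (iota_ x) = embed X k x. Proof. by []. Qed.

Lemma iota_is_linear k : linear (@iota_ k).
Proof. by move=> a x y; apply: val_inj; rewrite /= linearP. Qed.

HB.instance Definition _ k := GRing.isLinear.Build R[i] (X k) (Sigma X) _ (@iota_ k)
  (@iota_is_linear k).

Lemma rnorm_iota k (x : X k) : rnorm (iota_ x) <= rnorm x.
Proof.
rewrite rnorm_sigmaE; apply: sigma_norm_le; case: k x => x.
  by exists 0, x; rewrite linear0 add0r rnorm0 add0r.
by exists x, 0; rewrite linear0 addr0 rnorm0 addr0.
Qed.

Lemma iota_inj k : injective (@iota_ k).
Proof. by move=> x y /(congr1 val) /= /embed_inj. Qed.

Lemma sigma_split (a : Sigma X) (e : R) : 0 < e -> exists p : X false * X true,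
  [/\ a = iota_ p.1 + iota_ p.2, rnorm p.1 <= rnorm a + e & rnorm p.2 <= rnorm a + e].
Proof.
move=> /(sigma_norm_adh a)[_ [a0 [a1 [ea ->]]] /ltW h]; exists (a0, a1).
have h0 := rnorm_ge0 a0; have h1 := rnorm_ge0 a1; rewrite rnorm_sigmaE /=; split; [|lra|lra].
exact: val_inj.
Qed.

(** Along a subsequence the increments split into components of size [2/2^n] in
the two endpoints, whose series converge there. *)
Lemma sigma_rcomplete : rcomplete (Sigma X).
Proof.
move=> u hu; have /choice[N0 hN0] n : exists N, forall p q, (N <= p)%N -> (N <= q)%N ->
    rnorm (u p - u q) <= 1 / 2 ^+ n :> R.
  by apply: hu; rewrite divr_gt0// exprn_gt0.
pose N n := (\sum_(k < n.+1) N0 k)%N.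
have N0N n : (N0 n <= N n)%N by rewrite /N big_ord_recr leq_addl.
have NS n : (N n <= N n.+1)%N by rewrite [N n.+1]/N big_ord_recr leq_addr.
have /choice[p hp] n : exists p : X false * X true, [/\ u (N n.+1) - u (N n) = iota_ p.1 + iota_ p.2,
    rnorm p.1 <= 2 / 2 ^+ n & rnorm p.2 <= 2 / 2 ^+ n].
  have e0 : 0 < 1 / 2 ^+ n :> R by rewrite divr_gt0// exprn_gt0.
  have [p [h1 h2 h3]] := sigma_split (u (N n.+1) - u (N n)) e0.
  have k := hN0 n (N n.+1) (N n) (leq_trans (N0N n) (NS n)) (N0N n).
  exists p; split => //; rewrite (_ : 2 / 2 ^+ n = 1 / 2 ^+ n + 1 / 2 ^+ n) ?mulrDl//; lra.
have [|A hA] := @geometric_series R _ (fun n => (p n).1) 2 (@complete_rcomplete R _).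
  by move=> n; have [] := hp n.
have [|B hB] := @geometric_series R _ (fun n => (p n).2) 2 (@complete_rcomplete R _).
  by move=> n; have [] := hp n.
exists (u (N 0%N) + (iota_ A + iota_ B)) => e e0.
have e30 : 0 < e / 3 by lra.
have [n hn] := exp2_small 4 e30.
have {hn} hn := hn n (leqnn n).
have vE m : u (N m) = u (N 0%N) + (iota_ (\sum_(k < m) (p k).1) + iota_ (\sum_(k < m) (p k).2)).
  elim: m => [|m IH]; first by rewrite !big_ord0 !linear0 !addr0.
  have [hm _ _] := hp m; rewrite !big_ord_recr /= !linearD /=.
  rewrite -(subrK (u (N m)) (u (N m.+1))) hm IH.
  by rewrite addrC -addrA [X in _ = _ + X]addrACA.
exists (N n) => m Nm.
have k1 : rnorm (u m - u (N n)) <= e / 3.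
  apply: (le_trans (hN0 n _ _ (leq_trans (N0N n) Nm) (N0N n))).
  apply: le_trans hn; rewrite ler_pM2r ?invr_gt0 ?exprn_gt0//; lra.
have k2 := le_trans (rnorm_iota _) (hA n); have k3 := le_trans (rnorm_iota _) (hB n).
have k4 := rnormD (u m - u (N n)) (iota_ (\sum_(k < n) (p k).1 - A) + iota_ (\sum_(k < n) (p k).2 - B)).
have k5 := rnormD (iota_ (\sum_(k < n) (p k).1 - A)) (iota_ (\sum_(k < n) (p k).2 - B)).
have -> : u m - (u (N 0%N) + (iota_ A + iota_ B)) =
   u m - u (N n) + (iota_ (\sum_(k < n) (p k).1 - A) + iota_ (\sum_(k < n) (p k).2 - B)).
  by rewrite [in RHS]vE !linearB /=; linear_identity.
have e22 : 2 * 2 = 4 :> R by lra.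
rewrite e22 in k2 k3; lra.
Qed.

End sum_space_theory.

(** * Primitives on the closed strip *)

Section strip_primitive.
Context (R : realType) (E : normedModType R[i]).
Hypothesis cE : rcomplete E.
Variable f : R[i]^o -> E.
Hypothesis cf : entire_cont f.
Hypothesis hf : forall x y, 0 < x < 1 -> exists l, cderiv f (pt x y) l.
Implicit Types (x y a b c d s t : R) (z w : R[i]^o).

(* For 0 < s < 1, this contraction maps the closed strip into the open one. *)
Let dil s z : R[i]^o := pt (1 / 2) 0 + s%:C * (z - pt (1 / 2) 0).

Let dil_pt s x y : dil s (pt x y) = pt (1 / 2 + s * (x - 1 / 2)) (s * y).
Proof. by apply/eqP; rewrite eq_complex /=; apply/andP; split; apply/eqP; ring. Qed.

Let dil_uniform a b c d e : 0 < e -> a <= b -> c <= d ->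
  exists2 s0, s0 < 1 & forall s, s0 < s < 1 -> forall x y, a <= x <= b -> c <= y <= d ->
    rnorm (f (pt x y) - f (dil s (pt x y))) <= e.
Proof.
move=> e0 ab cd.
apply: (bisection2 (P := fun a b c d => exists2 s0, s0 < 1 & forall s, s0 < s < 1 ->
    forall x y, a <= x <= b -> c <= y <= d ->
    rnorm (f (pt x y) - f (dil s (pt x y))) <= e)) => //.
  move=> a1 b1 c1 d1 _ _ [s1 l1 h1] [s2 l2 h2] [s3 l3 h3] [s4 l4 h4].
  exists (Num.max (Num.max s1 s2) (Num.max s3 s4)); first by rewrite !gt_max l1 l2 l3 l4.
  move=> s /andP[]; rewrite !gt_max => /andP[/andP[k1 k2] /andP[k3 k4]] s1' x y hx hy.
  have [xm|xm] := leP x ((a1 + b1) / 2); have [ym|ym] := leP y ((c1 + d1) / 2).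
  - by apply: h1; lra.
  - by apply: h3; lra.
  - by apply: h2; lra.
  - by apply: h4; lra.
move=> x y hx hy; have e20 : 0 < e / 2 by lra.
have [r r0 hr] := cf (pt x y) e20.
pose B := `|x| + `|y| + r + 1; have B0 : 0 < B.
  by rewrite /B; have := normr_ge0 x; have := normr_ge0 y; lra.
exists (r / 4); first lra.
move=> a' b' c' d' _ ax xb _ _ cy yd _ hba hdc.
exists (1 - r / 4 / B); first by rewrite gtrBl divr_gt0// divr_gt0.
move=> s /andP[s1 s2] x1 y1 hx1 hy1.
have hx2 : `|x1 - x| <= r / 4 by rewrite ler_norml; lra.
have hy2 : `|y1 - y| <= r / 4 by rewrite ler_norml; lra.
have k1 : rnorm (pt x1 y1 - pt x y) < r.
  by rewrite ptB (le_lt_trans (rnorm_pt_le _ _))//; lra.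
have k2 : rnorm (dil s (pt x1 y1) - pt x y) < r.
  rewrite dil_pt ptB (le_lt_trans (rnorm_pt_le _ _))//.
  have -> : 1 / 2 + s * (x1 - 1 / 2) - x = (x1 - x) - (1 - s) * (x1 - 1 / 2) by ring.
  have -> : s * y1 - y = (y1 - y) - (1 - s) * y1 by ring.
  have m1 := ler_normB (x1 - x) ((1 - s) * (x1 - 1 / 2)).
  have m2 := ler_normB (y1 - y) ((1 - s) * y1).
  have s3 : 0 <= 1 - s by lra.
  rewrite (normrM (1 - s)) (ger0_norm s3) in m1; rewrite (normrM (1 - s)) (ger0_norm s3) in m2.
  have n1 : `|x1 - 1 / 2| + `|y1| <= B.
    have := ler_normD (x1 - x) (x - 1 / 2); have := ler_normB x (1 / 2).
    have := ler_normD (y1 - y) y; rewrite !subrK addrA subrK.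
    rewrite (@ger0_norm _ (1 / 2)); last lra.
    by rewrite /B; lra.
  have n2 : (1 - s) * (`|x1 - 1 / 2| + `|y1|) <= (1 - s) * B by rewrite ler_wpM2l.
  have : (1 - s) * B < r / 4 by rewrite -ltr_pdivlMr//; lra.
  lra.
have h1 := hr _ k1; have h2 := hr _ k2.
have := rnorm_dist (f (pt x y)) (f (pt x1 y1)) (f (dil s (pt x1 y1))).
by rewrite (rnorm_distC (f (pt x y)) (f (dil s (pt x1 y1)))); lra.
Qed.

(** Goursat's theorem for rectangles that may touch the edges, where [f] is only
continuous: apply it to [f] composed with a contraction towards [1/2], which
converges to [f] uniformly on the rectangle. *)
Lemma goursat_strip a b c d : 0 <= a -> a <= b -> b <= 1 -> c <= d -> rect f a b c d = 0.
Proof.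
move=> a0 ab b1 cd; apply: rnorm_le_eps => e e0.
pose p := 2 * ((b - a) + (d - c)); have p0 : 0 <= p by rewrite /p; lra.
have k0 : 0 < e / (p + 1) by rewrite divr_gt0//; lra.
have [s0 s01 hs] := dil_uniform k0 ab cd.
pose s := Num.max ((1 + s0) / 2) (1 / 2).
have s1 : s < 1 by rewrite gt_max; apply/andP; split; lra.
have s2 : s0 < s by rewrite lt_max; apply/orP; left; lra.
have s3 : 0 < s by rewrite lt_max; apply/orP; right; lra.
pose g z := f (dil s z).
have dilB z w : dil s w - dil s z = s%:C * (w - z) by rewrite /dil; ring.
have cg : entire_cont g.
  move=> z; apply: (@ccont_comp _ _ f (dil s)) => // k kk0; exists k => // w wz.
  rewrite dilB rnormM rnorm_real gtr0_norm//.
  have : s * rnorm (w - z) <= 1 * rnorm (w - z) by rewrite ler_wpM2r ?rnorm_ge0// ltW.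
  by rewrite mul1r => h; apply/ltW/(le_lt_trans h).
have cgN : entire_cont (fun z => - g z).
  move=> z; have := ccontB (ccont_cst (0 : E) z) (cg z).
  by under eq_fun do rewrite sub0r.
have g0 : rect g a b c d = 0.
  apply: (goursat cE) => // x y hx hy.
  have [|l hl] := @hf (1 / 2 + s * (x - 1 / 2)) (s * y).
    have [xs|/ltW xs] := leP 0 (x - 1 / 2).
      have : s * (x - 1 / 2) <= 1 * (x - 1 / 2) by rewrite ler_wpM2r// ltW.
      have : 0 <= s * (x - 1 / 2) by rewrite mulr_ge0// ltW.
      have : s * (x - 1 / 2) <= s * (1 / 2) by rewrite ler_pM2l//; lra.
      lra.
    have : s * (- (1 / 2)) <= s * (x - 1 / 2) by rewrite ler_pM2l//; lra.
    have : 0 <= s * (1 / 2 - x) by rewrite mulr_ge0//; lra.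
    lra.
  exists (s%:C *: l); apply: (@cderiv_comp _ _ f (dil s)); last by rewrite dil_pt.
  move=> k kk0; exists 1 => // w _; rewrite dilB.
  have -> : s%:C * (w - pt x y) - (w - pt x y) *: s%:C = 0 :> R[i]^o.
    by rewrite [_ *: _]mulrC subrr.
  by rewrite rnorm0 mulr_ge0 ?(ltW kk0) ?rnorm_ge0.
have fE : f = (fun z => (f z + - g z) + g z) by apply/funext => z; rewrite subrK.
have cfg : entire_cont (fun z => f z + - g z) by move=> z; apply: ccontD.
rewrite fE rectD// g0 addr0.
apply: (@le_trans _ _ (e / (p + 1) * p)).
  by apply: rect_bound => // x y hx hy; apply: hs => //; rewrite s2.
by rewrite mulrAC -mulrA ger_pMr// ler_pdivrMr//; lra.
Qed.

Lemma vint_rev phi s t : contR phi -> vint phi s t = - vint (E := E) phi t s.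
Proof. by move=> /(vint_primitive cE)[F hF FE]; rewrite !FE; linear_identity. Qed.

Lemma goursat_strip_path a b c d : 0 <= a <= 1 -> 0 <= b <= 1 ->
  hint f a b c + 'i *: vvint f c d b = hint f a b d + 'i *: vvint f c d a.
Proof.
move=> ha hb.
have H1 c' d' a' b' : 0 <= a' <= 1 -> 0 <= b' <= 1 -> a' <= b' -> c' <= d' ->
    hint f a' b' c' + 'i *: vvint f c' d' b' = hint f a' b' d' + 'i *: vvint f c' d' a'.
  move=> /andP[a0 _] /andP[_ b1] ab cd; have := goursat_strip a0 ab b1 cd; rewrite /rect => h.
  by apply/eqP; rewrite -subr_eq0 -h; apply/eqP; linear_identity.
have Hh a' b' y : hint f a' b' y = - hint f b' a' y by exact/vint_rev/contR_hor.
have Hv c' d' x : vvint f c' d' x = - vvint f d' c' x by exact/vint_rev/contR_ver.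
have [ab|/ltW ab] := leP a b; have [cd|/ltW cd] := leP c d.
- exact: H1.
- have := H1 _ _ _ _ ha hb ab cd; rewrite (Hv c d a) (Hv c d b) => h.
  apply/eqP; rewrite -subr_eq0; apply/eqP.
  move/eqP: h; rewrite -subr_eq0 => /eqP h; rewrite -oppr0 -h; linear_identity.
- have := H1 _ _ _ _ hb ha ab cd; rewrite (Hh a b c) (Hh a b d) => h.
  apply/eqP; rewrite -subr_eq0; apply/eqP.
  move/eqP: h; rewrite -subr_eq0 => /eqP h; rewrite -oppr0 -h; linear_identity.
have := H1 _ _ _ _ hb ha ab cd.
rewrite (Hh a b c) (Hh a b d) (Hv c d a) (Hv c d b) => h.
apply/eqP; rewrite -subr_eq0; apply/eqP.
move/eqP: h; rewrite -subr_eq0 => /eqP h; rewrite -h; linear_identity.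
Qed.

(** The integral of [f] from [1/2] along a vertical and then a horizontal segment. *)
Definition strip_primitive z : E :=
  'i *: vvint f 0 (complex.Im z) (1 / 2) + hint f (1 / 2) (complex.Re z) (complex.Im z).

(** By Cauchy's theorem the increment is also the integral along a horizontal and
then a vertical segment; for two points of an edge this path stays in the edge. *)
Lemma strip_primitiveB x y x' y' : 0 <= x <= 1 -> 0 <= x' <= 1 ->
  strip_primitive (pt x' y') - strip_primitive (pt x y) =
  hint f x x' y + 'i *: vvint f y y' x'.
Proof.
move=> hx hx'; rewrite /strip_primitive /=.
have h2 : 0 <= (1 / 2 : R) <= 1 by lra.
have := @goursat_strip_path (1 / 2) x' y y' h2 hx'.
rewrite /vvint (vint_cat cE y 0 y' (contR_ver (1 / 2) cf)).
rewrite /hint (vint_cat cE x (1 / 2) x' (contR_hor y cf)) => h.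
apply/eqP; rewrite -subr_eq0; apply/eqP.
move/eqP: h; rewrite -subr_eq0 => /eqP h; rewrite -oppr0 -h; linear_identity.
Qed.

Lemma vint_bound_abs (phi : R -> E) M s t : contR phi ->
  (forall r, Num.min s t <= r <= Num.max s t -> rnorm (phi r) <= M) ->
  rnorm (vint phi s t) <= M * `|t - s|.
Proof.
move=> cphi h; have [st|/ltW st] := leP s t.
  rewrite ger0_norm ?subr_ge0//; apply: vint_bound => // r hr; apply: h.
  by rewrite min_l// max_r.
rewrite vint_rev// rnormN distrC ger0_norm ?subr_ge0//; apply: vint_bound => // r hr.
by apply: h; rewrite min_r// max_l.
Qed.

Let between_dist r s t : Num.min s t <= r <= Num.max s t -> `|r - s| <= `|t - s|.
Proof.
have [st|st] := leP s t => hr.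
  by rewrite (@ger0_norm _ (t - s)) ?subr_ge0// ler_norml; lra.
by rewrite (@ler0_norm _ (t - s)) ?ler_norml; lra.
Qed.

Lemma strip_primitive_lipschitz M x y x' y' : 0 <= x <= 1 -> 0 <= x' <= 1 ->
  (forall x y, 0 <= x <= 1 -> rnorm (f (pt x y)) <= M) ->
  rnorm (strip_primitive (pt x' y') - strip_primitive (pt x y)) <= M * (`|x' - x| + `|y' - y|).
Proof.
move=> hx hx' hM; rewrite strip_primitiveB// (le_trans (rnormD _ _))// rnorm_scalei mulrDr.
apply: lerD; apply: vint_bound_abs; rewrite ?[contR _]/(contR _).
- exact: contR_hor.
- move=> r; rewrite ge_min le_max => hr; apply: hM.
  by case/andP: hr => /orP[] h1 /orP[] h2; lra.
- exact: contR_ver.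
- by move=> r _; exact: hM.
Qed.

Lemma strip_primitive_cderiv x y : 0 < x < 1 -> cderiv strip_primitive (pt x y) (f (pt x y)).
Proof.
move=> hx e e0; have e20 : 0 < e / 2 by lra.
have [d d0 hd] := cf (pt x y) e20.
exists (Num.min (d / 2) (Num.min x (1 - x))); first by rewrite !lt_min divr_gt0//; lra.
move=> w; rewrite !lt_min => /andP[w1 /andP[w2 w3]].
set x' := complex.Re w; set y' := complex.Im w.
have wE : w = pt x' y' by rewrite pt_ReIm.
have hx' : `|x' - x| <= rnorm (w - pt x y).
  by have := Re_le (w - pt x y); rewrite wE.
have hy' : `|y' - y| <= rnorm (w - pt x y).
  by have := Im_le (w - pt x y); rewrite wE.
have h01 : 0 <= x' <= 1.
  by have := le_lt_trans hx' w2; have := le_lt_trans hx' w3; rewrite !ltr_norml; lra.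
have h01x : 0 <= x <= 1 by lra.
rewrite {1}wE strip_primitiveB//.
pose g z := f z + - f (pt x y).
have cg : entire_cont g by move=> z; apply: ccontD => //; exact: ccont_cst.
have fE : f = (fun z => g z + f (pt x y)) by apply/funext => z; rewrite subrK.
have hE : hint f x x' y = hint g x x' y + (x' - x)%:C *: f (pt x y).
  rewrite {1}fE /hint -vint_cst (vintD cE) //; first exact: contR_hor.
  by apply: (@contR_hor _ _ (fun=> f (pt x y)) 0) => z; exact: ccont_cst.
have vE : vvint f y y' x' = vvint g y y' x' + (y' - y)%:C *: f (pt x y).
  rewrite {1}fE /vvint -vint_cst (vintD cE) //; first exact: contR_ver.
  by apply: (@contR_hor _ _ (fun=> f (pt x y)) 0) => z; exact: ccont_cst.
have wz : w - pt x y = (x' - x)%:C + 'i * (y' - y)%:C by rewrite wE ptB ptE.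
rewrite (_ : _ - _ = hint g x x' y + 'i *: vvint g y y' x'); last first.
  by rewrite hE vE wz scalerDl -scalerA; linear_identity.
rewrite (le_trans (rnormD _ _))// rnorm_scalei.
have small x1 y1 : `|x1 - x| <= `|x' - x| -> `|y1 - y| <= `|y' - y| -> rnorm (g (pt x1 y1)) <= e / 2.
  move=> l1 l2; apply: hd; rewrite ptB (le_lt_trans (rnorm_pt_le _ _))//; lra.
have b1 : rnorm (hint g x x' y) <= e / 2 * `|x' - x|.
  apply: vint_bound_abs; first exact: contR_hor.
  move=> r hr; apply: small; last by rewrite subrr normr0.
  exact: between_dist.
have b2 : rnorm (vvint g y y' x') <= e / 2 * `|y' - y|.
  apply: vint_bound_abs; first exact: contR_ver.
  move=> r hr; apply: small => //.
  exact: between_dist.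
have : e / 2 * `|x' - x| <= e / 2 * rnorm (w - pt x y) by rewrite ler_wpM2l// ltW.
have : e / 2 * `|y' - y| <= e / 2 * rnorm (w - pt x y) by rewrite ler_wpM2l// ltW.
lra.
Qed.

End strip_primitive.

(** * From the first space to the second *)

Section A_into_B.
Context (R : realType) (X : compatible_pair R).
Implicit Types (f g : R[i]^o -> Sigma X) (x y t c theta : R).

Lemma edge_lipschitz_ge0 g c : edge_lipschitz g c -> 0 <= c.
Proof.
move=> /(_ false 0 1)[x [_]]; rewrite normr1 mulr1; apply: le_trans; exact: rnorm_ge0.
Qed.

Lemma calderon_B_norm_le g c : edge_lipschitz g c -> calderon_B_norm g <= c.
Proof. by move=> h; apply: ge_inf => //; exists 0 => d /edge_lipschitz_ge0. Qed.

Lemma edge_le_sup f (k : bool) (F : R -> X k) M y :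
  (forall y, embed X k (F y) = val (f (edge k y))) -> (forall y, rnorm (F y) <= M) ->
  rnorm (F y) <= edge_sup f k.
Proof.
move=> hF hM; apply: ub_le_sup; last by exists y, (F y).
exists M => _ [y' [x [h ->]]]; suff -> : x = F y' by [].
by apply: (@embed_inj R X k); rewrite hF.
Qed.

Lemma edge_sup_le f (k : bool) (F : R -> X k) M :
  (forall y, embed X k (F y) = val (f (edge k y))) -> (forall y, rnorm (F y) <= M) ->
  edge_sup f k <= M.
Proof.
move=> hF hM; apply: ge_sup; first by exists (rnorm (F 0)), 0, (F 0).
move=> _ [y [x [h ->]]]; suff -> : x = F y by [].
by apply: (@embed_inj R X k); rewrite hF.
Qed.

Lemma continuous_contR (E : normedModType R[i]) (F : R -> E) : continuous F -> contR F.
Proof.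
move=> h x e e0; have /cvgrPdist_le/(_ e%:C) := h x; rewrite ltcR => /(_ e0).
move=> /nbhs_normP[d /= d0 hd]; exists d => // y yx; rewrite -norm_leC distrC.
by apply: hd; rewrite /= distrC.
Qed.

Lemma derivable_strip f : (forall z, open_strip z -> derivable f z 1) ->
  forall x y, 0 < x < 1 -> cderiv (fun z => f (clamp z)) (pt x y) ('D_1 f (pt x y)).
Proof.
move=> h x y hx; have sz : open_strip (pt x y) := hx.
exact: (iffLR (clamp_cderiv f _ sz) (derivable_cderiv (h _ sz))).
Qed.

(** On the line over [k] the primitive in the sum space is the image of a
primitive of the edge function in [X k], so the mean value inequality in [X k]
gives the Lipschitz bound. *)
Lemma A_into_B f theta : 0 < theta < 1 -> calderon_A f -> exists g,
  [/\ calderon_B g, 'D_1 g theta%:C = f theta%:C & calderon_B_norm g <= calderon_A_norm f].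
Proof.
move=> th [/strip_contP cf [M hM] df hF].
pose h z := f (clamp z); have ch : entire_cont h := clamp_entire cf.
have dh x y : 0 < x < 1 -> exists l, cderiv h (pt x y) l.
  by move=> hx; exists ('D_1 f (pt x y)); exact: derivable_strip.
have hM' x y : 0 <= x <= 1 -> rnorm (h (pt x y)) <= M.
  by move=> hx; apply: hM; exact: clamp_strip.
have cS := @sigma_rcomplete R X.
pose g := strip_primitive h.
have lipE x y x' y' : 0 <= x <= 1 -> 0 <= x' <= 1 ->
    rnorm (g (pt x' y') - g (pt x y)) <= M * (`|x' - x| + `|y' - y|).
  by move=> hx hx'; apply: strip_primitive_lipschitz.
have M0 : 0 <= M.
  by have h0 : 0 <= (0 : R) <= 1 by [rewrite lexx ler01]; have := hM' 0 0 h0; apply: le_trans; exact: rnorm_ge0.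
have dg x y : 0 < x < 1 -> cderiv g (pt x y) (f (pt x y)).
  move=> hx; have := strip_primitive_cderiv cS ch dh y hx.
  by rewrite {2}/h clamp_id// /strip /=; lra.
have lip : edge_lipschitz g (calderon_A_norm f).
  move=> k y t; have [F [FE /continuous_contR cF [B hB]]] := hF k.
  have [Phi hPhi] := primitive_exists cF (@complete_rcomplete R (X k)).
  have hb r : rnorm (F r) <= calderon_A_norm f.
    apply: (le_trans (edge_le_sup r FE hB)); rewrite /calderon_A_norm le_max.
    by case: (k); rewrite lexx ?orbT.
  exists ('i *: (Phi (y + t) - Phi y)).
  have k01 : 0 <= (k%:R : R) <= 1 by case: (k); rewrite ?lexx ?ler01.
  split; last first.
    rewrite rnorm_scalei; have [t0|/ltW t0] := leP 0 t.
      rewrite (ger0_norm t0) -[X in _ * X](addrK y t) [t + y]addrC.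
      by apply: (mean_value_const hPhi) => //; lra.
    rewrite (ler0_norm t0) rnorm_distC (_ : - t = y - (y + t)); last by ring.
    by apply: (mean_value_const hPhi) => //; lra.
  rewrite -val_iota; congr val.
  rewrite /edge -/(pt k%:R (y + t)) -/(pt k%:R y) /g strip_primitiveB// /hint.
  have -> : vint (fun x => h (pt x y)) k%:R k%:R = 0.
    by have [G hG ->] := vint_primitive cS (contR_hor y ch); rewrite subrr.
  rewrite add0r linearZ /= linearB /=; congr (_ *: _); apply/esym.
  apply: (vintE y (y + t) (F := fun r => iota_ (Phi r))).
  have Fh r : iota_ (F r) = h (pt k%:R r).
    by apply: val_inj; rewrite val_iota FE /h clamp_id.
  apply: (primitive_ext _ Fh).
  apply: (@primitive_linear R (X k) (Sigma X) (@iota_ R X k) 1) => // v.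
  by rewrite mul1r; exact: rnorm_iota.
have [gd gD] := cderiv_derivable (dg theta 0 th).
exists g; rewrite -[theta%:C]/(pt theta 0).
split; [|exact: gD|exact: calderon_B_norm_le].
split.
- apply/strip_contP => -[x y] /= hx e e0; exists (e / (2 * M + 1)).
    by rewrite divr_gt0//; lra.
  move=> [x' y'] /= hx'; rewrite -/(pt x y) -/(pt x' y') ltr_pdivlMr; last lra.
  move=> k; apply: (le_trans (lipE _ _ _ _ hx hx')).
  have h1 := Re_le (pt x' y' - pt x y); have h2 := Im_le (pt x' y' - pt x y).
  rewrite ptB /= in h1 h2 k *.
  have : M * (`|x' - x| + `|y' - y|) <= M * (rnorm (pt (x' - x) (y' - y)) * 2).
    by rewrite ler_wpM2l//; lra.
  have := rnorm_ge0 (pt (x' - x) (y' - y) : R[i]^o); lra.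
- by move=> [x y] hx; have [] := cderiv_derivable (dg x y hx).
- exists (M * 2), 1 => -[x y] /= hx y1.
  have h2 : 0 <= (1 / 2 : R) <= 1 by lra.
  have {}hx : 0 <= x <= 1 := hx.
  have := lipE (1 / 2) 0 x y h2 hx.
  have -> : g (pt (1 / 2) 0) = 0.
    rewrite /g /strip_primitive /= /hint /vvint.
    have [G hG ->] := vint_primitive cS (contR_hor 0 ch).
    have [G' hG' ->] := vint_primitive cS (contR_ver (1 / 2) ch).
    by rewrite !subrr scaler0 addr0.
  rewrite !subr0 => /le_trans; apply; rewrite -mulrA ler_wpM2l//.
  have : `|x - 1 / 2| <= 1 / 2 by rewrite ler_norml; lra.
  lra.
- by exists (calderon_A_norm f).
Qed.

End A_into_B.

(** * The operator on L^1 defined by a Lipschitz function *)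

(** The operator integrates against the vector measure [dG].  It is the limit of
the operators [T n] that replace [G], between [-(n+1)] and [n+1], by its piecewise
linear interpolation with mesh [1/(n+1)]; these are bounded by [c] times the L^1 norm,
uniformly in [n]. *)
Section stieltjes.
Context (R : realType) (E : normedModType R[i]).
Let mu := @lebesgue_measure R.
Variables (G : R -> E) (c : R).
Hypothesis c0 : 0 <= c.
Hypothesis lipG : forall x y, rnorm (G y - G x) <= c * `|y - x|.
Implicit Types (psi chi : R -> R) (x y a b : R).

Definition integrable_R psi := mu.-integrable setT (EFin \o psi).

Let t (n k : nat) : R := k%:R / n.+1%:R - n.+1%:R.
(* The number of cells of length 1/(n+1) in [-(n+1), n+1]. *)
Let K n := (2 * n.+1 * n.+1)%N.
Let J psi a b : R := \int[mu]_(x in `[a, b[) psi x.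
Let T n psi : E :=
  \sum_(k <- iota 0 (K n)) (n.+1%:R * J psi (t n k) (t n k.+1))%:C *: (G (t n k.+1) - G (t n k)).

Let tS n k : t n k.+1 = t n k + n.+1%:R^-1.
Proof. by rewrite /t -natr1 mulrDl mul1r addrAC. Qed.

Let dt n k : t n k.+1 - t n k = n.+1%:R^-1.
Proof. by rewrite tS addrAC subrr add0r. Qed.

Let inv0 n : 0 <= n.+1%:R^-1 :> R. Proof. by rewrite invr_ge0. Qed.

Let t_mono n k j : (k <= j)%N -> t n k <= t n j.
Proof. by move=> kj; rewrite /t lerD2r ler_pM2r ?invr_gt0// ler_nat. Qed.

Let intS psi (A : set R) : measurable A -> integrable_R psi -> mu.-integrable A (EFin \o psi).
Proof. by move=> mA; apply: integrableS. Qed.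

Lemma integrable_R_lin (a : R) psi chi : integrable_R psi -> integrable_R chi ->
  integrable_R (fun x => a * psi x + chi x).
Proof.
move=> hp hc; have h1 := @integrableZl _ _ _ mu setT measurableT a _ hp.
have := @integrableD _ _ _ mu setT measurableT _ _ h1 hc.
by apply: eq_integrable => //.
Qed.

Let T_lin n a psi chi : integrable_R psi -> integrable_R chi ->
  T n (fun x => a * psi x + chi x) = a%:C *: T n psi + T n chi.
Proof.
move=> hp hc; rewrite /T scaler_sumr -big_split /=; apply: eq_bigr => k _.
have mI : measurable (`[t n k, t n k.+1[ : set R) by exact: measurable_itv.
rewrite /J RintegralD//.
- rewrite RintegralZl//; last exact: intS.
  by linear_identity.
- by have := @integrableZl _ _ _ mu _ mI a _ (intS mI hp).
- exact: intS.
Qed.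

Let J_cat psi a b d : a <= b -> b <= d -> integrable_R psi -> J psi a d = J psi a b + J psi b d.
Proof.
move=> ab bd hp; rewrite /J -Rintegral_setU//.
- by congr Rintegral; rewrite -itv_bndbnd_setU// ?bnd_simp.
- by apply: intS => //; apply: measurableU.
- apply/disj_setPS => x /= []; rewrite !in_itv/= => /andP[_ h1] /andP[h2 _].
  by move: (lt_le_trans h1 h2); rewrite ltxx.
Qed.

Lemma integrable_R_abs psi : integrable_R psi -> integrable_R (fun x => `|psi x|).
Proof. by move=> h; exact: (integrable_norm h). Qed.

Let J_sum psi n m : integrable_R psi ->
  \sum_(k <- iota 0 m) J psi (t n k) (t n k.+1) = J psi (t n 0) (t n m).
Proof.
move=> hp; elim: m => [|m IH].
  by rewrite big_nil /J set_itvco0 Rintegral_set0.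
rewrite -addn1 iotaD big_cat big_seq1 /= IH add0n addn1 -J_cat//; exact: t_mono.
Qed.

Let J_le psi a b : integrable_R psi -> (forall x, 0 <= psi x) -> J psi a b <= \int[mu]_x psi x.
Proof.
move=> hp p0; rewrite /J /Rintegral fine_le//.
- by apply: integrable_fin_num => //; exact: intS.
- exact: integrable_fin_num.
- apply: ge0_subset_integral => //=; last by move=> x _; rewrite lee_fin.
  by case/integrableP: hp.
Qed.

Let T_bound n psi : integrable_R psi -> rnorm (T n psi) <= c * \int[mu]_x `|psi x|.
Proof.
move=> hp; have hpa := integrable_R_abs hp.
apply: (le_trans (rnorm_sum _ _)).
apply: (@le_trans _ _ (c * \sum_(k <- iota 0 (K n)) J (fun x => `|psi x|) (t n k) (t n k.+1))).
  rewrite mulr_sumr; apply: ler_sum => k _; rewrite rnormZr normrM ger0_norm//.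
  have mI : measurable (`[t n k, t n k.+1[ : set R) by exact: measurable_itv.
  have h1 : `|J psi (t n k) (t n k.+1)| <= J (fun x => `|psi x|) (t n k) (t n k.+1).
    by apply: le_normr_Rintegral => //; exact: intS.
  have h2 := lipG (t n k) (t n k.+1); rewrite dt (ger0_norm (inv0 n)) in h2.
  apply: (@le_trans _ _ (n.+1%:R * J (fun x => `|psi x|) (t n k) (t n k.+1) * (c * n.+1%:R^-1))).
    by rewrite ler_pM ?mulr_ge0 ?rnorm_ge0// ler_wpM2l.
  rewrite le_eqVlt; apply/orP; left; apply/eqP; field.
  by rewrite addrC natr1 pnatr_eq0.
by rewrite ler_wpM2l// J_sum// J_le.
Qed.

Let J_indic a b x y : a <= b -> x <= y -> J (\1_(`[x, y[ : set R)) a b =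
  (Num.min y b - Num.min y a) - (Num.min x b - Num.min x a).
Proof.
move=> ab xy; rewrite /J /Rintegral integral_indic//.
have -> : (`[x, y[ : set R) `&` `[a, b[ = [set` `[Num.max x a, Num.min y b[].
  apply/seteqP; split => z /=; rewrite !in_itv/=.
    by move=> [/andP[h1 h2] /andP[h3 h4]]; rewrite ge_max lt_min h1 h2 h3 h4.
  by rewrite ge_max lt_min => /andP[/andP[-> ->] /andP[-> ->]].
rewrite [X in fine X](_ : _ = lebesgue_measure [set` `[Num.max x a, Num.min y b[])//.
rewrite lebesgue_measure_itv /= lte_fin.
case: (ltP (Num.max x a) (Num.min y b)) => h /=; move: h; rewrite ?gt_max ?lt_min;
 rewrite !maxEle !minEle;
 case: (lerP y b) => ?; case: (lerP y a) => ?; case: (lerP x b) => ?; case: (lerP x a) => ? //=; try lra.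
Qed.

(** On the grid's interval, [P n] is the piecewise linear interpolation of [G],
normalized at the left end. *)
Let P n x : E :=
  \sum_(k <- iota 0 (K n)) (n.+1%:R * (Num.min x (t n k.+1) - Num.min x (t n k)))%:C *:
    (G (t n k.+1) - G (t n k)).

Let T_indic n x y : x <= y -> T n (\1_(`[x, y[ : set R)) = P n y - P n x.
Proof.
move=> xy; rewrite /T /P -sumrB; apply: eq_bigr => k _.
by rewrite J_indic//; [linear_identity|exact: t_mono].
Qed.

Let P_est n x : `|x| <= n.+1%:R -> rnorm (P n x - (G x - G (t n 0))) <= 2 * c * n.+1%:R^-1.
Proof.
move=> hx; pose u k := Num.min x (t n k).
pose tm k := (n.+1%:R * (u k.+1 - u k))%:C *: (G (t n k.+1) - G (t n k)) - (G (u k.+1) - G (u k)).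
have t0 : t n 0 = - n.+1%:R by rewrite /t mul0r sub0r.
have tK : t n (K n) = n.+1%:R.
  by rewrite /t /K natrM mulfK ?pnatr_eq0// mul2n -addnn natrD addrK.
move: (hx); rewrite ler_norml => /andP[hx1 hx2].
have -> : P n x - (G x - G (t n 0)) = \sum_(k <- iota 0 (K n)) tm k.
  rewrite /tm sumrB -/(P n x); congr (_ - _).
  rewrite -[iota 0 (K n)]/(index_iota 0 (K n)) (telescope_sumr (fun k => G (u k)))//.
  by rewrite /u tK t0 min_l// min_r.
have nn : n.+1%:R * n.+1%:R^-1 = 1 :> R by rewrite mulfV// pnatr_eq0.
have z1 k : t n k.+1 <= x -> tm k = 0.
  move=> h; rewrite /tm /u min_r// min_r; last by rewrite (le_trans _ h)// t_mono.
  by rewrite dt nn scale1r subrr.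
have z2 k : x <= t n k -> tm k = 0.
  move=> h; rewrite /tm /u min_l; last by rewrite (le_trans h)// t_mono.
  by rewrite min_l// !subrr mulr0 scale0r subr0.
have bt k : rnorm (tm k) <= 2 * c * n.+1%:R^-1.
  have b1 : 0 <= u k.+1 - u k <= n.+1%:R^-1.
    have := tS n k; have := inv0 n; rewrite /u; move: (n.+1%:R^-1) => i i0 tk.
    by rewrite !minEle; case: (lerP x (t n k.+1)) => ?; case: (lerP x (t n k)) => ?; lra.
  case/andP: b1 => b10 b11.
  have b2 := lipG (t n k) (t n k.+1); rewrite dt (ger0_norm (inv0 n)) in b2.
  have b3 := lipG (u k) (u k.+1); rewrite (ger0_norm b10) in b3.
  have b4 : c * (u k.+1 - u k) <= c * n.+1%:R^-1 := ler_wpM2l c0 b11.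
  have b5 : n.+1%:R * (u k.+1 - u k) <= 1 by have := ler_wpM2l (ler0n R n.+1) b11; rewrite nn.
  have b6 : rnorm ((n.+1%:R * (u k.+1 - u k))%:C *: (G (t n k.+1) - G (t n k))) <= c * n.+1%:R^-1.
    rewrite rnormZr ger0_norm; last by rewrite mulr_ge0.
    by rewrite -[X in _ <= X]mul1r ler_pM ?rnorm_ge0// mulr_ge0.
  have e2 : 2 * c * n.+1%:R^-1 = c * n.+1%:R^-1 + c * n.+1%:R^-1 by rewrite -mulrA mulr_natl mulr2n.
  by rewrite e2; apply: (le_trans (rnormB _ _)); apply: lerD => //; exact: le_trans b4.
have z3 m : t n m <= x -> \sum_(k <- iota 0 m) tm k = 0.
  move=> h; rewrite big_seq big1// => k; rewrite mem_iota => /andP[_ km].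
  by apply: z1; apply: le_trans h; exact: t_mono.
elim: (K n) => [|m IH].
  by rewrite big_nil rnorm0 mulr_ge0// mulr_ge0.
rewrite -addn1 iotaD big_cat big_seq1 add0n /=.
have [h|/ltW h] := leP (t n m) x; first by rewrite z3// add0r.
by rewrite z2// addr0.
Qed.

Let T_itv x y e : x <= y -> 0 < e -> exists N, forall n, (N <= n)%N ->
  rnorm (T n (\1_(`[x, y[ : set R)) - (G y - G x)) <= e.
Proof.
move=> xy e0; have [N hN] : exists N : nat, `|x| + `|y| + 4 * c / e < N%:R.
  by exists (Num.truncn (`|x| + `|y| + 4 * c / e)).+1; exact: truncnS_gt.
have ce : 0 <= 4 * c / e by rewrite divr_ge0 ?(ltW e0) ?mulr_ge0.
have ax := normr_ge0 x; have ay := normr_ge0 y.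
exists N => n Nn; have nn : `|x| + `|y| + 4 * c / e < n.+1%:R.
  by apply: (lt_trans hN); rewrite ltr_nat ltnS.
rewrite T_indic//.
have h1 := @P_est n x ltac:(lra); have h2 := @P_est n y ltac:(lra).
rewrite (_ : _ - _ = (P n y - (G y - G (t n 0))) - (P n x - (G x - G (t n 0)))); last by linear_identity.
apply: (le_trans (rnormB _ _)).
suff : 4 * c * n.+1%:R^-1 <= e by move: h1 h2; move: (n.+1%:R^-1) => i; lra.
rewrite ler_pdivrMr// [e * _]mulrC -ler_pdivrMr//.
by apply/ltW; apply: le_lt_trans nn; rewrite lerDr addr_ge0.
Qed.

Hypothesis cE : rcomplete E.

Let cauchy_at psi := forall e : R, 0 < e -> exists N, forall n m,
  (N <= n)%N -> (N <= m)%N -> rnorm (T n psi - T m psi) <= e.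

Let itv_fun (g : R -> R) x y (z : R) : R := g z * \1_(`[x, y[ : set R) z.

Let integrable_itv_fun g x y : continuous g -> integrable_R (itv_fun g x y).
Proof.
move=> cg; have h : mu.-integrable `[x, y] (EFin \o g).
  apply: continuous_compact_integrable; first exact: segment_compact.
  exact: continuous_subspaceT.
have h2 : mu.-integrable `[x, y[ (EFin \o g).
  by apply: integrableS h => //; move=> z /=; rewrite !in_itv/= => /andP[-> /ltW ->].
have mI : measurable (`[x, y[ : set R) by exact: measurable_itv.
have := iffLR (@integrable_mkcond _ _ _ mu _ (EFin \o g) mI) h2.
apply: eq_integrable => // z _; rewrite /= /itv_fun restrict_EFin /= patchE indicE.
by case: ifP => _; rewrite ?mulr1 ?mulr0.
Qed.

Let int_indic_bound x y (M : R) psi : x <= y -> integrable_R psi ->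
  (forall z, `|psi z| <= M * \1_(`[x, y[ : set R) z) -> \int[mu]_z `|psi z| <= M * (y - x).
Proof.
move=> xy hp hM; have hi : integrable_R (fun z => M * \1_(`[x, y[ : set R) z).
  have := @integrableZl _ _ _ mu setT measurableT M _ (integrable_indic_itv x y true true).
  exact: eq_integrable.
apply: (le_trans (le_Rintegral _ (integrable_R_abs hp) hi _)) => //.
rewrite RintegralZl//; last exact: integrable_indic_itv.
rewrite /Rintegral integral_indic//.
rewrite setIT [X in fine X](_ : _ = lebesgue_measure [set` `[x, y[])//.
rewrite lebesgue_measure_itv /= lte_fin; case: ltP => // h; rewrite /= ?mulr0.
suff -> : x = y by rewrite subrr mulr0.
by apply/eqP; rewrite eq_le xy.
Qed.

Let T_ext n psi chi : psi =1 chi -> T n psi = T n chi.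
Proof. by move=> /funext ->. Qed.

(** On a short interval the integrand is nearly constant, and on indicators of
intervals [T n] converges; bisection sums up the local estimates. *)
Let cauchy_continuous g x y : continuous g -> x <= y -> cauchy_at (itv_fun g x y).
Proof.
move=> cg xy e e0; pose e1 := e / (y - x + 1).
have yx1 : 0 < y - x + 1 by lra.
have e10 : 0 < e1 by rewrite divr_gt0.
have cc : 0 < c + 1 by rewrite ltr_wpDl.
suff [N hN] : exists N, forall n m, (N <= n)%N -> (N <= m)%N ->
    rnorm (T n (itv_fun g x y) - T m (itv_fun g x y)) <= e1 * (y - x).
  exists N => n m Nn Nm; apply: (le_trans (hN _ _ Nn Nm)).
  by rewrite /e1 mulrAC -mulrA ger_pMr// ler_pdivrMr//; lra.
apply: (bisection1 (P := fun x y => exists N, forall n m, (N <= n)%N -> (N <= m)%N ->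
    rnorm (T n (itv_fun g x y) - T m (itv_fun g x y)) <= e1 * (y - x))) => //.
  move: e1 {xy yx1} e10 => e1 e10 x1 y1 xy1 [N1 h1] [N2 h2].
  exists (maxn N1 N2) => n m; rewrite !geq_max => /andP[n1 n2] /andP[m1 m2].
  have := h1 _ _ n1 m1; have := h2 _ _ n2 m2; set z := (x1 + y1) / 2 => k1 k2.
  have split_itv n' : T n' (itv_fun g x1 y1) = T n' (itv_fun g x1 z) + T n' (itv_fun g z y1).
    rewrite -[T n' (itv_fun g x1 z)]scale1r -(rmorph1 (real_complex R)).
    rewrite -T_lin; [|exact: integrable_itv_fun|exact: integrable_itv_fun].
    apply: T_ext => w; rewrite mul1r /itv_fun -mulrDr; congr (_ * _).
    rewrite !indicE !mem_setE !in_itv /=.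
    have xz : x1 <= z by rewrite /z; lra.
    have zy : z <= y1 by rewrite /z; lra.
    case: (lerP x1 w) => h3; case: (ltrP w y1) => h4; case: (lerP z w) => h5;
      case: (ltrP w z) => h6 /=; rewrite ?addr0 ?add0r //; exfalso; lra.
  rewrite !split_itv (_ : _ - _ = (T n (itv_fun g x1 z) - T m (itv_fun g x1 z)) +
    (T n (itv_fun g z y1) - T m (itv_fun g z y1))); last by linear_identity.
  by apply: (le_trans (rnormD _ _)); rewrite /z in k1 k2 *; lra.
move=> s hs; pose e2 := e1 / (4 * (c + 1)).
have e20 : 0 < e2 by rewrite divr_gt0//; lra.
have ce2 : c * e2 <= e1 / 4.
  rewrite /e2 (_ : c * (e1 / (4 * (c + 1))) = e1 / 4 * (c / (c + 1))); last by field; lra.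
  by rewrite ger_pMr ?divr_gt0// ler_pdivrMr//; lra.
have /cvgrPdist_le/(_ e2 e20) := cg s.
move=> /nbhs_normP[d /= d0 hd]; exists d => // x1 y1 xx1 x1s sy1 y1y yx1'.
have x1y1 : x1 <= y1 by lra.
pose rho := itv_fun (fun z => g z - g s) x1 y1.
have irho : integrable_R rho.
  by apply: integrable_itv_fun => z; apply: cvgB; [exact: cg|exact: cvg_cst].
have brho : \int[mu]_z `|rho z| <= e2 * (y1 - x1).
  apply: int_indic_bound => // z; rewrite /rho /itv_fun indicE mem_setE in_itv /=.
  case: (boolP (x1 <= z < y1)) => /= hz; last by rewrite !mulr0 normr0.
  by rewrite !mulr1 distrC; apply: hd => /=; rewrite ltr_norml; lra.
have Trho n : rnorm (T n rho) <= e1 / 4 * (y1 - x1).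
  apply: (le_trans (T_bound n irho)); apply: (le_trans (ler_wpM2l c0 brho)).
  by rewrite mulrA ler_wpM2r//; lra.
have ii : integrable_R (\1_(`[x1, y1[ : set R)) by exact: integrable_indic_itv.
have TE n : T n (itv_fun g x1 y1) = (g s)%:C *: T n (\1_(`[x1, y1[ : set R)) + T n rho.
  rewrite -T_lin//; apply: T_ext => z; rewrite /rho /itv_fun -mulrDl; congr (_ * _); ring.
move: x1y1; rewrite le_eqVlt => /orP[/eqP xe|x1y1].
  exists 0%N => n m _ _.
  have Z k : T k (itv_fun g x1 y1) = 0.
    apply: rnorm_eq0; have : \int[mu]_z `|itv_fun g x1 y1 z| <= 0 * (y1 - x1).
      apply: int_indic_bound; [by rewrite xe|exact: integrable_itv_fun|move=> z].
      by rewrite /itv_fun xe set_itvco0 indicE in_set0 !mulr0 normr0.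
    rewrite mul0r => h; apply: (le_trans (T_bound k (integrable_itv_fun _ _ cg))).
    by rewrite -(mulr0 c) ler_wpM2l.
  by rewrite !Z subrr rnorm0 xe subrr mulr0.
pose eta := e1 * (y1 - x1) / (4 * (`|g s| + 1)).
have gs0 := normr_ge0 (g s).
have eta0 : 0 < eta.
  by apply: divr_gt0; [rewrite mulr_gt0// subr_gt0|lra].
have [N hN] := T_itv (ltW x1y1) eta0; exists N => n m Nn Nm.
have k1 := hN n Nn; have k2 := hN m Nm; have k3 := Trho n; have k4 := Trho m.
set Tn := T n (\1_(`[x1, y1[ : set R)) in k1; set Tm := T m (\1_(`[x1, y1[ : set R)) in k2.
rewrite !TE -/Tn -/Tm (_ : _ - _ = (g s)%:C *: ((Tn - (G y1 - G x1)) - (Tm - (G y1 - G x1)))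
   + (T n rho - T m rho)); last by linear_identity.
apply: (le_trans (rnormD _ _)); rewrite rnormZr.
have k5 := rnormB (Tn - (G y1 - G x1)) (Tm - (G y1 - G x1)).
have k6 := rnormB (T n rho) (T m rho).
have k7 : `|g s| * rnorm (Tn - (G y1 - G x1) - (Tm - (G y1 - G x1))) <= `|g s| * (2 * eta).
  by rewrite ler_wpM2l//; lra.
have k8 : `|g s| * (2 * eta) <= e1 / 2 * (y1 - x1).
  rewrite /eta (_ : `|g s| * _ = e1 / 2 * (y1 - x1) * (`|g s| / (`|g s| + 1))); last by field; lra.
  rewrite ger_pMr; first by rewrite ler_pdivrMr//; lra.
  by rewrite mulr_gt0 ?divr_gt0// subr_gt0.
lra.
Qed.

(** Truncate to a bounded interval, then approximate by a continuous function. *)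
Let approx psi e : integrable_R psi -> 0 < e -> exists g x y, [/\ continuous g, x <= y &
  \int[mu]_z `|psi z - itv_fun g x y z| <= e].
Proof.
move=> hp e0; have e20 : 0 < e / 2 by lra.
pose A n : set R := [set` `[(- n%:R : R), n%:R[].
have mA n : measurable (A n) by exact: measurable_itv.
have mpsi : measurable_fun setT psi by case/integrableP: hp => /measurable_EFinP.
pose f n z := psi z * \1_(A n) z.
have mf n : measurable_fun setT (f n) by apply: measurable_funM => //; exact: measurable_indic.
have [N hN] : exists N, \int[mu]_z `|f N z - psi z| <= e / 2.
  have [||||| _ + _] := @dominated_convergence _ _ R mu setT measurableT (fun n z => (f n z)%:E)
      (fun z => (psi z)%:E) (fun z => `|psi z|%:E).
  - by move=> n; apply/measurable_EFinP; exact: mf.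
  - exact/measurable_EFinP.
  - apply: aeW => z _; apply: cvg_EFin; first exact: nearW.
    apply: cvg_near_cst; exists (Num.truncn `|z|).+1 => // n /= hn.
    have zn : `|z| < n%:R by apply: (lt_le_trans (truncnS_gt _)); rewrite ler_nat.
    rewrite /f indicE mem_set ?mulr1// /A /= in_itv /=.
    by move: zn; rewrite ltr_norml => /andP[/ltW -> ->].
  - exact: integrable_R_abs.
  - apply: aeW => z n _; rewrite lee_fin /f normrM ler_piMr// indicE.
    by case: (_ \in _); rewrite ?normr1 ?normr0.
  move=> /fine_cvgP[_] /cvgrPdist_le/(_ _ e20)[N _ hN]; exists N.
  have := hN N (leqnn N); rewrite /= sub0r normrN => h.
  by apply: le_trans h; rewrite ler_norm.
have muA : (mu (A N) < +oo)%E.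
  rewrite /A [X in (X < _)%E](_ : _ = lebesgue_measure [set` `[(- N%:R : R), N%:R[])//.
  by rewrite lebesgue_measure_itv /= lte_fin; case: ifP => _; rewrite ltry.
have [g_ [cg ig /fine_cvgP[_]]] := approximation_continuous_integrable (mA N) muA (intS (mA N) hp).
move=> /cvgrPdist_le/(_ _ e20)[k _ hk]; have := hk k (leqnn k); rewrite /= sub0r normrN => {}hk.
have NN : - N%:R <= N%:R :> R by rewrite (@le_trans _ _ 0) ?oppr_le0 ?ler0n.
exists (g_ k), (- N%:R), N%:R; split; [exact: cg|exact: NN|].
set u := itv_fun _ _ _.
have iu : integrable_R u by apply: integrable_itv_fun; exact: cg.
have indic_int (h : R -> R) : mu.-integrable (A N) (EFin \o h) ->
    integrable_R (fun z => h z * \1_(A N) z).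
  move=> /(iffLR (@integrable_mkcond _ _ _ mu _ (EFin \o h) (mA N))).
  apply: eq_integrable => // z _; rewrite /= restrict_EFin /= patchE indicE.
  by case: ifP => _; rewrite ?mulr1 ?mulr0.
have ifN : integrable_R (f N) by apply: indic_int; exact: intS.
have subI h1 h2 : integrable_R h1 -> integrable_R h2 -> integrable_R (fun z => `|h1 z - h2 z|).
  move=> i1 i2; apply: integrable_R_abs.
  have := integrable_R_lin (-1) i2 i1.
  by apply: eq_integrable => // z _; rewrite /= mulN1r addrC.
apply: (@le_trans _ _ (\int[mu]_z (`|f N z - psi z| + `|f N z - u z|))).
  apply: le_Rintegral => //; first exact: subI.
    apply: (@integrableD _ _ _ mu setT measurableT _ _ (subI _ _ ifN hp) (subI _ _ ifN iu)).
  move=> z _; rewrite (_ : psi z - u z = (f N z - u z) - (f N z - psi z)); last by ring.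
  by apply: (le_trans (ler_normB _ _)); rewrite [leLHS]addrC.
rewrite RintegralD//; [|exact: subI|exact: subI].
rewrite [leRHS](splitr e); apply: lerD; first exact: hN.
rewrite (_ : (\int[mu]_z `|f N z - u z|) = \int[mu]_(z in A N) `|psi z - g_ k z|).
  by rewrite (le_trans (ler_norm _)).
rewrite [RHS]Rintegral_mkcond; apply: eq_Rintegral => z _.
rewrite patchE -[u z]/(g_ k z * \1_(A N) z) /f -mulrBl normrM indicE.
have [zA|zA] := pselect (A N z); first by rewrite !mem_set// normr1 mulr1.
by rewrite !memNset// normr0 mulr0.
Qed.

Let cauchy_integrable psi : integrable_R psi -> cauchy_at psi.
Proof.
move=> hp e e0; have cc : 0 < 4 * (c + 1) by rewrite mulr_gt0// ltr_wpDl.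
have e10 : 0 < e / (4 * (c + 1)) by rewrite divr_gt0.
have [g [x [y [cg xy hg]]]] := approx hp e10.
have e20 : 0 < e / 4 by lra.
have [N hN] := cauchy_continuous cg xy e20; exists N => n m Nn Nm.
set u := itv_fun g x y in hg hN *.
have iu : integrable_R u by exact: integrable_itv_fun.
pose r z := -1 * u z + psi z.
have ir : integrable_R r by exact: integrable_R_lin.
have Tr k : T k r = T k psi - T k u.
  by rewrite T_lin// rmorphN1; linear_identity.
have rb k : rnorm (T k r) <= e / 4.
  apply: (le_trans (T_bound k ir)); apply: (@le_trans _ _ (c * (e / (4 * (c + 1))))).
    rewrite ler_wpM2l//; apply: le_trans hg; rewrite le_eqVlt; apply/orP; left; apply/eqP.
    by apply: eq_Rintegral => z _; rewrite /r mulN1r addrC.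
  rewrite (_ : c * _ = e / 4 * (c / (c + 1))); last by field; rewrite lt0r_neq0// ltr_wpDl.
  by rewrite ger_pMr// ler_pdivrMr ?mul1r ?lerDl// ltr_wpDl.
rewrite (_ : _ - _ = T n r - T m r + (T n u - T m u)); last by rewrite !Tr; linear_identity.
apply: (le_trans (rnormD _ _)); have := rnormB (T n r) (T m r).
have := rb n; have := rb m; have := hN n m Nn Nm; lra.
Qed.

Let is_limit psi l := forall e : R, 0 < e -> exists N, forall n, (N <= n)%N ->
  rnorm (T n psi - l) <= e.

Let Tr psi : E := xget 0 (is_limit psi).

Let TrP psi : integrable_R psi -> is_limit psi (Tr psi).
Proof.
move=> /cauchy_integrable/cE[l hl]; exact: (xgetPex 0 (ex_intro (is_limit psi) l hl)).
Qed.

Let limit_unique psi l : integrable_R psi -> is_limit psi l -> Tr psi = l.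
Proof.
move=> /TrP h1 h2; apply/eqP; rewrite -subr_eq0; apply/eqP; apply: rnorm_le_eps => e e0.
have e20 : 0 < e / 2 by lra.
have [N1 k1] := h1 _ e20; have [N2 k2] := h2 _ e20.
have := k1 _ (leq_maxl N1 N2); have := k2 _ (leq_maxr N1 N2); move: (maxn _ _) => n.
have := rnorm_dist (T n psi) (Tr psi) l; rewrite (rnorm_distC (Tr psi) (T n psi)); lra.
Qed.

Let Tr_lin a psi chi : integrable_R psi -> integrable_R chi ->
  Tr (fun x => a * psi x + chi x) = a%:C *: Tr psi + Tr chi.
Proof.
move=> hp hc; apply: limit_unique; first exact: integrable_R_lin.
move=> e e0; have aa : 0 < `|a| + 1 by rewrite ltr_wpDl.
have e20 : 0 < e / 2 by lra.
have [N1 k1] := TrP hp (divr_gt0 e20 aa); have [N2 k2] := TrP hc e20.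
exists (maxn N1 N2) => n; rewrite geq_max => /andP[/k1 h1 /k2 h2].
rewrite T_lin// (_ : _ - _ = a%:C *: (T n psi - Tr psi) + (T n chi - Tr chi)); last by linear_identity.
apply: (le_trans (rnormD _ _)); rewrite rnormZr.
have : (`|a| + 1) * rnorm (T n psi - Tr psi) <= e / 2 by rewrite mulrC -ler_pdivlMr.
have := rnorm_ge0 (T n psi - Tr psi); lra.
Qed.

Let Tr_bound psi : integrable_R psi -> rnorm (Tr psi) <= c * \int[mu]_x `|psi x|.
Proof.
move=> hp; apply/ler_addgt0Pr => e e0; have [N hN] := TrP hp e0.
have := hN N (leqnn N); have := T_bound N hp; have := rnorm_distD (Tr psi) (T N psi).
rewrite rnorm_distC; lra.
Qed.

Let Tr_itv x y : x <= y -> Tr (\1_(`[x, y[ : set R)) = G y - G x.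
Proof.
move=> xy; apply: limit_unique; first exact: integrable_indic_itv.
by move=> e e0; exact: T_itv.
Qed.

Let Top (phi : R -> R[i]) : E :=
  Tr (fun y => complex.Re (phi y)) + 'i *: Tr (fun y => complex.Im (phi y)).

Let Tr_ext psi chi : psi =1 chi -> Tr psi = Tr chi.
Proof. by move=> /funext ->. Qed.

Let Tr0 : Tr (fun=> 0) = 0.
Proof.
have i0 : integrable_R (fun=> 0) by exact: integrable0.
apply: limit_unique => // e e0; exists 0%N => n _; rewrite subr0.
apply: (le_trans (T_bound n i0)).
rewrite (_ : (fun _ : R => `|0|) = (fun=> 0 : R)); last by apply/funext => z; rewrite normr0.
by rewrite /Rintegral integral0 /= mulr0 ltW.
Qed.

Lemma measurable_rnorm (phi : R -> R[i]) :
  measurable_fun setT (fun y => complex.Re (phi y)) ->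
  measurable_fun setT (fun y => complex.Im (phi y)) ->
  measurable_fun setT (fun y => rnorm (phi y)).
Proof.
move=> h1 h2.
rewrite (_ : (fun y => rnorm _) = (@Num.sqrt R) \o (fun y => complex.Re (phi y) ^+ 2 + complex.Im (phi y) ^+ 2)).
  apply: measurableT_comp; last by apply: measurable_funD; exact: measurable_funX.
  by apply: continuous_measurable_fun; exact: sqrt_continuous.
by apply/funext => y; rewrite rnormE_sqrt.
Qed.

Lemma stieltjes_operator : exists T : (R -> R[i]) -> E, hom_L1 T /\
  forall x y, x <= y -> T (fun z => (\1_(`[x, y[ : set R) z)%:C) = G y - G x.
Proof.
exists Top; split; last by move=> x y xy; rewrite /Top /= Tr_itv// Tr0 scaler0 addr0.
split=> [a phi psi [hp1 hp2] [hc1 hc2]|phi [hp1 hp2] e e0].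
  rewrite /Top.
  have i1 := integrable_R_lin (- complex.Im a) hp2 hc1.
  have i2 := integrable_R_lin (complex.Im a) hp1 hc2.
  have -> : Tr (fun y => complex.Re (a * phi y + psi y)) =
      Tr (fun y => complex.Re a * complex.Re (phi y) +
        (- complex.Im a * complex.Im (phi y) + complex.Re (psi y))).
    apply: Tr_ext => y; case: (a) => a1 a2; case: (phi y) => p1 p2; case: (psi y) => q1 q2 /=; ring.
  have -> : Tr (fun y => complex.Im (a * phi y + psi y)) =
      Tr (fun y => complex.Re a * complex.Im (phi y) +
        (complex.Im a * complex.Re (phi y) + complex.Im (psi y))).
    apply: Tr_ext => y; case: (a) => a1 a2; case: (phi y) => p1 p2; case: (psi y) => q1 q2 /=; ring.
  rewrite !Tr_lin//.
  have a1 : a = (complex.Re a)%:C + 'i * (complex.Im a)%:C by rewrite -ptE; case: (a).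
  have a2 : a * 'i = 'i * (complex.Re a)%:C - (complex.Im a)%:C.
    by rewrite {1}a1; apply/eqP; rewrite eq_complex /=; apply/andP; split; apply/eqP; ring.
  have aE (u v : E) : a *: (u + 'i *: v) = ((complex.Re a)%:C *: u + 'i *: ((complex.Im a)%:C *: u)) +
      ('i *: ((complex.Re a)%:C *: v) - (complex.Im a)%:C *: v).
    by rewrite scalerDr scalerA a2 {1}a1; linear_identity.
  rewrite aE; linear_identity.
have cc : 0 < 2 * c + 1 by rewrite ltr_wpDl// mulr_ge0.
exists (e / (2 * c + 1)); first by rewrite divr_gt0.
move=> psi [hc1 hc2] hd.
have part (p1 p2 : R -> R) : integrable_R p1 -> integrable_R p2 ->
    (forall y, `|p1 y - p2 y| <= rnorm (phi y - psi y)) ->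
    rnorm (Tr p1 - Tr p2) <= c * (e / (2 * c + 1)).
  move=> j1 j2 hb.
  have j3 := integrable_R_lin (-1) j2 j1.
  have := Tr_bound j3; rewrite Tr_lin// rmorphN1 scaleN1r addrC => /le_trans; apply.
  rewrite ler_wpM2l// -lee_fin; apply: le_trans (ltW hd).
  rewrite /Rintegral fineK; last by apply: integrable_fin_num => //; exact: integrable_R_abs.
  apply: ge0_le_integral => //.
  - by case/integrableP: (integrable_R_abs j3).
  - apply/measurable_EFinP; apply: measurable_rnorm.
      rewrite (_ : (fun y => _) = (fun y => complex.Re (phi y) - complex.Re (psi y))).
        by apply: measurable_funB; [case/integrableP: hp1|case/integrableP: hc1] => /measurable_EFinP.
      by apply/funext => y; case: (phi y); case: (psi y).
    rewrite (_ : (fun y => _) = (fun y => complex.Im (phi y) - complex.Im (psi y))).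
      by apply: measurable_funB; [case/integrableP: hp2|case/integrableP: hc2] => /measurable_EFinP.
    by apply/funext => y; case: (phi y); case: (psi y).
  - by move=> y _; rewrite lee_fin mulN1r addrC.
have b1 := part _ _ hp1 hc1 (fun y => ltac:(by have := Re_le (phi y - psi y); case: (phi y); case: (psi y))).
have b2 := part _ _ hp2 hc2 (fun y => ltac:(by have := Im_le (phi y - psi y); case: (phi y); case: (psi y))).
rewrite /Top (_ : _ - _ = (Tr (fun y => complex.Re (phi y)) - Tr (fun y => complex.Re (psi y))) +
  'i *: (Tr (fun y => complex.Im (phi y)) - Tr (fun y => complex.Im (psi y)))); last by linear_identity.
apply: (le_lt_trans (rnormD _ _)); rewrite rnorm_scalei.
apply: (@le_lt_trans _ _ (2 * c * (e / (2 * c + 1)))).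
  by rewrite -mulrA mulr_natl mulr2n lerD.
rewrite (_ : 2 * c * _ = e * (2 * c / (2 * c + 1))); last by field; rewrite lt0r_neq0.
by rewrite gtr_pMr// ltr_pdivrMr// mul1r ltrDl.
Qed.

End stieltjes.

(** * Comparison of a Bochner integral with a constant *)

Section finite_range.
Import finmap.
Context (R : realType) (T : choiceType).
Let mu := @lebesgue_measure R.
Variable s : R -> T.
Hypothesis fin_s : finite_set (range s).
Hypothesis mes_s : forall x, measurable (s @^-1` [set x]).
Let rs := fset_set (range s).

Lemma finite_range_sum (F : T -> R) (A : set R) z :
  F (s z) * \1_A z = \sum_(x <- rs) F x * \1_(s @^-1` [set x] `&` A) z.
Proof.
have szr : s z \in rs by rewrite /rs in_fset_set// mem_set//; exists z.
rewrite (bigD1_seq (s z)) ?fset_uniq//= big1 ?addr0.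
  rewrite !indicE in_setI; congr (_ * _%:R); congr nat_of_bool.
  by rewrite (@mem_set _ (s @^-1` [set s z]) z).
move=> x xs; rewrite indicE memNset ?mulr0//= => -[e _].
by move: xs; rewrite -e eqxx.
Qed.

Lemma finite_range_measurable (F : T -> R) : measurable_fun setT (fun z => F (s z)).
Proof.
rewrite (_ : (fun z => _) = (fun z => \sum_(x <- rs) F x * \1_(s @^-1` [set x] `&` setT) z)).
  apply: measurable_sum => x; apply: measurable_funM => //.
  by apply: measurable_indic; rewrite setIT.
by apply/funext => z; rewrite -finite_range_sum indicT mulr1.
Qed.

Lemma finite_range_integral (F : T -> R) (A : set R) : measurable A -> (forall x, 0 <= F x) ->
  (\int[mu]_z (F (s z) * \1_A z)%:E = \sum_(x <- rs) (F x)%:E * mu (s @^-1` [set x] `&` A))%E.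
Proof.
move=> mA F0.
transitivity (\int[mu]_z (\sum_(x <- rs) (F x * \1_(s @^-1` [set x] `&` A) z)%:E))%E.
  by apply: eq_integral => z _; rewrite finite_range_sum sumEFin.
have mB x : measurable (s @^-1` [set x] `&` A) by exact: measurableI.
have mI0 x : measurable_fun setT (\1_(s @^-1` [set x] `&` A) : R -> R).
  by apply: measurable_indic.
have mI x : measurable_fun setT (fun z => (\1_(s @^-1` [set x] `&` A) z)%:E : \bar R).
  by apply/measurable_EFinP; exact: (mI0 x).
rewrite ge0_integral_sum//.
- apply: eq_bigr => x _.
  transitivity (\int[mu]_z ((F x)%:E * (\1_(s @^-1` [set x] `&` A) z)%:E))%E.
    by apply: eq_integral => z _; rewrite EFinM.
  rewrite ge0_integralZl_EFin//; last exact: (mI x).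
  rewrite integral_indic//; last exact: (mB x).
  transitivity ((F x)%:E * mu ((s @^-1` [set x] `&` A) `&` setT))%E; first by [].
  by rewrite setIT.
- by move=> x; apply/measurable_EFinP; apply: measurable_funM => //; exact: (mI0 x).
- by move=> x y _; rewrite lee_fin mulr_ge0.
Qed.

End finite_range.

Section bochner_estimate.
Import finmap.
Context (R : realType) (E : normedModType R[i]).
Let mu := @lebesgue_measure R.

(** With the weights [w x] and [q x] of the level set of [x] inside and outside
[A], the left-hand side is the norm of the sum of [w x (x - v) + q x x], and
the right-hand side the sum of the norms. *)
Lemma simple_integral_dist (s : R -> E) (A : set R) (v : E) :
  integrable_simple_fun s -> measurable A -> (mu A < +oo)%E ->
  ((rnorm (simple_integral s - (fine (mu A))%:C *: v))%:E <=
    \int[mu]_z (rnorm (s z - (\1_A z)%:C *: v))%:E)%E.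
Proof.
move=> [[fs ms] ints] mA fA; set rs := fset_set (range s).
have mAC : measurable (~` A) by exact: measurableC.
pose w x := fine (mu (s @^-1` [set x] `&` A)); pose q x := fine (mu (s @^-1` [set x] `&` ~` A)).
have mBA x : measurable (s @^-1` [set x] `&` A) := measurableI _ _ (ms x) mA.
have mBC x : measurable (s @^-1` [set x] `&` ~` A) := measurableI _ _ (ms x) mAC.
have mono (B C : set R) : measurable B -> measurable C -> B `<=` C -> (mu B <= mu C)%E.
  by move=> mB mC BC; apply: le_measure => //; apply: mem_set.
have wf x : (mu (s @^-1` [set x] `&` A) < +oo)%E.
  by apply: le_lt_trans fA; apply: mono => //; exact: subIsetr.
have w0 x : 0 <= w x by exact: fine_ge0.
have q0 x : 0 <= q x by exact: fine_ge0.
have wE x : mu (s @^-1` [set x] `&` A) = (w x)%:E by rewrite /w fineK// ge0_fin_numE.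
have qE x : x != 0 -> mu (s @^-1` [set x] `&` ~` A) = (q x)%:E.
  move=> /ints h; rewrite /q fineK// ge0_fin_numE//.
  by apply: le_lt_trans h; apply: mono => //; exact: subIsetl.
have wA : fine (mu A) = \sum_(x <- rs) w x.
  have L : (\int[mu]_z (1 * \1_A z)%:E = mu A)%E.
    transitivity (\int[mu]_z (\1_A z)%:E)%E; first by apply: eq_integral => z _; rewrite mul1r.
    by rewrite integral_indic//; exact: (congr1 mu (setIT A)).
  have H := finite_range_integral fs ms (F := fun=> 1) mA (fun=> ler01).
  have -> : mu A = (\sum_(x <- rs) w x)%:E.
    rewrite -L; apply: (etrans H); rewrite -sumEFin; apply: eq_bigr => x _.
    by rewrite mul1e; exact: wE.
  by [].
have sE x : x != 0 -> mu (s @^-1` [set x]) = (w x + q x)%:E.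
  move=> x0; have U : mu ((s @^-1` [set x] `&` A) `|` (s @^-1` [set x] `&` ~` A)) =
      (mu (s @^-1` [set x] `&` A) + mu (s @^-1` [set x] `&` ~` A))%E.
    by apply: measureU; [exact: mBA|exact: mBC|rewrite setIACA setICr setI0].
  by rewrite -setIUr setUv setIT wE qE in U.
have sI : simple_integral s = \sum_(x <- rs) (w x + q x)%:C *: x.
  rewrite /simple_integral fsbig_finite//=; apply: eq_bigr => x _.
  have [->|x0] := eqVneq x 0; first by rewrite !scaler0.
  by congr (_%:C *: _); rewrite -[RHS]/(fine (w x + q x)%:E) -sE.
have -> : simple_integral s - (fine (mu A))%:C *: v =
    \sum_(x <- rs) ((w x)%:C *: (x - v) + (q x)%:C *: x).
  rewrite sI wA rmorph_sum /= scaler_suml -sumrB; apply: eq_bigr => x _; linear_identity.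
have intE : (\int[mu]_z (rnorm (s z - (\1_A z)%:C *: v))%:E =
    (\sum_(x <- rs) (rnorm (x - v) * w x + rnorm x * q x))%:E)%E.
  rewrite (_ : (fun z => _) = (fun z => (rnorm (s z - v) * \1_A z)%:E +
      (rnorm (s z) * \1_(~` A) z)%:E)%E); last first.
    apply/funext => z; rewrite -EFinD; congr (_%:E); rewrite !indicE in_setC.
    case: (z \in A) => /=; first by rewrite scale1r mulr1 mulr0 addr0.
    by rewrite scale0r subr0 mulr0 mulr1 add0r.
  have mS (F : E -> R) (B : set R) : measurable B -> measurable_fun setT (fun z => (F (s z) * \1_B z)%:E).
    move=> mB; apply/measurable_EFinP; apply: measurable_funM; last exact: measurable_indic.
    exact: finite_range_measurable.
  rewrite ge0_integralD//.
  - rewrite (finite_range_integral fs ms (F := fun x => rnorm (x - v)) mA) => [|x]; last exact: rnorm_ge0.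
    rewrite (finite_range_integral fs ms (F := fun x => rnorm x) mAC) => [|x]; last exact: rnorm_ge0.
    rewrite -big_split /= -sumEFin; apply: eq_bigr => x _.
    rewrite EFinD; congr (_ + _)%E; first by rewrite EFinM -wE.
    have [->|x0] := eqVneq x 0; first by rewrite rnorm0 mul0e mul0r.
    by rewrite EFinM -qE.
  - by move=> z _; rewrite lee_fin mulr_ge0 ?rnorm_ge0.
  - exact: (mS (fun x => rnorm (x - v))).
  - by move=> z _; rewrite lee_fin mulr_ge0 ?rnorm_ge0.
  - exact: (mS (fun x => rnorm x)).
rewrite intE lee_fin (le_trans (rnorm_sum _ _))//; apply: ler_sum => x _.
rewrite (le_trans (rnormD _ _))// !rnormZr !ger0_norm//.
by rewrite mulrC [q x * _]mulrC.
Qed.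

(** The function is a pointwise limit of functions that take finitely many values
on measurable sets. *)
Lemma strongly_measurable_dist (h : R -> E) (s : R -> E) (A : set R) :
  strongly_measurable h -> simple_fun s -> measurable A ->
  measurable_fun setT (fun z => rnorm ((\1_A z)%:C *: h z - s z)).
Proof.
move=> [t [st ht]] [fs ms] mA.
pose f n z := rnorm ((\1_A z)%:C *: t n z - s z).
apply: (@measurable_fun_cvg _ _ _ setT f) => [n|z _].
  have [ft mt] := st n.
  pose p z := (t n z, s z, z \in A).
  have fp : finite_set (range p).
    apply: (@sub_finite_set _ _ (range (t n) `*` range s `*` [set: bool])).
      by move=> _ [z _ <-]; split => //; split; exists z.
    by apply: finite_setX => //; exact: finite_setX.
  have mp x : measurable (p @^-1` [set x]).
    case: x => [[x1 x2] bb].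
    have -> : p @^-1` [set (x1, x2, bb)] = (t n @^-1` [set x1]) `&` (s @^-1` [set x2]) `&`
        (if bb then A else ~` A).
      apply/seteqP; split => z /=.
        move=> [<- <- <-]; split => //; case: ifPn; first exact: set_mem.
        by move=> /negP h1 h2; apply: h1; exact: mem_set.
      move=> [[<- <-] h1]; rewrite /p; congr (_, _).
      by case: bb h1 => h1; [rewrite mem_set|rewrite memNset].
    apply: measurableI; first exact: measurableI.
    by case: bb => //; exact: measurableC.
  have := finite_range_measurable fp mp (fun x => rnorm (((x.2 : nat)%:R : R)%:C *: x.1.1 - x.1.2)).
  exact.
apply/cvgrPdist_le => e e0.
have e1 : 0 < e%:C by rewrite ltcR.
have /cvgrPdist_le/(_ _ e1)[N _ hN] := ht z.
exists N => // n /hN; rewrite norm_leC => h1.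
apply: (le_trans (rnorm_dist_abs _ _)); rewrite /f.
rewrite (_ : _ - _ = (\1_A z)%:C *: (h z - t n z)); last by linear_identity.
rewrite rnormZr; apply: le_trans h1; rewrite -[leRHS]mul1r ler_wpM2r ?rnorm_ge0// indicE.
by case: (z \in A); rewrite ?normr1 ?normr0.
Qed.

(** The limit of [simple_integral_dist] along simple functions that converge to
the integrand in the mean. *)
Lemma bochner_dist (h : R -> E) (a b : R) (v : E) (I : E) : a <= b ->
  strongly_measurable h ->
  is_bochner_integral (fun z => (\1_(`[a, b[ : set R) z)%:C *: h z) I ->
  ((rnorm (I - (b - a)%:C *: v))%:E <= \int[mu]_(z in `[a, b[) (rnorm (h z - v))%:E)%E.
Proof.
move=> ab mh [_ [s [si s0 sI]]].
pose A : set R := [set` `[a, b[]; have mA : measurable A by exact: measurable_itv.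
have muA : mu A = (b - a)%:E.
  rewrite [LHS](_ : _ = lebesgue_measure [set` `[a, b[])// lebesgue_measure_itv /= lte_fin.
  case: ltP => // ba; rewrite (_ : b - a = 0)//; apply/eqP; rewrite subr_eq0 eq_le ab andbT //.
have fA : (mu A < +oo)%E by rewrite muA ltry.
have sv : simple_fun (fun _ : R => v).
  split; first by apply: (sub_finite_set _ (finite_set1 v)) => _ [z _ <-].
  move=> x; have [->|xv] := pselect (x = v).
    by rewrite (_ : _ @^-1` _ = setT)//; apply/seteqP; split.
  by rewrite (_ : _ @^-1` _ = set0)//; apply/seteqP; split => // z /= /esym.
pose L := (\int[mu]_(z in A) (rnorm (h z - v))%:E)%E.
have mhv : measurable_fun setT (fun z => rnorm (h z - v)).
  have := strongly_measurable_dist mh sv measurableT.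
  by apply: eq_measurable_fun => z _; rewrite indicT scale1r.
have LE : L = (\int[mu]_z (rnorm (h z - v) * \1_A z)%:E)%E.
  rewrite /L integral_mkcond; apply: eq_integral => z _.
  rewrite patchE indicE; case: ifPn => _; by rewrite ?mulr1 ?mulr0.
have mhvA : measurable_fun setT (fun z => (rnorm (h z - v) * \1_A z)%:E).
  by apply/measurable_EFinP; apply: measurable_funM => //; exact: measurable_indic.
have step n : ((rnorm (simple_integral (s n) - (b - a)%:C *: v))%:E <=
    \int[mu]_z (rnorm ((\1_A z)%:C *: h z - s n z))%:E + L)%E.
  have mhs := strongly_measurable_dist mh (si n).1 mA.
  have := simple_integral_dist v (si n) mA fA; rewrite muA => /le_trans; apply.
  rewrite LE -ge0_integralD//.
  - apply: ge0_le_integral => //.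
    + by move=> z _; rewrite lee_fin rnorm_ge0.
    + apply/measurable_EFinP; have := strongly_measurable_dist (h := fun=> v) _ (si n).1 mA.
      have h1 : strongly_measurable (fun _ : R => v).
        by exists (fun _ _ => v); split => // y; exact: cvg_cst.
      by move=> /(_ h1); apply: eq_measurable_fun => z _; rewrite rnorm_distC.
    + apply: emeasurable_funD => //; exact/measurable_EFinP.
    + move=> z _; rewrite -EFinD lee_fin.
      have := rnorm_dist ((\1_A z)%:C *: h z) (s n z) ((\1_A z)%:C *: v).
      rewrite -scalerBr rnormZr ger0_norm// (rnorm_distC (s n z) (_ *: h z)).
      by rewrite [X in _ <= _ + X -> _]mulrC.
  - by move=> z _; rewrite lee_fin rnorm_ge0.
  - exact/measurable_EFinP.
  - by move=> z _; rewrite lee_fin mulr_ge0 ?rnorm_ge0.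
rewrite -/A -/L; have L0 : (0 <= L)%E by apply: integral_ge0 => z _; rewrite lee_fin rnorm_ge0.
move: L0 step; case: L {LE} => [l| |]//= l0 step; last by rewrite leey.
rewrite lee_fin; apply/ler_addgt0Pr => e e0; have e20 : 0 < e / 2 by lra.
move/fine_cvgP: s0 => [[N1 _ fin1] /cvgrPdist_le/(_ _ e20)[N2 _ hN2]].
have e21 : 0 < (e / 2)%:C by rewrite ltcR.
have /cvgrPdist_le/(_ _ e21)[N3 _ hN3] := sI.
pose n := maxn N1 (maxn N2 N3).
have n1 : (N1 <= n)%N by rewrite leq_maxl.
have n2 : (N2 <= n)%N by rewrite /n !leq_max leqnn orbT.
have n3 : (N3 <= n)%N by rewrite /n !leq_max leqnn !orbT.
have k1 := fin1 n n1; have k2 := hN2 n n2; have k3 := hN3 n n3; have k4 := step n.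
rewrite /= norm_leC in k3; rewrite /= sub0r normrN in k2; rewrite /= in k1.
move: k4; rewrite -(fineK k1) -EFinD lee_fin => k4.
have := rnorm_dist (simple_integral (s n)) I ((b - a)%:C *: v).
have := le_trans (ler_norm _) k2.
lra.
Qed.

End bochner_estimate.

(** * Difference quotients under the Radon-Nikodym property *)

Section difference_quotients.
Import finmap.
Context (R : realType) (E : normedModType R[i]).
Let mu := @lebesgue_measure R.

Lemma lipschitz_continuous (f : R -> R) (L : R) :
  (forall x y, `|f y - f x| <= L * `|y - x|) -> continuous f.
Proof.
move=> h x; apply/cvgrPdist_le => e e0; have L1 : 0 < `|L| + 1 by rewrite ltr_wpDl.
apply/nbhs_normP; exists (e / (`|L| + 1)); first by rewrite /= divr_gt0.
move=> y /=; rewrite ltr_pdivlMr// => /ltW k.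
apply: (le_trans _ k); rewrite distrC (distrC x y); apply: (le_trans (h x y)); rewrite mulrC ler_wpM2l//.
by rewrite (le_trans (ler_norm L))// lerDl.
Qed.

Definition quotient (G : R -> E) (n : nat) (y : R) : E :=
  (n.+1%:R)%:C *: (G (y + n.+1%:R^-1) - G y).

Variables (G : R -> E) (c : R).
Hypothesis lipG : forall x y, rnorm (G y - G x) <= c * `|y - x|.

Let tau0 n : 0 < n.+1%:R^-1 :> R. Proof. by rewrite invr_gt0. Qed.
Let tauM n : n.+1%:R * n.+1%:R^-1 = 1 :> R. Proof. by rewrite mulfV// pnatr_eq0. Qed.

Let cancel (x i : R) : x + i - x = i. Proof. by rewrite addrAC subrr add0r. Qed.

Lemma quotient_bound n y : rnorm (quotient G n y) <= c.
Proof.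
rewrite /quotient rnormZr ger0_norm//.
have := lipG y (y + n.+1%:R^-1); rewrite cancel (gtr0_norm (tau0 n)) => h.
apply: le_trans (ler_wpM2l (ler0n R n.+1) h) _.
by rewrite mulrCA tauM mulr1.
Qed.

Lemma quotient_lipschitz n x y :
  rnorm (quotient G n y - quotient G n x) <= 2 * c * n.+1%:R * `|y - x|.
Proof.
rewrite /quotient -scalerBr rnormZr ger0_norm//.
have h1 := lipG x y; have h2 := lipG (x + n.+1%:R^-1) (y + n.+1%:R^-1).
rewrite (_ : y + n.+1%:R^-1 - (x + n.+1%:R^-1) = y - x) in h2; last by ring.
rewrite (_ : 2 * c * n.+1%:R * `|y - x| = n.+1%:R * (c * `|y - x| + c * `|y - x|)); last by ring.
rewrite ler_wpM2l// (_ : _ - _ = (G (y + n.+1%:R^-1) - G (x + n.+1%:R^-1)) - (G y - G x)).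
  by apply: (le_trans (rnormB _ _)); rewrite lerD.
linear_identity.
Qed.

Variable h : R -> E.
Hypothesis mh : strongly_measurable h.
Hypothesis bh : essentially_bounded h.
Hypothesis hG : forall x y, x <= y ->
  is_bochner_integral (fun z => (\1_(`[x, y[ : set R) z)%:C *: h z) (G y - G x).

Let mes_dist v : measurable_fun setT (fun z => rnorm (h z - v)).
Proof.
have sv : simple_fun (fun _ : R => v).
  split; first by apply: (sub_finite_set _ (finite_set1 v)) => _ [z _ <-].
  move=> x; have [->|xv] := pselect (x = v).
    by rewrite (_ : _ @^-1` _ = setT)//; apply/seteqP; split.
  by rewrite (_ : _ @^-1` _ = set0)//; apply/seteqP; split => // z /= /esym.
have := strongly_measurable_dist mh sv measurableT.
by apply: eq_measurable_fun => z _; rewrite indicT scale1r.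
Qed.

Let locally_integrable_dist v : locally_integrable setT (fun z => rnorm (h z - v)).
Proof.
split; [exact: mes_dist|exact: openT|move=> K _ cK].
have [M hM] := bh; have mK : measurable K by exact: compact_measurable.
have Kfin : (mu K < +oo)%E by exact: compact_finite_measure.
apply: (@le_lt_trans _ _ (\int[mu]_(x in K) (`|M| + rnorm v)%:E)%E); last first.
  by rewrite integral_cst// lte_mul_pinfty// lee_fin addr_ge0// rnorm_ge0.
apply: ae_ge0_le_integral => //.
- by apply/measurable_EFinP; apply: measurableT_comp => //; apply: measurable_funTS; exact: mes_dist.
- by move=> z _; rewrite lee_fin addr_ge0// rnorm_ge0.
- apply: (@filterS _ _ (ae_filter_ringOfSetsType mu) _ _ _ hM) => z hz _; rewrite lee_fin ger0_norm ?rnorm_ge0//.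
  by rewrite (le_trans (rnormB _ _))// lerD2r (le_trans hz)// ler_norm.
Qed.

Let itv (x : R) (n : nat) : set R := [set` `[x, (x + n.+1%:R^-1)[].

Let mu_itv x n : mu (itv x n) = (n.+1%:R^-1)%:E.
Proof.
rewrite [LHS](_ : _ = lebesgue_measure [set` `[x, (x + n.+1%:R^-1)[])//.
by rewrite lebesgue_measure_itv /= lte_fin ltrDl tau0 -EFinD cancel.
Qed.

Let nice x : nicely_shrinking x (itv x).
Proof.
split; first by move=> n; exact: measurable_itv.
exists (2, fun n => PosNum (tau0 n)); split => //=.
- exact: cvg_harmonic.
- move=> n z; rewrite /itv /= in_itv /= => /andP[xz zx]; rewrite /ball /= ltr_norml; move: (tau0 n) zx; move: (_^-1) => i; lra.
- by move=> n; rewrite lebesgue_measure_ball ?(ltW (tau0 n))// [X in (_ <= _ * X)%E](_ : _ = (n.+1%:R^-1)%:E);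
    [rewrite -EFinM lee_fin mulr2n mulrDl mul1r|exact: mu_itv].
Qed.

(** At a Lebesgue point of [|h - v|], the quotients of [G] are asymptotically no
farther from [v] than [h] is. *)
Let near_value x v : lebesgue_pt (fun z => rnorm (h z - v)) x -> forall e, 0 < e ->
  exists N, forall n, (N <= n)%N -> rnorm (quotient G n x - v) <= rnorm (h x - v) + e.
Proof.
move=> /(nice_lebesgue_differentiation nice (locally_integrable_dist v)) hl e e0.
move/fine_cvgP: hl => [[N1 _ f1] /cvgrPdist_le/(_ _ e0)[N2 _ h2]].
exists (maxn N1 N2) => n; rewrite geq_max => /andP[/f1 k1 /h2 k2].
have xx : x <= x + n.+1%:R^-1 by rewrite lerDl ltW.
have := bochner_dist v xx mh (hG xx).
have -> : x + n.+1%:R^-1 - x = n.+1%:R^-1 by rewrite cancel.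
rewrite -/(itv x n) => k3.
have k4 : ((rnorm (quotient G n x - v))%:E <=
    (mu (itv x n))^-1 * \int[mu]_(y in itv x n) (rnorm (h y - v))%:E)%E.
  rewrite mu_itv inver gt_eqF// invrK.
  have -> : quotient G n x - v =
      (n.+1%:R)%:C *: (G (x + n.+1%:R^-1) - G x - (n.+1%:R^-1)%:C *: v).
    by rewrite /quotient [RHS]scalerBr scalerA -rmorphM tauM scale1r.
  by rewrite rnormZr ger0_norm// EFinM lee_pmul2l.
have := k4; rewrite -(fineK k1) lee_fin => {}k4.
move: k2; rewrite /= ler_norml => /andP[k2 _]; lra.
Qed.

(** The values of the simple functions that converge to [h] form a countable set
with [h y] in its closure for every [y].  Almost every [y] is a Lebesgue point
of [|h - v|] for all these [v] at once, and taking [v] close to [h y] shows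
that the quotients are Cauchy at [y]. *)
Lemma quotient_cauchy_ae : {ae mu, forall y, forall e : R, 0 < e -> exists N, forall n m,
  (N <= n)%N -> (N <= m)%N -> rnorm (quotient G n y - quotient G m y) <= e}.
Proof.
have [t [st ht]] := mh.
pose v n i : E := nth 0 (fset_set (range (t n))) i.
have ae1 : {ae mu, forall y, forall n i, lebesgue_pt (fun z => rnorm (h z - v n i)) y}.
  apply: ae_foralln => n; apply: ae_foralln => i.
  exact: lebesgue_differentiation (locally_integrable_dist (v n i)).
apply: (@filterS _ _ (ae_filter_ringOfSetsType mu) _ _ _ ae1) => y hy e e0.
have e50 : 0 < e / 4 by lra.
have e51 : 0 < (e / 4)%:C by rewrite ltcR.
have /cvgrPdist_le/(_ _ e51)[k _ hk] := ht y.
have := hk k (leqnn k); rewrite /= norm_leC => {}hk.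
have tr : t k y \in fset_set (range (t k)).
  by rewrite in_fset_set; [apply: mem_set; exists y|exact: (st k).1].
have vE : v k (index (t k y) (fset_set (range (t k)))) = t k y by apply: nth_index.
have := hy k (index (t k y) (fset_set (range (t k)))); rewrite vE.
move=> /near_value/(_ _ e50)[N hN]; exists N => n m /hN k1 /hN k2.
have := rnorm_dist (t k y) (quotient G n y) (quotient G m y).
by rewrite (rnorm_distC (t k y)); lra.
Qed.

(** Otherwise there are pairs of arbitrarily large indices whose quotients are
farther apart than [e] in the mean, while their distance tends to 0 almost
everywhere and is bounded by [2 c]: dominated convergence is contradicted. *)
Lemma quotient_L1_cauchy (A e : R) : 0 < e -> exists N, forall n m,
  (N <= n)%N -> (N <= m)%N ->
  \int[mu]_(y in `[- A, A]) rnorm (quotient G n y - quotient G m y) <= e.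
Proof.
move=> e0; apply: contrapT => H.
have /choice[p hp] k : exists p : nat * nat, [/\ (k <= p.1)%N, (k <= p.2)%N &
    e < \int[mu]_(y in `[- A, A]) rnorm (quotient G p.1 y - quotient G p.2 y)].
  apply: contrapT => Hk; apply: H; exists k => n m kn km.
  by rewrite leNgt; apply/negP => he; apply: Hk; exists (n, m).
pose B : set R := [set` `[(- A), A]]; have mB : measurable B by exact: measurable_itv.
have muB : (mu B < +oo)%E.
  rewrite [X in (X < _)%E](_ : _ = lebesgue_measure [set` `[(- A), A]])//.
  by rewrite lebesgue_measure_itv /=; case: ifP => _; rewrite ltry.
pose f k y := rnorm (quotient G (p k).1 y - quotient G (p k).2 y).
have cf k : continuous (f k).
  apply: (@lipschitz_continuous _ (2 * c * (p k).1.+1%:R + 2 * c * (p k).2.+1%:R)) => x y.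
  apply: (le_trans (rnorm_dist_abs _ _)).
  rewrite (_ : _ - _ = (quotient G (p k).1 y - quotient G (p k).1 x) -
    (quotient G (p k).2 y - quotient G (p k).2 x)); last by linear_identity.
  by rewrite (le_trans (rnormB _ _))// mulrDl lerD// quotient_lipschitz.
have mf k : measurable_fun B (f k).
  by apply: measurable_funTS; exact: continuous_measurable_fun.
have [||||| _ _ ] := @dominated_convergence _ _ R mu B mB (fun k y => (f k y)%:E) (cst 0%E)
    (cst (2 * c)%:E).
- by move=> k; apply/measurable_EFinP; exact: mf.
- exact: measurable_cst.
- apply: (@filterS _ _ (ae_filter_ringOfSetsType mu) _ _ _ quotient_cauchy_ae) => y hy _; apply: cvg_EFin; first exact: nearW.
  apply/cvgrPdist_le => r r0; have [N hN] := hy r r0; exists N => // k /= Nk.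
  rewrite sub0r normrN ger0_norm ?rnorm_ge0//; have [h1 h2 _] := hp k.
  by apply: hN; [exact: leq_trans h1|exact: leq_trans h2].
- apply/integrableP; split; first exact: measurable_cst.
  rewrite integral_cst//= lte_mul_pinfty//.
- apply: aeW => y n _; rewrite abse_EFin lee_fin ger0_norm ?rnorm_ge0//.
  apply: (le_trans (rnormB _ _)); rewrite mulr_natl mulr2n lerD//; exact: quotient_bound.
rewrite integral0 => /fine_cvgP[_] /cvgrPdist_lt/(_ _ e0)[N _ hN].
have := hN N (leqnn N); rewrite /= sub0r normrN => h1.
have [_ _ h2] := hp N; have := le_lt_trans (ler_norm _) h1; rewrite -[X in X < _]/(Rintegral mu B (f N)).
by move=> h3; move: (lt_trans h2 h3); rewrite ltxx.
Qed.

End difference_quotients.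

Lemma radon_nikodym_quotients (R : realType) (E : completeNormedModType R[i]) (G : R -> E) (c : R) :
  radon_nikodym_property E -> 0 <= c ->
  (forall x y, rnorm (G y - G x) <= c * `|y - x|) ->
  forall A e : R, 0 < e -> exists N, forall n m, (N <= n)%N -> (N <= m)%N ->
    \int[@lebesgue_measure R]_(y in `[- A, A]) rnorm (quotient G n y - quotient G m y) <= e.
Proof.
move=> hRN c0 lipG A e e0.
have [T [hT TE]] := stieltjes_operator c0 lipG (@complete_rcomplete R E).
have [h [mh bh] hB] := hRN T hT.
have hG x y : x <= y -> is_bochner_integral (fun z => (\1_(`[x, y[ : set R) z)%:C *: h z) (G y - G x).
  move=> xy; rewrite -TE//; apply: hB; split; last exact: integrable0.
  exact: integrable_indic_itv.
exact: (quotient_L1_cauchy lipG mh bh hG A e0).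
Qed.

(** * The scalar multiplier *)

Section holomorphic_scalars.
Context (R : realType).
Implicit Types (phi psi : R[i]^o -> R[i]^o) (z : R[i]^o).

Definition hol phi z := exists l, cderiv phi z l.

Lemma hol_cst (a : R[i]^o) z : hol (fun=> a) z.
Proof. by exists 0; exact: cderiv_cst. Qed.

Lemma hol_id z : hol id z.
Proof. by exists 1; exact: cderiv_id. Qed.

Lemma holD phi psi z : hol phi z -> hol psi z -> hol (fun w => phi w + psi w) z.
Proof. by move=> [a ha] [b hb]; exists (a + b); exact: cderivD. Qed.

Lemma holM phi psi z : hol phi z -> hol psi z -> hol (fun w => phi w * psi w) z.
Proof. by move=> [a ha] [b hb]; eexists; exact: (cderivZ ha hb). Qed.

Lemma holV phi z : phi z != 0 -> hol phi z -> hol (fun w => (phi w)^-1) z.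
Proof. by move=> h [a ha]; eexists; exact: (cderivV h ha). Qed.

Lemma holX phi n z : hol phi z -> hol (fun w => phi w ^+ n) z.
Proof.
move=> h; elim: n => [|n IH]; first exact: hol_cst.
by under eq_fun do rewrite exprS; exact: holM.
Qed.

Lemma hol_sum (I : Type) (s : seq I) (phi : I -> R[i]^o -> R[i]^o) z :
  (forall i, hol (phi i) z) -> hol (fun w => \sum_(i <- s) phi i w) z.
Proof.
move=> h; elim: s => [|i s IH].
  by under eq_fun do rewrite big_nil; exact: hol_cst.
by under eq_fun do rewrite big_cons; exact: holD.
Qed.

End holomorphic_scalars.

Section riemann_sum.
Context (R : realType).
Let mu := @lebesgue_measure R.
Variables (b : R -> R) (L : R).
Hypothesis lipb : forall x y, `|b y - b x| <= L * `|y - x|.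

Let intb x y : mu.-integrable `[x, y] (EFin \o b).
Proof.
apply: continuous_compact_integrable; first exact: segment_compact.
exact/continuous_subspaceT/lipschitz_continuous.
Qed.

Let intb' x y : mu.-integrable `[x, y[ (EFin \o b).
Proof.
apply: integrableS (intb x y) => //.
by move=> z /=; rewrite !in_itv/= => /andP[-> /ltW ->].
Qed.

(** On a cell of length [d], the function varies by at most [L d]. *)
Lemma left_endpoint_sum (a d : R) n : 0 <= d -> 0 <= L ->
  \sum_(j < n) d * b (a + j%:R * d) <=
  \int[mu]_(y in `[a, (a + n%:R * d)]) b y + n%:R * (L * d ^+ 2).
Proof.
move=> d0 L0; rewrite -Rintegral_itv_bndo_bndc; last exact: intb'.
elim: n => [|n IH].
  by rewrite big_ord0 !mul0r !addr0 set_itvco0 Rintegral_set0.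
pose t j := a + j%:R * d.
have tS : t n.+1 = t n + d by rewrite /t -natr1 mulrDl mul1r addrA.
have t0 : a <= t n by rewrite lerDl mulr_ge0.
have tn : t n <= t n.+1 by rewrite tS lerDl.
have cat : \int[mu]_(y in `[a, t n.+1[) b y =
    \int[mu]_(y in `[a, t n[) b y + \int[mu]_(y in `[t n, t n.+1[) b y.
  rewrite -Rintegral_setU//.
  - by congr Rintegral; rewrite -itv_bndbnd_setU// ?bnd_simp.
  - rewrite -itv_bndbnd_setU ?bnd_simp//; exact: intb'.
  - apply/disj_setPS => x /= []; rewrite !in_itv/= => /andP[_ h1] /andP[h2 _].
    by move: (lt_le_trans h1 h2); rewrite ltxx.
rewrite big_ord_recr /= -/(t n) -/(t n.+1) cat.
have mI : measurable (`[t n, t n.+1[ : set R) by exact: measurable_itv.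
have last : d * b (t n) - L * d ^+ 2 <= \int[mu]_(y in `[t n, t n.+1[) b y.
  have muI : fine (mu [set` `[t n, t n.+1[]) = d.
    rewrite [X in fine X](_ : _ = lebesgue_measure [set` `[t n, t n.+1[])//.
    rewrite lebesgue_measure_itv /= lte_fin tS; case: ltP => /= h; first by rewrite addrAC subrr add0r.
    by move: h; rewrite gerDl => h; apply/eqP; rewrite eq_le d0 h.
  rewrite (_ : d * b (t n) - L * d ^+ 2 = (b (t n) - L * d) * d); last by ring.
  rewrite -{2}muI -Rintegral_cst//; apply: le_Rintegral => //.
    apply/integrableP; split; first exact: measurable_cst.
    rewrite integral_cst//= lte_mul_pinfty//.
    rewrite [X in (X < _)%E](_ : _ = lebesgue_measure [set` `[t n, t n.+1[])//.
    by rewrite lebesgue_measure_itv /=; case: ifP => _; rewrite ltry.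
  move=> y; rewrite /= in_itv /= tS => /andP[y1 y2].
  have := lipb (t n) y; rewrite (ger0_norm (_ : 0 <= y - t n)) ?subr_ge0// ler_norml => /andP[h1 _].
  have : L * (y - t n) <= L * d by rewrite ler_wpM2l//; lra.
  lra.
rewrite -[n.+1%:R]natr1 mulrDl mul1r.
by move: last; rewrite lerBlDr => /(lerD IH); rewrite addrACA.
Qed.

End riemann_sum.

Section multiplier.
Context (R : realType).
Let mu := @lebesgue_measure R.
Implicit Types (z w : R[i]^o) (x y : R).

Lemma ReD z w : complex.Re (z + w) = complex.Re z + complex.Re w.
Proof. by case: z; case: w. Qed.

Lemma Re_scaled_inv (k : R) z : complex.Re (k%:C / z) =
  k * (complex.Re z / (complex.Re z ^+ 2 + complex.Im z ^+ 2)).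
Proof. by case: z => a b /=; ring. Qed.

Lemma Re_sum (n : nat) (F : 'I_n -> R[i]^o) :
  complex.Re (\sum_(j < n) F j) = \sum_(j < n) complex.Re (F j).
Proof. by rewrite (big_morph (@complex.Re R) ReD (erefl : complex.Re (0 : R[i]^o) = 0)). Qed.

Lemma grid_cell (a d y : R) n : 0 <= d -> a <= y <= a + n.+1%:R * d ->
  exists j : 'I_n.+1, a + j%:R * d <= y <= a + j%:R * d + d.
Proof.
move=> d0; elim: n => [|n IH] h.
  by exists ord0; rewrite mul0r addr0; move: h; rewrite mul1r.
have [yn|yn] := leP y (a + n.+1%:R * d).
  have [|j hj] := IH; first by case/andP: h => -> _.
  by exists (widen_ord (leqnSn _) j).
exists ord_max => /=; rewrite (ltW yn) /=.
by case/andP: h => _; rewrite -[n.+2%:R]natr1 mulrDl mul1r addrA.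
Qed.

(** The factors of [m] are [((1 + theta)/(z + 1))^p] and [g theta / g z] with
[g = 1 + M H], where [H z] is the sum of the [d b(t_j)/(z + d - i t_j)] over a
grid of mesh [d] from [-N] to [N].  Its poles lie at distance [d] to the left of
the imaginary axis.  All terms have nonnegative real part, and the term of the
cell of [y] alone contributes at least [b(t_j)/2] at [iy]; at [theta] the sum
is at most the integral of [b], up to the mesh error, divided by [theta]. *)
Lemma multiplier (theta N M L : R) (b : R -> R) (p : nat) :
  0 < theta < 1 -> 0 < N -> 0 < M -> 0 <= L -> (forall y, 0 <= b y) ->
  (forall x y, `|b y - b x| <= L * `|y - x|) ->
  \int[mu]_(y in `[- N, N]) b y <= theta / (2 * M) ->
  exists m : R[i]^o -> R[i]^o, [/\ forall z, 0 <= complex.Re z -> hol m z,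
    m (pt theta 0) = 1,
    forall z, 0 <= complex.Re z -> rnorm (m z) <= 2 * ((1 + theta) / rnorm (z + 1)) ^+ p &
    forall y, `|y| <= N -> rnorm (m (pt 0 y)) * b y <= 2 ^+ p * 4 / M].
Proof.
move=> /andP[th0 th1] N0 M0 L0 b0 lipb intb.
(* The first bound keeps the error of the Riemann sum below theta/(2 M); the
   second one makes M b vary by at most 1 on a cell, which the summand 1 of g
   absorbs. *)
pose d0 := Num.min (theta / (4 * M * N * (L + 1))) (1 / (M * (L + 1))).
have L1 : 0 < L + 1 by rewrite ltr_wpDl.
have d00 : 0 < d0 by rewrite lt_min !divr_gt0// !mulr_gt0.
have [n hn] : exists n : nat, 2 * N / d0 < n.+1%:R.
  by exists (Num.truncn (2 * N / d0)); exact: truncnS_gt.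
pose d := 2 * N / n.+1%:R.
have d_gt0 : 0 < d by rewrite divr_gt0// mulr_gt0.
have nd : n.+1%:R * d = 2 * N by rewrite mulrC divfK// pnatr_eq0.
have dd0 : d <= d0 by rewrite /d ler_pdivrMr// [d0 * _]mulrC -ler_pdivrMr// ltW.
have dL1 : 2 * N * (L * d) <= theta / (2 * M).
  have : d <= theta / (4 * M * N * (L + 1)) by rewrite (le_trans dd0)// ge_min lexx.
  rewrite ler_pdivlMr ?mulr_gt0// => k; rewrite ler_pdivlMr ?mulr_gt0//.
  apply: le_trans k; rewrite (_ : d * _ = 2 * N * (L * d) * (2 * M) + d * (4 * M * N)); last by ring.
  by rewrite lerDl !mulr_ge0// ltW.
have dL2 : M * (L * d) <= 1.
  have : d <= 1 / (M * (L + 1)) by rewrite (le_trans dd0)// ge_min lexx orbT.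
  rewrite ler_pdivlMr ?mulr_gt0// => k; apply: le_trans k.
  rewrite (_ : d * _ = M * (L * d) + d * M); last by ring.
  by rewrite lerDl mulr_ge0// ltW.
pose t j := - N + j%:R * d.
pose c j := d * b (t j).
have c0 j : 0 <= c j by rewrite mulr_ge0// ltW.
have csum : \sum_(j < n.+1) c j <= theta / M.
  have := left_endpoint_sum lipb (- N) n.+1 (ltW d_gt0) L0.
  rewrite nd (_ : - N + 2 * N = N); last by ring.
  move=> /le_trans; apply.
  have -> : n.+1%:R * (L * d ^+ 2) = 2 * N * (L * d) by rewrite -nd; ring.
  rewrite (_ : theta / M = theta / (2 * M) + theta / (2 * M)); last by field; rewrite gt_eqF.
  exact: lerD.
pose den j z : R[i]^o := z + pt d (- t j).
have Re_den j z : complex.Re (den j z) = complex.Re z + d by rewrite ReD.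
have den0 j z : 0 <= complex.Re z -> den j z != 0.
  move=> z0; apply/eqP => /(congr1 (@complex.Re R)); rewrite Re_den /= => h.
  by move: d_gt0; lra.
pose H z : R[i]^o := \sum_(j < n.+1) (c j)%:C / den j z.
have Re_term j z : 0 <= complex.Re z -> 0 <= complex.Re ((c j)%:C / den j z).
  move=> z0; rewrite Re_scaled_inv mulr_ge0// divr_ge0 ?addr_ge0 ?sqr_ge0//.
  by rewrite Re_den addr_ge0// ltW.
have ReH z : 0 <= complex.Re z -> 0 <= complex.Re (H z).
  by move=> z0; rewrite /H Re_sum sumr_ge0// => j _; exact: Re_term.
have holH z : 0 <= complex.Re z -> hol H z.
  move=> z0; apply: hol_sum => j; apply: holM; first exact: hol_cst.
  by apply: holV; [exact: den0|apply: holD; [exact: hol_id|exact: hol_cst]].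
have Hth : M * rnorm (H (pt theta 0)) <= 1.
  have : rnorm (H (pt theta 0)) <= (\sum_(j < n.+1) c j) / theta.
    rewrite mulr_suml (le_trans (rnorm_sum _ _))//; apply: ler_sum => j _.
    rewrite rnormM rnorm_real ger0_norm// rnormV ler_wpM2l// lef_pV2 ?posrE//.
      have := Re_le (den j (pt theta 0)); rewrite Re_den /= ler_norml; lra.
    by rewrite rnorm_gt0 den0//= ltW.
  rewrite ler_pdivlMr// => h.
  have h2 := le_trans h csum; rewrite ler_pdivlMr// in h2.
  rewrite -(ler_pM2r th0) mul1r; apply: le_trans h2.
  by rewrite -[leLHS]mulrA [leLHS]mulrC.
pose g z : R[i]^o := 1 + M%:C * H z.
have Re_g z : complex.Re (g z) = 1 + M * complex.Re (H z).
  by rewrite /g; case: (H z) => a e /=; ring.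
have g1 z : 0 <= complex.Re z -> 1 + M * complex.Re (H z) <= rnorm (g z).
  by move=> z0; rewrite -Re_g (le_trans (ler_norm _))// Re_le.
have g1' z : 0 <= complex.Re z -> 1 <= rnorm (g z).
  by move=> z0; apply: le_trans (g1 z z0); rewrite lerDl mulr_ge0// ?(ltW M0)// ReH.
have gn0 z : 0 <= complex.Re z -> g z != 0.
  by move=> /g1' h; rewrite -rnorm_gt0 (lt_le_trans _ h).
have gth : rnorm (g (pt theta 0)) <= 2.
  apply: (le_trans (rnormD _ _)); rewrite rnorm1 rnormM rnorm_real (gtr0_norm M0); lra.
have z1 z : 0 <= complex.Re z -> z + 1 != 0.
  move=> z0; apply/eqP => /(congr1 (@complex.Re R)); rewrite ReD /= => h; lra.
pose m z : R[i]^o := ((1 + theta)%:C / (z + 1)) ^+ p * (g (pt theta 0) / g z).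
have nm z : 0 <= complex.Re z ->
    rnorm (m z) = ((1 + theta) / rnorm (z + 1)) ^+ p * (rnorm (g (pt theta 0)) / rnorm (g z)).
  move=> z0; rewrite /m rnormM rnormX !rnormM !rnormV rnorm_real ger0_norm//; lra.
have pos z : 0 <= ((1 + theta) / rnorm (z + 1)) ^+ p.
  by rewrite exprn_ge0// divr_ge0 ?rnorm_ge0//; lra.
exists m; split.
- move=> z z0; apply: holM.
    apply: holX; apply: holM; first exact: hol_cst.
    by apply: holV; [exact: z1|apply: holD; [exact: hol_id|exact: hol_cst]].
  apply: holM; first exact: hol_cst.
  apply: holV; first exact: gn0.
  by apply: holD; [exact: hol_cst|apply: holM; [exact: hol_cst|exact: holH]].
- rewrite /m divff ?gn0//=; last exact: ltW.
  rewrite (_ : pt theta 0 + 1 = (1 + theta)%:C); last first.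
    by apply/eqP; rewrite eq_complex /=; apply/andP; split; apply/eqP; ring.
  rewrite divff ?expr1n ?mulr1//.
  by apply/eqP => /(congr1 (@complex.Re R)) /= h; lra.
- move=> z z0; rewrite nm// mulrC ler_wpM2r// ler_pdivrMr; last first.
    by rewrite (lt_le_trans _ (g1' z z0)).
  by apply: (le_trans gth); rewrite ler_peMr// g1'.
- move=> y yN; have z0 : 0 <= complex.Re (pt 0 y : R[i]^o) by [].
  have [|j /andP[j1 j2]] := @grid_cell (- N) d y n (ltW d_gt0).
    by rewrite nd; move: yN; rewrite ler_norml; lra.
  rewrite -/(t j) in j1 j2.
  have HR : (b y - L * d) / 2 <= complex.Re (H (pt 0 y)).
    rewrite /H Re_sum (bigD1 j isT).
    have : c j * (d / (d ^+ 2 + (y - t j) ^+ 2)) <= complex.Re ((c j)%:C / den j (pt 0 y)).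
      by rewrite Re_scaled_inv Re_den /= add0r.
    have : 0 <= \sum_(i < n.+1 | i != j) complex.Re ((c i)%:C / den i (pt 0 y)).
      by apply: sumr_ge0 => i _; exact: Re_term.
    have : b (t j) / 2 <= c j * (d / (d ^+ 2 + (y - t j) ^+ 2)).
      have s0 : 0 < d ^+ 2 + (y - t j) ^+ 2 by rewrite ltr_pwDl ?sqr_ge0// exprn_gt0.
      rewrite mulrA ler_pdivlMr// /c.
      have : (y - t j) ^+ 2 <= d ^+ 2 by rewrite lerXn2r ?nnegrE//; lra.
      move=> /(ler_wpM2l (b0 (t j))); rewrite (_ : d * b (t j) * d = b (t j) * d ^+ 2); last by ring.
      lra.
    have := lipb (t j) y; rewrite ler_norml (ger0_norm (_ : 0 <= y - t j)) ?subr_ge0//.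
    have : L * (y - t j) <= L * d by rewrite ler_wpM2l//; lra.
    move=> k1 /andP[_ k2] k3 k4 k5.
    apply: (@le_trans _ _ (b (t j) / 2)); first by move: k1 k2; clear; lra.
    by apply: (le_trans k3); apply: (le_trans k5); rewrite lerDl.
  have gy : M * b y / 2 <= rnorm (g (pt 0 y)).
    apply: le_trans (g1 _ z0).
    have : M * ((b y - L * d) / 2) <= M * complex.Re (H (pt 0 y)) by rewrite ler_pM2l.
    lra.
  rewrite nm//.
  have r1 : ((1 + theta) / rnorm (pt 0 y + 1)) ^+ p <= 2 ^+ p.
    have ny : 1 <= rnorm (pt 0 y + 1 : R[i]^o).
      by have := Re_le (pt 0 y + 1 : R[i]^o); rewrite ReD /= add0r normr1.
    rewrite lerXn2r ?nnegrE//; first by rewrite divr_ge0 ?rnorm_ge0//; lra.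
    rewrite ler_pdivrMr; last by rewrite (lt_le_trans _ ny).
    lra.
  have gpos : 0 < rnorm (g (pt 0 y)) by rewrite (lt_le_trans _ (g1' _ z0)).
  have r2 : rnorm (g (pt theta 0)) / rnorm (g (pt 0 y)) * b y <= 4 / M.
    rewrite mulrAC ler_pdivrMr// mulrAC ler_pdivlMr//.
    have := ler_wpM2r (b0 y) gth; have := b0 y.
    move=> k1 k2; have := ler_wpM2r (ltW M0) k2; lra.
  rewrite -[leLHS]mulrA -[leRHS]mulrA; apply: ler_pM => //.
  by rewrite mulr_ge0// divr_ge0 ?rnorm_ge0.
Qed.

End multiplier.

(** * Corrections with small edge values *)

Section admissible.
Context (R : realType) (X : compatible_pair R).
Let mu := @lebesgue_measure R.
Implicit Types (u : R[i]^o -> Sigma X) (F : forall k : bool, R -> X k).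

(** The functions of the first space without the bounds, together with their edge
functions: keeping the latter as data makes sums and limits in [X k] direct. *)
Definition admissible u F : Prop :=
  [/\ strip_cont u, forall z, open_strip z -> exists l, cderiv u z l,
      forall k y, iota_ (F k y) = u (edge k y) & forall k, contR (F k)].

Definition vanishing u : Prop := forall e : R, 0 < e -> exists Y : R,
  forall z, strip z -> Y <= `|complex.Im z| -> rnorm (u z) <= e.

Definition linear_growth u (C : R) : Prop :=
  forall z, strip z -> rnorm (u z) <= C * (1 + `|complex.Im z|).

Lemma edge_strip k y : strip (@edge R k y).
Proof. by rewrite /strip /= ler0n lern1 leq_b1. Qed.

Lemma open_strip_strip (z : R[i]^o) : open_strip z -> strip z.
Proof. by rewrite /open_strip /strip /= => /andP[/ltW -> /ltW ->]. Qed.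

Lemma scale_close (E : normedModType R[i]) (a0 : R[i]^o) (x0 : E) (e : R) : 0 < e ->
  exists2 e1 : R, 0 < e1 & forall (a : R[i]^o) x, rnorm (a - a0) <= e1 -> rnorm (x - x0) <= e1 ->
    rnorm (a *: x - a0 *: x0) <= e.
Proof.
move=> e0; have p0 := rnorm_ge0 a0; have q0 := rnorm_ge0 x0.
pose D := rnorm a0 + rnorm x0 + 1; have D0 : 0 < D by rewrite /D; lra.
exists (Num.min 1 (e / D)); first by rewrite lt_min ltr01 divr_gt0.
move=> a x; rewrite !le_min => /andP[a1 a2] /andP[_ x2].
rewrite (_ : _ - _ = a *: (x - x0) + (a - a0) *: x0); last by linear_identity.
rewrite (le_trans (rnormD _ _))// !rnormZ.
have an : rnorm (a : R[i]) <= rnorm a0 + 1.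
  by have := @rnorm_distD R R[i]^o a a0; lra.
have h1 : rnorm (a : R[i]) * rnorm (x - x0) <= (rnorm a0 + 1) * (e / D).
  by rewrite ler_pM ?rnorm_ge0.
have h2 : rnorm (a - a0 : R[i]) * rnorm x0 <= e / D * rnorm x0 by rewrite ler_wpM2r.
apply: (le_trans (lerD h1 h2)).
rewrite (_ : _ + _ = e / D * D); first by rewrite divfK// gt_eqF.
by rewrite /D; ring.
Qed.

Lemma admissible_scale (m : R[i]^o -> R[i]^o) u F :
  (forall z, 0 <= complex.Re z -> hol m z) -> admissible u F ->
  admissible (fun z => m z *: u z) (fun k y => m (edge k y) *: F k y).
Proof.
move=> hm [cu du uF cF]; split.
- move=> z sz e e0; have [e1 e10 h1] := scale_close (m z) (u z) e0.
  have z0 : 0 <= complex.Re z by case/andP: sz.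
  have [l hl] := hm z z0; have [d1 d10 k1] := cderiv_cont hl e10.
  have [d2 d20 k2] := cu z sz e1 e10.
  exists (Num.min d1 d2); first by rewrite lt_min d10.
  by move=> w sw; rewrite lt_min => /andP[/k1 m1 /(k2 w sw) m2]; exact: h1.
- move=> z sz; have z0 : 0 <= complex.Re z by case/andP: (open_strip_strip sz).
  by have [l hl] := du z sz; have [l' hl'] := hm z z0; eexists; exact: (cderivZ hl' hl).
- by move=> k y; rewrite linearZ /= uF.
- move=> k y e e0; have [e1 e10 h1] := scale_close (m (edge k y)) (F k y) e0.
  have z0 : 0 <= complex.Re (edge k y : R[i]^o) by rewrite /= ler0n.
  have [l hl] := hm _ z0; have [d1 d10 k1] := cderiv_cont hl e10.
  have [d2 d20 k2] := cF k y e1 e10.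
  exists (Num.min d1 d2); first by rewrite lt_min d10.
  move=> y'; rewrite lt_min => /andP[yy1 yy2]; apply: h1; last exact: k2.
  apply: k1; rewrite [X in rnorm X](_ : _ = pt 0 (y' - y)); last first.
    by rewrite /edge -/(pt k%:R y') -/(pt k%:R y) ptB subrr.
  by rewrite (le_lt_trans (rnorm_pt_le _ _))// normr0 add0r.
Qed.

Lemma contRD (E : normedModType R[i]) (f g : R -> E) : contR f -> contR g ->
  contR (fun y => f y + g y).
Proof.
move=> hf hg x e e0; have e20 : 0 < e / 2 by lra.
have [d1 d10 k1] := hf x _ e20; have [d2 d20 k2] := hg x _ e20.
exists (Num.min d1 d2); first by rewrite lt_min d10.
move=> y; rewrite lt_min => /andP[/k1 h1 /k2 h2].
rewrite (_ : _ - _ = (f y - f x) + (g y - g x)); last by linear_identity.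
by rewrite (le_trans (rnormD _ _))//; lra.
Qed.

Lemma admissibleD u F u' F' : admissible u F -> admissible u' F' ->
  admissible (fun z => u z + u' z) (fun k y => F k y + F' k y).
Proof.
move=> [cu du uF cF] [cu' du' uF' cF']; split.
- move=> z sz e e0; have e20 : 0 < e / 2 by lra.
  have [d1 d10 k1] := cu z sz _ e20; have [d2 d20 k2] := cu' z sz _ e20.
  exists (Num.min d1 d2); first by rewrite lt_min d10.
  move=> w sw; rewrite lt_min => /andP[/(k1 w sw) h1 /(k2 w sw) h2].
  rewrite (_ : _ - _ = (u w - u z) + (u' w - u' z)); last by linear_identity.
  by rewrite (le_trans (rnormD _ _))//; lra.
- by move=> z sz; have [l h] := du z sz; have [l' h'] := du' z sz; exists (l + l'); exact: cderivD.
- by move=> k y; rewrite linearD /= uF uF'.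
- by move=> k; apply: contRD.
Qed.

Lemma admissible_maximum u F M : admissible u F -> vanishing u -> 0 <= M ->
  (forall k y, rnorm (F k y) <= M) -> forall z, strip z -> rnorm (u z) <= M.
Proof.
move=> [cu du uF cF] hv M0 hM [x y] sz; rewrite -/(pt x y) in sz *; rewrite -(clamp_id sz).
have hx : 0 <= x <= 1 := sz.
have eb (k : bool) y' : rnorm (u (clamp (pt k%:R y'))) <= M.
  have se : strip (pt k%:R y' : R[i]^o) := edge_strip k y'.
  rewrite (clamp_id se) -[pt _ _]/(edge k y') -uF.
  exact: le_trans (rnorm_iota _) (hM k y').
apply: (strip_maximum (f := fun z => u (clamp z)) (@sigma_rcomplete R X) (clamp_entire cu)) => //.
- move=> x' y' hx'; have so : open_strip (pt x' y' : R[i]^o) := hx'.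
  have [l hl] := du _ so; exists l; exact: (iffLR (clamp_cderiv u l so) hl).
- by move=> y'; exact: (eb false).
- by move=> y'; exact: (eb true).
- move=> e /hv[Y hY]; exists Y => x' y' hx' hy'; apply: hY; first exact: clamp_strip.
  by [].
Qed.

(** Far out on both edges and on the whole edge over 1, the power [p >= 2] in the
multiplier beats the bound [B]; for [|y| <= N] over 0 the second
factor beats the size of [u] itself.  With [p >= 2] the product also vanishes at
infinity in spite of the linear growth of [u], as the maximum principle
requires. *)
Lemma correction (theta B e : R) : 0 < theta < 1 -> 0 <= B -> 0 < e ->
  exists N d : R, 0 < d /\ forall u F L C,
    admissible u F -> linear_growth u C -> (forall k y, rnorm (F k y) <= B) ->
    0 <= L -> (forall x y, rnorm (F false y - F false x) <= L * `|y - x|) ->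
    \int[mu]_(y in `[- N, N]) rnorm (F false y) <= d ->
    exists w W, [/\ admissible w W, vanishing w, w (pt theta 0) = u (pt theta 0) &
      forall k y, rnorm (W k y) <= e].
Proof.
move=> th B0 e0; have /andP[th0 th1] := th.
have [p [p2 hp]] : exists p, (2 <= p)%N /\ 2 * B * ((1 + theta) / 2) ^+ p <= e.
  pose r := (1 + theta) / 2; have r0 : 0 <= r by rewrite /r; lra.
  have r1 : r < 1 by rewrite /r; lra.
  have /cvgrPdist_le hr : r ^+ n @[n --> \oo] --> (0 : R) by apply: cvg_expr; rewrite ger0_norm.
  have B1 : 0 < 2 * B + 1 by lra.
  have [n0 _ hn] := hr _ (divr_gt0 e0 B1).
  exists (maxn 2 n0); rewrite leq_maxl; split => //.
  have := hn _ (leq_maxr 2 n0); rewrite /= sub0r normrN ger0_norm ?exprn_ge0// => k.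
  apply: (le_trans (ler_wpM2l _ k)); first lra.
  rewrite (_ : 2 * B * (e / (2 * B + 1)) = e * (2 * B / (2 * B + 1))); last by ring.
  by rewrite ger_pMr// ler_pdivrMr//; lra.
(* For |y| >= N, the multiplier times B is at most 4 B / N <= e; M is chosen so that the bound on [-N, N] equals e. *)
pose N := 2 + 4 * B / e; have N0 : 2 <= N by rewrite lerDl divr_ge0 ?(ltW e0)//; lra.
pose M := 2 ^+ p * 4 / e; have M0 : 0 < M by rewrite divr_gt0// mulr_gt0// exprn_gt0.
exists N, (theta / (2 * M)); split; first by rewrite divr_gt0// mulr_gt0.
move=> u F L C au gu FB L0 lipF intF.
have lipb x y : `|rnorm (F false y) - rnorm (F false x)| <= L * `|y - x|.
  by apply: (le_trans (rnorm_dist_abs _ _)); exact: lipF.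
have [|m [hm mth m1 m2]] := multiplier p th _ M0 L0 (fun y => rnorm_ge0 (F false y)) lipb intF.
  by lra.
exists (fun z => m z *: u z), (fun k y => m (edge k y) *: F k y); split.
- exact: admissible_scale.
- move=> k k0; exists (2 + 16 * `|C| / k) => z sz hY.
  have z0 : 0 <= complex.Re z by case/andP: sz.
  have C0 := normr_ge0 C; have Ck : 0 <= 16 * `|C| / k by rewrite divr_ge0 ?(ltW k0)//; lra.
  set y := `|complex.Im z| in hY; have y2 : 2 <= y by lra.
  have zy : y <= rnorm (z + 1).
    by have := Im_le (z + 1); rewrite (_ : complex.Im (z + 1) = complex.Im z)//; case: (z) => a b /=; rewrite addr0.
  have mz : rnorm (m z) <= 2 * (2 / y) ^+ 2.
    apply: (le_trans (m1 z z0)); rewrite ler_pM2l//.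
    have a0 : 0 <= (1 + theta) / rnorm (z + 1) by rewrite divr_ge0 ?rnorm_ge0//; lra.
    have a1 : (1 + theta) / rnorm (z + 1) <= 2 / y.
      rewrite ler_pdivrMr; last lra.
      rewrite mulrAC ler_pdivlMr; last lra.
      rewrite ler_pM//; lra.
    have y1 : 2 / y <= 1 by rewrite ler_pdivrMr; lra.
    apply: (@le_trans _ _ ((2 / y) ^+ p)); first by rewrite lerXn2r ?nnegrE// divr_ge0//; lra.
    by rewrite ler_wiXn2l// divr_ge0//; lra.
  rewrite rnormZ; have gz := gu z sz; rewrite -/y in gz.
  have gz' : rnorm (u z) <= `|C| * (2 * y).
    apply: (le_trans gz); apply: (@le_trans _ _ (`|C| * (1 + y))).
      by rewrite ler_wpM2r ?ler_norm//; lra.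
    by rewrite ler_wpM2l//; lra.
  apply: (@le_trans _ _ (2 * (2 / y) ^+ 2 * (`|C| * (2 * y)))).
    by apply: ler_pM; rewrite ?rnorm_ge0.
  have fe (r q : R) : 0 < r -> 2 * (2 / r) ^+ 2 * (q * (2 * r)) = 16 * q / r.
    by move=> r0; field; rewrite gt_eqF.
  rewrite fe; last lra.
  rewrite ler_pdivrMr; last lra.
  rewrite [k * _]mulrC -ler_pdivrMr//; lra.
- by rewrite mth scale1r.
- case=> y; rewrite rnormZ.
    have z0 : 0 <= complex.Re (edge true y : R[i]^o) by rewrite /= ler0n.
    apply: (@le_trans _ _ (2 * ((1 + theta) / 2) ^+ p * B)); last by rewrite mulrAC.
    apply: ler_pM; [exact: rnorm_ge0|exact: rnorm_ge0| |exact: FB].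
    apply: (le_trans (m1 _ z0)); rewrite ler_pM2l//.
    have n2 : 2 <= rnorm (edge true y + 1).
      by have := Re_le (edge true y + 1); rewrite ReD /= ger0_norm//; lra.
    rewrite lerXn2r ?nnegrE ?divr_ge0 ?rnorm_ge0//; try lra.
    by rewrite ler_pM2l ?lef_pV2 ?posrE//; lra.
  have z0 : 0 <= complex.Re (edge false y : R[i]^o) by rewrite /= ler0n.
  have [yN|/ltW yN] := leP `|y| N.
    have := m2 y yN; rewrite -[pt 0 y]/(edge false y) => /le_trans; apply.
    by rewrite /M invf_div mulrCA divff ?mulr1// gt_eqF// mulr_gt0// exprn_gt0.
  apply: (@le_trans _ _ (2 * (2 / N) * B)).
    apply: ler_pM; [exact: rnorm_ge0|exact: rnorm_ge0| |exact: FB].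
    apply: (le_trans (m1 _ z0)); rewrite ler_pM2l//.
    have nN : N <= rnorm (edge false y + 1).
      have := Im_le (edge false y + 1); rewrite (_ : complex.Im (edge false y + 1) = y); last by rewrite /= addr0.
      lra.
    have a0 : 0 <= (1 + theta) / rnorm (edge false y + 1) by rewrite divr_ge0 ?rnorm_ge0//; lra.
    have a1 : (1 + theta) / rnorm (edge false y + 1) <= 2 / N.
      rewrite ler_pdivrMr; last lra.
      rewrite mulrAC ler_pdivlMr; last lra.
      rewrite ler_pM//; lra.
    have y1 : 2 / N <= 1 by rewrite ler_pdivrMr; lra.
    apply: (@le_trans _ _ ((2 / N) ^+ p)); first by rewrite lerXn2r ?nnegrE// divr_ge0//; lra.
    rewrite -[leRHS]expr1 ler_wiXn2l//; first by rewrite divr_ge0//; lra.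
    exact: leq_trans p2.
  rewrite (_ : 2 * (2 / N) * B = 4 * B / N); last by field; lra.
  rewrite ler_pdivrMr; last lra.
  rewrite /N mulrDr [e * (_ / _)]mulrC divfK ?gt_eqF// lerDr mulr_ge0//; lra.
Qed.

End admissible.

(** * Vertical difference quotients *)

Section vertical_quotients.
Context (R : realType) (X : compatible_pair R).
Implicit Types (u g f : R[i]^o -> Sigma X) (F : forall k : bool, R -> X k).

Lemma contR_continuous (E : normedModType R[i]) (F : R -> E) : contR F -> continuous F.
Proof.
move=> h x; apply/(@cvgrPdist_le _ _ _ (nbhs x) (nbhs_filter x)) => e /pos_ReC[ee /(h x)[d d0 hd]].
apply/nbhs_normP; exists d => // y /= yx; rewrite -ee norm_leC rnorm_distC.
by apply: hd; rewrite distrC.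
Qed.

Lemma lipschitz_contR (E : normedModType R[i]) (F : R -> E) (L : R) : 0 <= L ->
  (forall x y, rnorm (F y - F x) <= L * `|y - x|) -> contR F.
Proof.
move=> L0 h x e e0; have L1 : 0 < L + 1 by rewrite ltr_wpDl.
exists (e / (L + 1)); first by rewrite divr_gt0.
move=> y; rewrite ltr_pdivlMr// => /ltW k; apply: (le_trans _ k); apply: (le_trans (h x y)).
by rewrite mulrC ler_wpM2l// lerDl.
Qed.

Definition step n : R[i]^o := pt 0 n.+1%:R^-1.

Definition vertical_quotient g n (z : R[i]^o) : Sigma X :=
  (- 'i * n.+1%:R%:C) *: (g (z + step n) - g z).

Lemma step_strip n (z : R[i]^o) : strip z -> strip (z + step n).
Proof. by rewrite /strip /= ReD addr0. Qed.

Lemma vertical_quotient_cvg g z l : cderiv g z l -> forall e : R, 0 < e ->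
  exists N, forall n, (N <= n)%N -> rnorm (vertical_quotient g n z - l) <= e.
Proof.
move=> hl e e0; have [d d0 hd] := hl e e0.
have [N hN] : exists N : nat, d^-1 < N%:R.
  by exists (Num.truncn d^-1).+1; exact: truncnS_gt.
exists N => n Nn; have n0 : 0 < n.+1%:R :> R by [].
have nstep : rnorm (step n : R[i]^o) = n.+1%:R^-1.
  by rewrite rnormE_sqrt /= expr0n add0r sqrtr_sqr ger0_norm.
have zs : z + step n - z = step n by rewrite addrAC subrr add0r.
have := hd (z + step n); rewrite zs nstep => h.
have {}h : rnorm (g (z + step n) - g z - step n *: l) <= e * n.+1%:R^-1.
  apply: h; rewrite invf_plt ?posrE//; apply: (lt_le_trans hN).
  by rewrite ler_nat leqW.
have is1 : (- 'i * n.+1%:R%:C) * step n = 1 :> R[i].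
  rewrite /step; apply/eqP; rewrite eq_complex /=; apply/andP; split; apply/eqP; last by ring.
  by field; rewrite addrC natr1 pnatr_eq0.
have -> : vertical_quotient g n z - l =
    (- 'i * n.+1%:R%:C) *: (g (z + step n) - g z - step n *: l).
  by rewrite [RHS]scalerBr scalerA is1 scale1r.
have ni : rnorm (- 'i * n.+1%:R%:C : R[i]) = n.+1%:R.
  have := @rnormM R (- 'i) (n.+1%:R%:C); rewrite rnormN rnormi mul1r rnorm_real ger0_norm//.
by rewrite rnormZ ni mulrC -ler_pdivlMr.
Qed.

Lemma compact_strip_bound g : strip_cont g -> forall Y : R, exists M : R,
  forall z, strip z -> `|complex.Im z| <= Y -> rnorm (g z) <= M.
Proof.
move=> cg Y; have [Y0|Y0] := leP 0 Y; last first.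
  by exists 0 => z _ h; move: (le_lt_trans h Y0); rewrite ltNge normr_ge0.
have [||M hM] := @rect_bounded R (Sigma X) (fun z => g (clamp z)) 0 1 (- Y) Y (clamp_entire cg).
- exact: ler01.
- lra.
exists M => -[x y] sz; rewrite -/(pt x y) /= ler_norml => hy.
have := hM x y sz hy; rewrite clamp_id//.
Qed.

Lemma calderon_B_growth g : calderon_B g -> exists C : R, linear_growth g C.
Proof.
move=> [/strip_contP cg _ [C [M hCM]] _].
have [M' hM'] := compact_strip_bound cg M; exists (`|C| + `|M'|) => z sz.
have y0 := normr_ge0 (complex.Im z); have C0 := normr_ge0 C; have M0 := normr_ge0 M'.
have [h|/ltW h] := leP M `|complex.Im z|.
  apply: (le_trans (hCM z sz h)).
  have : C * `|complex.Im z| <= `|C| * `|complex.Im z| by rewrite ler_wpM2r ?ler_norm.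
  have : 0 <= `|M'| * `|complex.Im z| by rewrite mulr_ge0.
  lra.
apply: (le_trans (hM' z sz h)); apply: (le_trans (ler_norm M')).
have : 0 <= `|M'| * `|complex.Im z| by rewrite mulr_ge0.
have : 0 <= `|C| * `|complex.Im z| by rewrite mulr_ge0.
lra.
Qed.

Lemma vertical_quotient_growth g C n : linear_growth g C ->
  exists C', linear_growth (vertical_quotient g n) C'.
Proof.
move=> hC; exists (n.+1%:R * (`|C| * 3)) => z sz.
rewrite /vertical_quotient rnormZ.
have ni : rnorm (- 'i * n.+1%:R%:C : R[i]) = n.+1%:R.
  have := @rnormM R (- 'i) (n.+1%:R%:C); rewrite rnormN rnormi mul1r rnorm_real ger0_norm//.
rewrite ni -mulrA ler_wpM2l//.
have h1 := hC z sz; have h2 := hC _ (step_strip n sz).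
have i1 : n.+1%:R^-1 <= 1 :> R by rewrite invf_le1// ler1n.
have ImE : `|complex.Im (z + step n)| <= `|complex.Im z| + 1.
  have -> : complex.Im (z + step n) = complex.Im z + n.+1%:R^-1 by case: (z).
  by rewrite (le_trans (ler_normD _ _))// lerD2l ger0_norm.
have y0 := normr_ge0 (complex.Im z); have C0 := normr_ge0 C.
have k1 : C * (1 + `|complex.Im z|) <= `|C| * (1 + `|complex.Im z|).
  by rewrite ler_wpM2r ?ler_norm// addr_ge0.
have k2 : C * (1 + `|complex.Im (z + step n)|) <= `|C| * (1 + (`|complex.Im z| + 1)).
  apply: (@le_trans _ _ (`|C| * (1 + `|complex.Im (z + step n)|))).
    by rewrite ler_wpM2r ?ler_norm// addr_ge0.
  by rewrite ler_wpM2l// lerD2l.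
have k3 : 0 <= `|C| * `|complex.Im z| by rewrite mulr_ge0.
apply: (le_trans (rnormB _ _)); move: h1 h2 k1 k2 k3; clear; lra.
Qed.

(** The differences [g(k + iy) - g(k)] lie in [X k], although [g(k)] may not. *)
Lemma edge_increment g c : edge_lipschitz g c -> exists G : forall k : bool, R -> X k,
  [/\ forall k y, iota_ (G k y) = g (edge k y) - g (edge k 0) &
      forall k x y, rnorm (G k y - G k x) <= c * `|y - x|].
Proof.
move=> hc.
have ex k y : exists x : X k, iota_ x = g (edge k y) - g (edge k 0).
  have [x [hx _]] := hc k 0 y; exists x; apply: val_inj; rewrite val_iota hx add0r //.
have G0 k : exists Gk : R -> X k, forall y, iota_ (Gk y) = g (edge k y) - g (edge k 0).
  by have /choice[Gk hG] := ex k; exists Gk.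
have [Gf hGf] := G0 false; have [Gt hGt] := G0 true.
exists (fun k => if k as k0 return R -> X k0 then Gt else Gf); split; first by case.
move=> k x y; have [v [hv nv]] := hc k x (y - x); rewrite addrCA subrr addr0 in hv nv.
suff -> : (if k as k0 return R -> X k0 then Gt else Gf) y -
  (if k as k0 return R -> X k0 then Gt else Gf) x = v by [].
apply: (@iota_inj R X k); rewrite linearB /=.
have -> : iota_ v = g (edge k y) - g (edge k x) by apply: val_inj; rewrite val_iota hv.
by case: k {v hv nv}; rewrite ?hGt ?hGf; linear_identity.
Qed.

Lemma vertical_quotient_admissible g (G : forall k : bool, R -> X k) c n :
  calderon_B g -> 0 <= c ->
  (forall k y, iota_ (G k y) = g (edge k y) - g (edge k 0)) ->
  (forall k x y, rnorm (G k y - G k x) <= c * `|y - x|) ->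
  admissible (vertical_quotient g n) (fun k y => - 'i *: quotient (G k) n y).
Proof.
move=> [/strip_contP cg dg _ _] c0 hG lipG; split.
- move=> z sz e e0; have n0 : 0 < n.+1%:R :> R by [].
  have e20 : 0 < e / n.+1%:R / 2 by rewrite !divr_gt0.
  have [d1 d10 h1] := cg z sz _ e20.
  have [d2 d20 h2] := cg _ (step_strip n sz) _ e20.
  exists (Num.min d1 d2); first by rewrite lt_min d10.
  move=> w sw; rewrite lt_min => /andP[/(h1 w sw) k1 w2].
  have k2 : rnorm (g (w + step n) - g (z + step n)) <= e / n.+1%:R / 2.
    by apply: h2; [exact: step_strip|rewrite opprD addrACA subrr addr0].
  rewrite /vertical_quotient -scalerBr rnormZ.
  have ni : rnorm (- 'i * n.+1%:R%:C : R[i]) = n.+1%:R.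
    have := @rnormM R (- 'i) (n.+1%:R%:C); rewrite rnormN rnormi mul1r rnorm_real ger0_norm//.
  rewrite ni mulrC -ler_pdivlMr//.
  rewrite (_ : _ - _ = (g (w + step n) - g (z + step n)) - (g w - g z)); last by linear_identity.
  by apply: (le_trans (rnormB _ _)); rewrite [leRHS]splitr lerD.
- move=> z sz; have sz' : open_strip (z + step n) by move: sz; rewrite /open_strip /= ReD addr0.
  have h1 := derivable_cderiv (dg z sz); have h2 := derivable_cderiv (dg _ sz').
  have h3 : cderiv (fun w => g (w + step n)) z ((1 + 0) *: 'D_1 g (z + step n)).
    apply: (@cderiv_comp _ _ g (fun w => w + step n)) h2.
    exact: cderivD (cderiv_id z) (cderiv_cst (step n) z).
  have h4 := cderivB h3 h1.
  eexists; apply: (cderivZ (cderiv_cst (- 'i * n.+1%:R%:C : R[i]^o) z) h4).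
- move=> k y; rewrite linearZ /= /quotient linearZ /= linearB /= !hG.
  rewrite /vertical_quotient scalerA; congr (_ *: _).
  rewrite (_ : edge k y + step n = edge k (y + n.+1%:R^-1)); first by linear_identity.
  by rewrite /edge /step -/(pt _ _) -/(pt _ _) ptD addr0.
- move=> k; apply: (@lipschitz_contR _ _ (2 * c * n.+1%:R)); first by rewrite !mulr_ge0.
  move=> x y; rewrite -scalerBr rnormZ.
  have ni : rnorm (- 'i : R[i]) = 1 := etrans (rnormN ('i : R[i]^o)) (rnormi R).
  by rewrite ni mul1r; exact: (quotient_lipschitz (lipG k)).
Qed.

End vertical_quotients.

(** * Limits and series of admissible functions *)

Section series.
Context (R : realType) (X : compatible_pair R).
Implicit Types (u g f : R[i]^o -> Sigma X) (F : forall k : bool, R -> X k).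

Lemma open_strip_ball (z : R[i]^o) : open_strip z -> exists2 d : R, 0 < d & forall w,
  rnorm (w - z) < d -> open_strip w.
Proof.
move=> /andP[z0 z1]; exists (Num.min (complex.Re z) (1 - complex.Re z)).
  by rewrite lt_min z0 subr_gt0.
move=> w; rewrite lt_min => /andP[h1 h2].
have := Re_le (w - z); rewrite ReD (_ : complex.Re (- z) = - complex.Re z); last by case: (z).
by rewrite ler_norml /open_strip /= => /andP[h3 h4]; apply/andP; split; lra.
Qed.

Lemma admissible_limit (u : nat -> R[i]^o -> Sigma X) (U : nat -> forall k : bool, R -> X k) f F :
  (forall n, admissible (u n) (U n)) ->
  (forall e : R, 0 < e -> exists N, forall n, (N <= n)%N ->
     (forall z, strip z -> rnorm (u n z - f z) <= e) /\
     (forall k y, rnorm (U n k y - F k y) <= e)) ->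
  admissible f F.
Proof.
move=> au hu; split.
- move=> z sz e e0; have e30 : 0 < e / 3 by lra.
  have [N /(_ N (leqnn N))[hN _]] := hu _ e30.
  have [cN _ _ _] := au N; have [d d0 hd] := cN z sz _ e30.
  exists d => // w sw wz; have h1 := hN z sz; have h2 := hN w sw; have h3 := hd w sw wz.
  rewrite (_ : f w - f z = (u N w - u N z) - (u N w - f w) + (u N z - f z)); last by linear_identity.
  apply: (le_trans (rnormD _ _)); have := rnormB (u N w - u N z) (u N w - f w); lra.
- move=> z sz; have [d d0 hd] := open_strip_ball sz.
  have [//|n w wz|e /hu[N hN]|l hl] := @weierstrass R (Sigma X) (@sigma_rcomplete R X)
    (fun n w => u n (clamp w)) (fun w => f (clamp w)) z d _ d0.
  + by move=> n; apply: clamp_entire; case: (au n).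
  + have sw : open_strip w by exact: hd.
    by have [_ /(_ w sw)[l hl] _ _] := au n; exists l; exact: (iffLR (clamp_cderiv (u n) l sw) hl).
  + by exists N => n /hN[h _] w _; apply: h; exact: clamp_strip.
  + by exists l; exact: (iffRL (clamp_cderiv f l sz)).
- move=> k y; apply/eqP; rewrite -subr_eq0; apply/eqP; apply: rnorm_le_eps => e e0.
  have e20 : 0 < e / 2 by lra.
  have [N /(_ N (leqnn N))[h1 h2]] := hu _ e20; have [_ _ uN _] := au N.
  have k1 := h1 _ (edge_strip k y); have k2 := le_trans (rnorm_iota _) (h2 k y).
  rewrite linearB /= uN in k2.
  have := rnorm_dist (u N (edge k y)) (iota_ (F k y)) (f (edge k y)).
  by rewrite [rnorm (iota_ _ - u _ _)]rnorm_distC; lra.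
- move=> k y e e0; have e30 : 0 < e / 3 by lra.
  have [N /(_ N (leqnn N))[_ hN]] := hu _ e30.
  have [_ _ _ cN] := au N; have [d d0 hd] := cN k y _ e30.
  exists d => // w wz; have h1 := hN k y; have h2 := hN k w; have h3 := hd w wz.
  rewrite (_ : F k w - F k y = (U N k w - U N k y) - (U N k w - F k w) + (U N k y - F k y)); last by linear_identity.
  apply: (le_trans (rnormD _ _)); have := rnormB (U N k w - U N k y) (U N k w - F k w); lra.
Qed.

Lemma admissible0 : admissible (fun=> 0 : Sigma X) (fun k _ => 0 : X k).
Proof.
split.
- by move=> z _ e e0; exists 1 => // w _ _; rewrite subrr rnorm0 ltW.
- by move=> z _; exists 0; exact: cderiv_cst.
- by move=> k y; rewrite linear0.
- by move=> k x e e0; exists 1 => // y _; rewrite subrr rnorm0 ltW.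
Qed.

Lemma admissible_ext u F u' F' : (forall z, u' z = u z) -> (forall k y, F' k y = F k y) ->
  admissible u F -> admissible u' F'.
Proof.
move=> /funext -> hF; have -> // : F' = F.
by apply: functional_extensionality_dep => k; apply/funext => y.
Qed.

Lemma admissible_series (w : nat -> R[i]^o -> Sigma X) (W : nat -> forall k : bool, R -> X k) (K : R) :
  (forall j, admissible (w j) (W j)) ->
  (forall j z, strip z -> rnorm (w j z) <= K / 2 ^+ j) ->
  (forall j k y, rnorm (W j k y) <= K / 2 ^+ j) ->
  exists f F, [/\ admissible f F,
    forall n z, strip z -> rnorm (\sum_(j < n) w j z - f z) <= 2 * K / 2 ^+ n &
    forall n k y, rnorm (\sum_(j < n) W j k y - F k y) <= 2 * K / 2 ^+ n].
Proof.
move=> aw hw hW.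
have /choice[f hf] z : exists l, forall n, rnorm (\sum_(j < n) w j (clamp z) - l) <= 2 * K / 2 ^+ n.
  exact: (geometric_series (@sigma_rcomplete R X) (fun j => hw j _ (clamp_strip z))).
have hk k : exists F : R -> X k, forall y n, rnorm (\sum_(j < n) W j k y - F y) <= 2 * K / 2 ^+ n.
  have /choice[Fk hFk] y := geometric_series (@complete_rcomplete R _) (fun j => hW j k y).
  by exists Fk.
have [F hF] : exists F : forall k, R -> X k,
    forall k y n, rnorm (\sum_(j < n) W j k y - F k y) <= 2 * K / 2 ^+ n.
  have [Gf hGf] := hk false; have [Gt hGt] := hk true.
  by exists (fun k => if k as k0 return R -> X k0 then Gt else Gf); case.
have fs n z : strip z -> rnorm (\sum_(j < n) w j z - f z) <= 2 * K / 2 ^+ n.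
  by move=> sz; have := hf z n; rewrite clamp_id.
exists f, F; split => //.
apply: (@admissible_limit (fun n z => \sum_(j < n) w j z) (fun n k y => \sum_(j < n) W j k y)).
  elim=> [|n IH].
    by apply: admissible_ext admissible0 => *; rewrite big_ord0.
  by apply: admissible_ext (admissibleD IH (aw n)) => *; rewrite big_ord_recr.
move=> e /(exp2_small (2 * K))[N hN]; exists N => n /hN h; split.
  by move=> z sz; exact: le_trans (fs n z sz) h.
by move=> k y; exact: le_trans (hF k y n) h.
Qed.

Lemma admissible_calderon_A f F (M M' : R) : admissible f F ->
  (forall z, strip z -> rnorm (f z) <= M') -> (forall k y, rnorm (F k y) <= M) ->
  calderon_A f /\ calderon_A_norm f <= M.
Proof.
move=> [cf df fF cF] hM' hM.
have fE k y : embed X k (F k y) = val (f (edge k y)) by rewrite -fF val_iota.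
split; last first.
  by rewrite ge_max; apply/andP; split; [apply: (edge_sup_le (fE false))|apply: (edge_sup_le (fE true))].
split.
- exact: (iffRL (strip_contP f)).
- by exists M'.
- by move=> z /df[l hl]; have [] := cderiv_derivable hl.
- move=> k; exists (F k); split; [exact: fE|exact: contR_continuous|by exists M => y; exact: hM].
Qed.

(** The factor [(theta + s)/(z + s)] has modulus at most [(theta + s)/s] on the
strip, close to 1 for large [s], and compensates for linear growth. *)
Lemma damping u F (C c e theta : R) : 0 < theta < 1 -> 0 <= c -> 0 < e ->
  admissible u F -> linear_growth u C -> (forall k y, rnorm (F k y) <= c) ->
  exists w W M, [/\ admissible w W, forall z, strip z -> rnorm (w z) <= M,
    w (pt theta 0) = u (pt theta 0) & forall k y, rnorm (W k y) <= c + e].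
Proof.
move=> th c0 e0 au gu Fc; have /andP[th0 th1] := th.
(* The condition c theta / s <= e is what the edge bound requires. *)
pose s := c / e + 1; have s1 : 1 <= s by rewrite /s lerDr divr_ge0// ltW.
have s0 : 0 < s by lra.
pose m (z : R[i]^o) : R[i]^o := (theta + s)%:C * (z + s%:C)^-1.
have far z : 0 <= complex.Re z -> s <= rnorm (z + s%:C : R[i]^o).
  move=> z0; apply: le_trans (Re_le _); rewrite ReD /= ger0_norm; lra.
have mE z : rnorm (m z) = (theta + s) / rnorm (z + s%:C : R[i]^o).
  by rewrite /m rnormM rnormV rnorm_real ger0_norm//; lra.
exists (fun z => m z *: u z), (fun k y => m (edge k y) *: F k y), (2 * `|C| * (theta + s)); split.
- apply: admissible_scale => // z /far hz; rewrite /m; apply: holM; first exact: hol_cst.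
  apply: holV; first by rewrite -rnorm_gt0; lra.
  by apply: holD; [exact: hol_id|exact: hol_cst].
- move=> z sz; have z0 : 0 <= complex.Re z by case/andP: sz.
  have hz := far z z0; rewrite rnormZ mE; have gz := gu z sz.
  have C0 := normr_ge0 C; have y0 := normr_ge0 (complex.Im z).
  have zy : `|complex.Im z| <= rnorm (z + s%:C : R[i]^o).
    apply: le_trans (Im_le _); rewrite (_ : complex.Im (z + s%:C) = complex.Im z)//.
    by case: (z) => a b /=; rewrite addr0.
  have gz' : rnorm (u z) <= `|C| * (2 * rnorm (z + s%:C : R[i]^o)).
    apply: (le_trans gz); apply: (@le_trans _ _ (`|C| * (1 + `|complex.Im z|))).
      by rewrite ler_wpM2r ?ler_norm//; lra.
    by rewrite ler_wpM2l//; lra.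
  have z1 : 0 < rnorm (z + s%:C : R[i]^o) by lra.
  apply: (le_trans (ler_wpM2l _ gz')); first by rewrite divr_ge0//; lra.
  have fe (t r q : R) : 0 < r -> t / r * (q * (2 * r)) = 2 * q * t.
    by move=> r0; field; rewrite gt_eqF.
  by rewrite fe.
- rewrite (_ : m _ = 1) ?scale1r// /m.
  rewrite (_ : pt theta 0 + s%:C = (theta + s)%:C); last first.
    by rewrite /pt -[s%:C]/(pt s 0) -/(pt theta 0) ptD addr0.
  by apply: (@divff R[i]); rewrite eq_complex /= eqxx andbT gt_eqF//; lra.
- move=> k y; have z0 : 0 <= complex.Re (edge k y : R[i]^o) by rewrite /= ler0n.
  have hz := far _ z0; rewrite rnormZ mE.
  apply: (@le_trans _ _ ((theta + s) / s * c)).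
    apply: ler_pM; [|exact: rnorm_ge0| |exact: Fc].
      by rewrite divr_ge0 ?rnorm_ge0//; lra.
    by rewrite ler_pM2l ?lef_pV2 ?posrE//; lra.
  rewrite mulrAC ler_pdivrMr//.
  have se : s * e = c + e by rewrite /s mulrDl divfK ?gt_eqF// mul1r.
  have h : (c + e) * s - (theta + s) * c = s * e - c * theta by ring.
  have : c * theta <= c by rewrite ler_piMr//; lra.
  by move: h se; clear -e0; lra.
Qed.

End series.

(** * From the second space to the first *)

Section second_into_first.
Context (R : realType) (X : compatible_pair R).
Implicit Types (u g f : R[i]^o -> Sigma X) (F : forall k : bool, R -> X k).

(** The Radon-Nikodym property makes differences of quotients over 0 small in the
mean, which is the hypothesis of [correction]; the maximum principle then bounds
the corrected difference on the strip. *)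
Lemma vertical_quotients_cauchy g (G : forall k : bool, R -> X k) (c theta e : R) :
  0 < theta < 1 -> radon_nikodym_property (X false) -> calderon_B g -> 0 <= c ->
  (forall k y, iota_ (G k y) = g (edge k y) - g (edge k 0)) ->
  (forall k x y, rnorm (G k y - G k x) <= c * `|y - x|) -> 0 < e ->
  exists N, forall n m, (N <= n)%N -> (N <= m)%N -> exists p : (R[i]^o -> Sigma X) * (forall k, R -> X k),
    [/\ admissible p.1 p.2, forall z, strip z -> rnorm (p.1 z) <= e,
        p.1 (pt theta 0) = vertical_quotient g n (pt theta 0) - vertical_quotient g m (pt theta 0) &
        forall k y, rnorm (p.2 k y) <= e].
Proof.
move=> th rn Bg c0 hG lipG e0.
have [|A [d [d0 hcor]]] := @correction R X theta (2 * c) e th _ e0; first by lra.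
have [N hN] := radon_nikodym_quotients rn c0 (lipG false) A d0.
exists N => n m Nn Nm; have {}hN := hN n m Nn Nm.
have an := vertical_quotient_admissible n Bg c0 hG lipG.
have am := vertical_quotient_admissible m Bg c0 hG lipG.
have ad := admissibleD an (admissible_scale (m := fun=> -1) (fun z _ => hol_cst (-1) z) am).
have [C hC] := calderon_B_growth Bg.
have [Cn hn] := vertical_quotient_growth n hC; have [Cm hm] := vertical_quotient_growth m hC.
have FE k y : - 'i *: quotient (G k) n y + -1 *: (- 'i *: quotient (G k) m y) =
    - 'i *: (quotient (G k) n y - quotient (G k) m y) :> X k.
  by rewrite scaleN1r [RHS]scalerBr.
have ni k (x : X k) : rnorm (- 'i *: x) = rnorm x.
  by rewrite rnormZ (etrans (rnormN ('i : R[i]^o)) (rnormi R)) mul1r.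
have [|||||w [W [aw vw wth We]]] := hcor _ _ (2 * c * n.+1%:R + 2 * c * m.+1%:R) (Cn + Cm) ad.
- move=> z sz; rewrite mulrDl scaleN1r; apply: (le_trans (rnormB _ _)).
  by rewrite lerD ?hn ?hm.
- move=> k y; rewrite FE ni; apply: (le_trans (rnormB _ _)).
  by rewrite mulr_natl mulr2n lerD// (quotient_bound (lipG k)).
- by rewrite addr_ge0// !mulr_ge0.
- move=> x y; rewrite !FE -scalerBr ni.
  have := lerD (quotient_lipschitz (lipG false) n x y) (quotient_lipschitz (lipG false) m x y).
  rewrite -mulrDl => /(le_trans (rnormB _ _)).
  by rewrite [X in rnorm X <= _ -> _](_ : _ = quotient (G false) n y - quotient (G false) m y -
    (quotient (G false) n x - quotient (G false) m x)) //; linear_identity.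
- rewrite (_ : (fun y => _) = fun y => rnorm (quotient (G false) n y - quotient (G false) m y))//.
  by apply/funext => y; rewrite FE ni.
exists (w, W); split => //=; last by rewrite wth scaleN1r.
exact: (admissible_maximum aw vw (ltW e0) We).
Qed.

(** The damped first quotient accounts for [c + e/2] and the series of the
corrected differences for the other [e/2]. *)
Lemma B_into_A g (c theta e : R) : 0 < theta < 1 -> radon_nikodym_property (X false) ->
  calderon_B g -> edge_lipschitz g c -> 0 < e ->
  exists f, [/\ calderon_A f, f theta%:C = 'D_1 g theta%:C & calderon_A_norm f <= c + e].
Proof.
move=> th rn Bg lg e0; have c0 := edge_lipschitz_ge0 lg.
have [G [hG lipG]] := edge_increment lg.
have e40 j : 0 < (e / 4) / 2 ^+ j :> R by rewrite !divr_gt0// exprn_gt0.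
have /choice[N hN] j := vertical_quotients_cauchy th rn Bg c0 hG lipG (e40 j).
(* An increasing sequence with n j >= N j and n j >= j. *)
pose n j := (\sum_(i < j.+1) (N i).+1)%N.
have nS j : (n j <= n j.+1)%N by rewrite [n j.+1]/n big_ord_recr leq_addr.
have Nn j : (N j <= n j)%N.
  by rewrite /n big_ord_recr; apply: leq_trans (leqnSn _) (leq_addl _ _).
have jn j : (j <= n j)%N.
  elim: j => // j IH; rewrite [n _]/n big_ord_recr /= -/(n j).
  by rewrite -addn1 leq_add.
have /choice[p hp] j := hN j (n j.+1) (n j) (leq_trans (Nn j) (nS j)) (Nn j).
have [C hC] := calderon_B_growth Bg.
have [Cn hn] := vertical_quotient_growth (n 0%N) hC.
have [||v [V [M [av vM vth Vc]]]] := @damping R X _ _ Cn c (e / 2) theta th c0 _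
    (vertical_quotient_admissible (n 0%N) Bg c0 hG lipG) hn.
- by lra.
- move=> k y; rewrite rnormZ (etrans (rnormN ('i : R[i]^o)) (rnormi R)) mul1r.
  exact: (quotient_bound (lipG k)).
have [|||h [H [ah hh hH]]] := @admissible_series R X (fun j => (p j).1) (fun j => (p j).2) (e / 4).
- by move=> j; have [] := hp j.
- by move=> j; have [] := hp j.
- by move=> j; have [] := hp j.
have h2 z : strip z -> rnorm (h z) <= e / 2.
  by move=> /(hh 0%N); rewrite big_ord0 sub0r rnormN expr0 divr1; lra.
have H2 k y : rnorm (H k y) <= e / 2.
  by have := hH 0%N k y; rewrite big_ord0 sub0r rnormN expr0 divr1; lra.
have [||fA fN] := @admissible_calderon_A R X _ _ (c + e) (M + e / 2) (admissibleD av ah).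
- by move=> z sz; apply: (le_trans (rnormD _ _)); rewrite lerD ?vM ?h2.
- move=> k y; apply: (le_trans (rnormD _ _)); have := Vc k y; have := H2 k y; lra.
exists (fun z => v z + h z); split => //.
have so : open_strip (theta%:C : R[i]^o) := th.
have [_ dg _ _] := Bg; have dt := derivable_cderiv (dg _ so).
have tele j : \sum_(i < j) (p i).1 (pt theta 0) =
    vertical_quotient g (n j) (pt theta 0) - vertical_quotient g (n 0%N) (pt theta 0).
  elim: j => [|j IH]; first by rewrite big_ord0 subrr.
  by rewrite big_ord_recr /= IH; have [_ _ -> _] := hp j; linear_identity.
rewrite -[theta%:C]/(pt theta 0) in dt *; rewrite vth.
apply/eqP; rewrite -subr_eq0; apply/eqP; apply: rnorm_le_eps => d d0.
have d20 : 0 < d / 2 by lra.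
have [N1 hN1] := vertical_quotient_cvg dt d20; have [N2 hN2] := exp2_small (2 * (e / 4)) d20.
pose j := maxn N1 N2.
have k1 := hN1 (n j) (leq_trans (leq_maxl _ _) (jn j)).
have k2 := le_trans (hh j _ (open_strip_strip so)) (hN2 j (leq_maxr _ _)).
rewrite -[theta%:C]/(pt theta 0) tele in k2.
have := rnormB (vertical_quotient g (n j) (pt theta 0) - 'D_1 g (pt theta 0))
  (vertical_quotient g (n j) (pt theta 0) - vertical_quotient g (n 0%N) (pt theta 0) - h (pt theta 0)).
rewrite (_ : _ - _ = vertical_quotient g (n 0%N) (pt theta 0) + h (pt theta 0) - 'D_1 g (pt theta 0)); last first.
  by linear_identity.
by move: k1 k2; lra.
Qed.

End second_into_first.

(** * Equality of the two spaces *)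

Lemma calderon_A_norm_ge0 (R : realType) (X : compatible_pair R) (f : R[i]^o -> Sigma X) :
  calderon_A f -> 0 <= calderon_A_norm f.
Proof.
move=> [_ _ _ hf]; have [F [FE _ [M hM]]] := hf false.
by rewrite le_max (le_trans (rnorm_ge0 (F 0)) (edge_le_sup 0 FE hM)).
Qed.

Lemma calderon_B_norm_ge0 (R : realType) (X : compatible_pair R) (g : R[i]^o -> Sigma X) :
  calderon_B g -> 0 <= calderon_B_norm g.
Proof. by case=> _ _ _ [c hc]; apply: lb_le_inf; [exists c|exact: edge_lipschitz_ge0]. Qed.

Theorem mainTheorem3 (R : realType) (X : compatible_pair R) (theta : R)
    (htheta : 0 < theta < 1)
    (hRN : radon_nikodym_property (X false)) :
  first_calderon X theta = second_calderon X theta /\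
  forall a : Sigma X, first_calderon X theta a ->
    first_calderon_norm theta a = second_calderon_norm theta a.
Proof.
have first_second : first_calderon X theta = second_calderon X theta.
  apply/seteqP; split=> [_ [f [hf <-]]|_ [g [hg <-]]].
    by have [g [hg ge _]] := A_into_B htheta hf; exists g.
  have [_ _ _ [c hc]] := hg.
  by have [f [hf fe _]] := B_into_A htheta hRN hg hc ltr01; exists f.
split=> // a ha; apply/eqP; rewrite eq_le; apply/andP; split.
- move: (ha); rewrite first_second => -[g0 [hg0 ag0]].
  apply: lb_le_inf; first by exists (calderon_B_norm g0), g0.
  move=> _ [g [hg ag ->]]; apply/ler_addgt0Pr => e e0; have e20 : 0 < e / 2 by lra.
  have [_ _ _ [c0 hc0]] := hg.
  have [|c hc /ltW cg] := @inf_adherent _ [set c | edge_lipschitz g c] _ e20.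
    by split; [exists c0|exists 0; exact: edge_lipschitz_ge0].
  have [f [hf fa fn]] := B_into_A htheta hRN hg hc e20.
  apply: (@le_trans _ _ (calderon_A_norm f)); last first.
    by move: fn cg; rewrite -/(calderon_B_norm g); lra.
  apply: ge_inf; last by exists f; rewrite fa.
  by exists 0 => _ [? [/calderon_A_norm_ge0 ? _ ->]].
- have [f0 [hf0 af0]] := ha; apply: lb_le_inf; first by exists (calderon_A_norm f0), f0.
  move=> _ [f [hf af ->]]; have [g [hg ga gn]] := A_into_B htheta hf.
  apply: le_trans gn; apply: ge_inf; last by exists g; rewrite ga.
  by exists 0 => _ [? [/calderon_B_norm_ge0 ? _ ->]].
Qed.
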